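(* Let $U$ be a translation-invariant, uniformly summable interaction on $\mathbb{Z}$ satisfying $$\sum_{A\ni0}\mathrm{diam}(A)\,\|U(A,\cdot)\|_\infty<\infty, \qquad (\ast)$$ and let $\mu$ be the (unique) Gibbs measure on $\Omega=\{0,1\}^{\mathbb{Z}}$ associated to $U$. (1) If there exists a coupling $\mu_{\sigma_{<i}\bar\sigma_i,\sigma_{<i}\sigma_i}$ of the conditional probabilities $\mu_{\sigma_{<i}\bar\sigma_i}$ and $\mu_{\sigma_{<i}\sigma_i}$ such that, for some $q>2$, $$\|\Theta^{1/q}\|_1=\sum_{j\geq1}\Theta(j)^{1/q}<\infty,$$ then there exists a constant $C=C(q)>0$ such that $\mu$ satisfies the Poincaré inequality: for all bounded measurable $f:\Omega\to\mathbb{R}$, $$\mathrm{Var}_\mu(f)\leq C\big(1+\|\Theta^{1/q}\|_1^2\big)\sum_{i\in\mathbb{Z}}\int(\nabla_if)^2\,d\mu .$$ (2) Moreover, if there exist $\alpha>3$ and $C'>0$ such that for all $m\ge1$ $$\sum_{A\ni0,\ \mathrm{diam}(A)>m}\|U(A,\cdot)\|_\infty\leq\frac{C'}{m^\alpha},$$ then such a coupling (i.e. one with $\sum_{j\ge1}\Theta(j)^{1/q}<\infty$ for some $q>2$) exists.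
   Context: $\Omega=\{0,1\}^{\mathbb{Z}}$ with product topology and Borel $\sigma$-field; $(\tau_x\sigma)(y)=\sigma(y-x)$. An interaction is a function $U(A,\sigma)$ of finite $A\subset\mathbb{Z}$ and $\sigma\in\Omega$ with: $U(A,\cdot)$ depends only on $\sigma_A$; $U(A+x,\tau_x\sigma)=U(A,\sigma)$ for all $x$; $\sum_{A\ni0}\sup_\sigma|U(A,\sigma)|<\infty$. With $H^\zeta_\Lambda(\sigma)=\sum_{A\cap\Lambda\neq\emptyset}U(A,\sigma_\Lambda\zeta_{\Lambda^c})$, $\mu$ is a Gibbs measure for $U$ if for every finite $\Lambda$ and $\mu$-a.e. $\zeta$ the conditional distribution of $\sigma_\Lambda$ given $\sigma_{\Lambda^c}=\zeta_{\Lambda^c}$ is proportional to $e^{-H^\zeta_\Lambda(\sigma)}$. Condition $(\ast)$ implies that there is a unique Gibbs measure for $U$. $\nabla_if(\eta)=f(\eta^i)-f(\eta)$, where $\eta^i$ is $\eta$ flipped at $i$. $\mathbb{Z}$ carries its natural order; $\sigma_{<i}$ is the restriction of $\sigma$ to $(-\infty,i)$, $\xi_{>i}$ a configuration on $(i,\infty)$, and $\bar\sigma_i=1-\sigma_i$. $\mu_{\sigma_{<i}\sigma_i}$ (resp. $\mu_{\sigma_{<i}\bar\sigma_i}$) is the conditional distribution under $\mu$ of the configuration on $(i,\infty)$ given the configuration $\sigma_{<i}$ on $(-\infty,i)$ and the value $\sigma_i$ (resp. $\bar\sigma_i$) at $i$. A coupling here is a family, indexed by $i\in\mathbb{Z}$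 and (measurably) $\sigma_{\le i}$, of probability measures $\mu_{\sigma_{<i}\bar\sigma_i,\sigma_{<i}\sigma_i}(d\xi^1_{>i}\,d\xi^2_{>i})$ with first marginal $\mu_{\sigma_{<i}\bar\sigma_i}$ and second marginal $\mu_{\sigma_{<i}\sigma_i}$. For $j\ge1$, $$\Theta(j)=\sup_\sigma\sup_i\int\mathbf{1}_{\{\xi^1_{i+j}\neq\xi^2_{i+j}\}}\,\mu_{\sigma_{<i}\bar\sigma_i,\sigma_{<i}\sigma_i}(d\xi^1_{>i}\,d\xi^2_{>i}),$$ with the supremum over $\sigma$ taken over the ($\mu$-full-measure) set where the conditional distributions are defined. The constant $C(q)$ does not depend on $f$ (it may depend on $U$). *)

(* Defs.v *)
From HB Require Import structures.
From mathcomp Require Import all_boot all_order all_algebra finmap.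
From mathcomp Require Import all_classical all_reals all_analysis.
Set Implicit Arguments.
Unset Strict Implicit.
Unset Printing Implicit Defensive.
Import Order.TTheory GRing.Theory Num.Theory.
Import numFieldNormedType.Exports.
Local Open Scope classical_set_scope.
Local Open Scope ring_scope.

(* {0,1}^I with the Borel sigma-algebra of the product topology *)
Definition config (I : Type) : Type :=
  g_sigma_algebraType (@open (prod_topology (fun _ : I => bool))).

Notation Omega := (config int).

Definition config_on (P : pred int) : Type := config {x : int | P x}.

Definition res (P : pred int) (s : Omega) : config_on P := fun x => s (val x).
Arguments res : clear implicits.

Definition inside (L : {fset int}) : pred int := fun x => x \in L.
Definition outside (L : {fset int}) : pred int := fun x => x \notin L.
Definition upto (i : int) : pred int := fun x => x <= i.
Definition after (i : int) : pred int := fun x => i < x.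

Definition shift (x : int) (s : Omega) : Omega := fun y => s (y - x).

Definition flip (i : int) (s : Omega) : Omega :=
  fun j => if j == i then ~~ s j else s j.

(* the configuration s_Lambda z_{Lambda^c} *)
Definition glue (L : {fset int}) (s z : Omega) : Omega :=
  fun x => if x \in L then s x else z x.

Definition diam (A : {fset int}) : nat :=
  (\max_(x <- A) \max_(y <- A) `|x - y|)%N.

Section interaction.
Variable R : realType.
Implicit Types U : {fset int} -> Omega -> R.

Definition supnorm (f : Omega -> R) : \bar R :=
  ereal_sup [set `|f s|%:E | s in [set: Omega]].

Definition interaction U : Prop :=
  [/\ forall A s s', {in A, s =1 s'} -> U A s = U A s',
      forall x A s, U [fset (y + x)%R | y in A]%fset (shift x s) = U A s &
      (\esum_(A in [set A : {fset int} | (0 : int) \in A]) supnorm (U A)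
        < +oo)%E].

Definition diam_summable U : Prop :=
  (\esum_(A in [set A : {fset int} | (0 : int) \in A])
     ((diam A)%:R%:E * supnorm (U A)) < +oo)%E.

(* H_L^z(s). The series converges absolutely for an interaction; its value is
   the sum of the positive parts minus the sum of the negative parts. *)
Definition hamiltonian U (L : {fset int}) (z s : Omega) : R :=
  let D := [set A : {fset int} | exists2 x : int, x \in A & x \in L] in
  let u := fun A : {fset int} => (U A (glue L s z))%:E in
  fine (esum D (u^\+)%E - esum D (u^\-)%E)%E.

End interaction.

(* kappa is a regular conditional distribution of X given Y under mu *)
Definition cond_distr (R : realType) (d dS dT : measure_display)
    (W : measurableType d) (S : measurableType dS) (T : measurableType dT)
    (mu : probability W R) (X : W -> S) (Y : W -> T)
    (kappa : R.-pker T ~> S) : Prop :=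
  forall (A : set T) (B : set S), measurable A -> measurable B ->
    (mu (Y @^-1` A `&` X @^-1` B) = \int[mu]_(w in Y @^-1` A) kappa (Y w) B)%E.

Definition gibbs (R : realType) (U : {fset int} -> Omega -> R)
    (mu : probability Omega R) : Prop :=
  forall L : {fset int},
    exists2 kappa : R.-pker config_on (outside L) ~> config_on (inside L),
      cond_distr mu (res (inside L)) (res (outside L)) kappa &
      {ae mu, forall z : Omega, exists c : R, forall s : Omega,
        kappa (res (outside L) z) [set res (inside L) s]
          = (c * expR (- hamiltonian U L z s))%:E}.

(* [cp_cond i] is a version of the conditional distribution of the
   configuration on (i, +oo) given the configuration on (-oo, i]; the value at
   i is changed by flipping the argument. [cp_dom] is the set of full measure
   on which these versions are coupled, and over which suprema are taken. *)
Record coupling (R : realType) (mu : probability Omega R) := Coupling {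
  cp_cond : forall i : int, R.-pker config_on (upto i) ~> config_on (after i);
  cp_condP : forall i : int,
    cond_distr mu (res (after i)) (res (upto i)) (cp_cond i);
  cp_dom : set Omega;
  cp_domP : {ae mu, forall s : Omega, cp_dom s};
  cp_ker : forall i : int, R.-pker config_on (upto i)
             ~> (config_on (after i) * config_on (after i))%type;
  cp_marg1 : forall (i : int) (s : Omega) (B : set (config_on (after i))),
    cp_dom s -> measurable B ->
    cp_ker i (res (upto i) s) (fst @^-1` B)
      = cp_cond i (res (upto i) (flip i s)) B;
  cp_marg2 : forall (i : int) (s : Omega) (B : set (config_on (after i))),
    cp_dom s -> measurable B ->
    cp_ker i (res (upto i) s) (snd @^-1` B) = cp_cond i (res (upto i) s) B
}.

(* the pairs that differ at the site i + j, which is a site of (i, +oo) when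
   0 < j *)
Definition disagree (i : int) (j : nat) :
    set (config_on (after i) * config_on (after i)) :=
  [set p | exists2 k : {x : int | after i x},
             val k = i + j%:Z & p.1 k != p.2 k].
Arguments disagree : clear implicits.

Section Theta.
Variables (R : realType) (mu : probability Omega R) (K : coupling mu).

Definition Theta (j : nat) : \bar R :=
  ereal_sup [set t | exists i : int, exists2 s : Omega,
    cp_dom K s & t = cp_ker K i (res (upto i) s) (disagree i j)].

Definition Theta_norm (q : R) : \bar R :=
  (\sum_(1 <= j <oo) (Theta j `^ q^-1))%E.

End Theta.

Definition dirichlet (R : realType) (mu : probability Omega R)
    (f : Omega -> R) : \bar R :=
  (\esum_(i in [set: int]) \int[mu]_s ((f (flip i s) - f s) ^+ 2)%:E)%E.

(* Main.v *)
Require Import Defs.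
From HB Require Import structures.
From mathcomp Require Import all_boot all_order all_algebra finmap.
From mathcomp Require Import all_classical all_reals all_analysis.
From mathcomp Require Import measurable_realfun.
From mathcomp Require Import zify ring lra.
Set Implicit Arguments.
Unset Strict Implicit.
Unset Printing Implicit Defensive.
Import Order.TTheory GRing.Theory Num.Theory.
Import numFieldNormedType.Exports.
Local Open Scope classical_set_scope.
Local Open Scope ring_scope.

(** Revealing the spins from left to right splits the variance into the sum over
    k of E[D_k^2], where D_k is the effect of the spin at k on the conditional
    expectation. Coupling the two conditional laws on a block to the right of k
    bounds D_k by gradients of f in the block and by the D_y with y beyond the
    block; the latter carry weights made of the interaction between y and the
    sites of disagreement. By diam_summable and the summability of Theta^(1/q)
    these weights have a small sum when the block is long, so the D_y can be
    absorbed in the left-hand side. All this is done for finite-volume averages,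
    uniformly in the boundary condition. The constant obtained from one coupling
    is a property of mu, and thus serves for all couplings.

    A coupling is built site by site from the one-sided conditional
    probabilities, with an optimal coupling at each site, by subdividing [0,1)
    according to a single uniform variable. When two pasts agree on the last n
    sites, the next spins differ with probability at most
    b_n = O(n^(-(alpha - 1))). Hence the disagreement at distance j is dominated
    by the probability that a transient house-of-cards chain is back at 0, a
    renewal sequence which is again O(j^(-(alpha - 1))). As alpha > 3, one can
    choose 2 < q < alpha - 1. *)

(** The given coupling lives under mu, at almost every past and on a half-line, whereas the block
    estimate is needed in every finite volume and for every boundary condition. Only its restriction
    to a block of fixed length [ell] is used. By loss of memory, which follows from [diam_summable]
    uniformly in the boundary condition, the law of the block in a large volume is close to the
    conditional law under mu at some typical past. Every pattern of the block has probability at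
    least [dlt U ^+ ell], so this additive error is a relative one and is repaired by a little
    independent coupling. Near the right end of the volume, the independent coupling up to the end
    is used instead. The Cauchy-Schwarz inequality splits a disagreement probability into two
    factors and asks for a summable [th] with Theta <= th^2; since Theta <= 1 and q > 2, Theta^(1/q)
    is such a sequence. In finite volume all sums are finite, so that absorption is a subtraction.
    The passage to mu rests on triviality of the tail, again by loss of memory. *)

(** * Patterns of spins on finitely many sites *)

Definition upd (s : Omega) (x : int) (b : bool) : Omega :=
  fun y => if y == x then b else s y.

Fixpoint bits (n : nat) : seq (seq bool) :=
  if n is n'.+1 then [seq b :: v | b <- [:: true; false], v <- bits n'] else [:: [::]].

(** A pattern is a list of booleans read along a list of sites, which turns sums over patterns into
    sums over [bits]. A missing value is read as [false], and for a repeated site the first entry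
    counts. *)
Definition asg (l : seq int) (v : seq bool) (s : Omega) : Omega :=
  fun y => if y \in l then nth false v (index y l) else s y.

Definition obs (l : seq int) (s : Omega) : seq bool := [seq s x | x <- l].

Definition eqoff (Q : set int) (s s' : Omega) : Prop :=
  forall x, ~ Q x -> s x = s' x.

Definition sset (l : seq int) : set int := [set x | x \in l].

Section bits.
Variable R : comNzRingType.

Lemma bits_size n v : v \in bits n -> size v = n.
Proof.
elim: n v => [|n IH] v /=; first by rewrite inE => /eqP ->.
by rewrite !mem_cat !in_nil orbF => /orP[] /mapP[w /IH <- ->].
Qed.

Lemma mem_bits v : v \in bits (size v).
Proof.
elim: v => [|b v IH] //=; rewrite !mem_cat in_nil orbF.
by apply/orP; case: b; [left|right]; apply/mapP; exists v.
Qed.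

Lemma mem_bitsE n v : (v \in bits n) = (size v == n).
Proof.
by apply/idP/eqP => [/bits_size //|<-]; exact: mem_bits.
Qed.

Lemma bits_uniq n : uniq (bits n).
Proof.
elim: n => //= n IH; rewrite cats0 cat_uniq !map_inj_uniq ?IH /=;
  try by move=> ? ? [].
rewrite andbT; apply/hasPn => w /mapP[u _ ->]; apply/mapP => -[? _ //].
Qed.

Lemma sum_bitsS n (f : seq bool -> R) :
  \sum_(v <- bits n.+1) f v =
  \sum_(v <- bits n) f (true :: v) + \sum_(v <- bits n) f (false :: v).
Proof. by rewrite /= cats0 big_cat !big_map. Qed.

Lemma sum_bitsD m n (f : seq bool -> R) :
  \sum_(v <- bits (m + n)) f v =
  \sum_(v <- bits m) \sum_(w <- bits n) f (v ++ w).
Proof.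
elim: m f => [|m IH] f; first by rewrite /= big_seq1.
by rewrite addSn !sum_bitsS !IH.
Qed.

End bits.

Lemma asg0 v s : asg [::] v s = s.
Proof. by []. Qed.

Lemma asg_cons x l b v s : asg (x :: l) (b :: v) s = upd (asg l v s) x b.
Proof.
apply/funext => y; rewrite /asg /upd inE /= eq_sym.
by case: (x =P y).
Qed.

Lemma asg1 x b s : asg [:: x] [:: b] s = upd s x b.
Proof. by rewrite asg_cons asg0. Qed.

Lemma asg_cat l1 l2 v1 v2 s : size v1 = size l1 ->
  asg (l1 ++ l2) (v1 ++ v2) s = asg l1 v1 (asg l2 v2 s).
Proof.
move=> sv; apply/funext => y; rewrite /asg mem_cat index_cat nth_cat sv.
case: (boolP (y \in l1)) => /= y1; first by rewrite index_mem y1.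
by rewrite ltnNge leq_addr /= addKn.
Qed.

Lemma asgC l1 l2 v1 v2 s : (forall x, x \in l1 -> x \notin l2) ->
  asg l1 v1 (asg l2 v2 s) = asg l2 v2 (asg l1 v1 s).
Proof.
move=> dis; apply/funext => y; rewrite /asg.
by case: (boolP (y \in l1)) => // /dis/negbTE ->.
Qed.

Lemma asgK l v w s : asg l v (asg l w s) = asg l v s.
Proof. by apply/funext => y; rewrite /asg; case: (y \in l). Qed.

Lemma asg_notin l v s x : x \notin l -> asg l v s x = s x.
Proof. by rewrite /asg => /negbTE ->. Qed.

Lemma upd_asg x b s : upd s x b = asg [:: x] [:: b] s.
Proof. by rewrite asg1. Qed.

Lemma size_obs l s : size (obs l s) = size l.
Proof. by rewrite size_map. Qed.

Lemma obs_bits l s : obs l s \in bits (size l).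
Proof. by rewrite -(size_obs l s) mem_bits. Qed.

Lemma asg_obs l s s' : asg l (obs l s) s' = fun y => if y \in l then s y else s' y.
Proof.
apply/funext => y; rewrite /asg; case: ifP => // yl.
by rewrite (nth_map 0) ?index_mem// nth_index.
Qed.

Lemma asg_obsK l s : asg l (obs l s) s = s.
Proof. by rewrite asg_obs; apply/funext => y; case: ifP. Qed.

Lemma obs_asg l v s : uniq l -> size v = size l -> obs l (asg l v s) = v.
Proof.
move=> ul sv; apply: (@eq_from_nth _ false); rewrite size_obs// => i il.
rewrite (nth_map 0)// /asg mem_nth//= index_uniq//.
Qed.

Lemma asg_eqoff l v s s' : eqoff (sset l) s s' -> asg l v s = asg l v s'.
Proof.
move=> h; apply/funext => y; rewrite /asg; case: ifPn => // yl.
by apply: h; exact/negP.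
Qed.

Lemma eqoff_sym Q s s' : eqoff Q s s' -> eqoff Q s' s.
Proof. by move=> h x /h. Qed.

Lemma eqoff_sub Q Q' s s' : Q `<=` Q' -> eqoff Q s s' -> eqoff Q' s s'.
Proof. by move=> sub h x Qx; apply: h => /sub. Qed.

Lemma eqoff_asgl l v s : eqoff (sset l) (asg l v s) s.
Proof. by move=> x /negP; exact: asg_notin. Qed.

(** * Sums over the patterns of a finite set of sites *)

Section ssum.
Variable R : realType.
Implicit Types (Q F W : Omega -> R) (l : seq int).

Definition ssum l Q (s : Omega) : R := \sum_(v <- bits (size l)) Q (asg l v s).

(** Locality is expressed negatively: a function of the spins in [l] alone is one that is invariant
    on the complement of [sset l]. *)
Definition inv_on (D : set int) Q := forall s s', eqoff D s s' -> Q s = Q s'.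

Lemma ssum0 Q : ssum [::] Q = Q.
Proof. by apply/funext => s; rewrite /ssum big_seq1 asg0. Qed.

Lemma ssum_cat l1 l2 Q : ssum (l1 ++ l2) Q =
  fun s => \sum_(v1 <- bits (size l1)) \sum_(v2 <- bits (size l2))
     Q (asg l1 v1 (asg l2 v2 s)).
Proof.
apply/funext => s; rewrite /ssum size_cat sum_bitsD.
rewrite big_seq [RHS]big_seq; apply: eq_bigr => v /bits_size sv.
by apply: eq_bigr => w _; rewrite asg_cat.
Qed.

Definition disj l1 l2 := forall x : int, x \in l1 -> x \notin l2.

Lemma ssum_catl l1 l2 Q : disj l1 l2 -> ssum (l1 ++ l2) Q = ssum l1 (ssum l2 Q).
Proof.
move=> d; rewrite ssum_cat; apply/funext => s; apply: eq_bigr => v1 _.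
by apply: eq_bigr => v2 _; rewrite asgC.
Qed.

Lemma ssum_catC l1 l2 Q : disj l1 l2 -> ssum (l1 ++ l2) Q = ssum (l2 ++ l1) Q.
Proof.
move=> d; rewrite !ssum_cat; apply/funext => s; rewrite exchange_big /=.
by apply: eq_bigr => v1 _; apply: eq_bigr => v2 _; rewrite asgC.
Qed.

Lemma ssum_cons x l Q s : x \notin l ->
  ssum (x :: l) Q s = ssum l Q (upd s x true) + ssum l Q (upd s x false).
Proof.
move=> xl; rewrite -cat1s ssum_catl; last by move=> y; rewrite inE => /eqP ->.
by rewrite {1}/ssum /= big_cons big_seq1 !asg1.
Qed.

Lemma ssum_inv l Q : inv_on (sset l) (ssum l Q).
Proof.
by move=> s s' e; apply: eq_bigr => v _; rewrite (asg_eqoff v e).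
Qed.

Lemma ssumM l Q F s : inv_on (sset l) F ->
  ssum l (fun s => Q s * F s) s = ssum l Q s * F s.
Proof.
move=> iF; rewrite /ssum mulr_suml; apply: eq_bigr => v _; congr (_ * _).
by apply: iF; exact: eqoff_asgl.
Qed.

Lemma ssumD l Q F s : ssum l (fun s => Q s + F s) s = ssum l Q s + ssum l F s.
Proof. by rewrite /ssum big_split. Qed.

Lemma ssumZ l c Q s : ssum l (fun s => c * Q s) s = c * ssum l Q s.
Proof. by rewrite /ssum mulr_sumr. Qed.

Lemma ssum_le l Q F s : (forall s', eqoff (sset l) s' s -> Q s' <= F s') ->
  ssum l Q s <= ssum l F s.
Proof. by move=> h; apply: ler_sum => v _; apply/h/eqoff_asgl. Qed.

Lemma eq_ssum l Q F s : (forall s', eqoff (sset l) s' s -> Q s' = F s') ->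
  ssum l Q s = ssum l F s.
Proof. by move=> h; apply: eq_bigr => v _; apply/h/eqoff_asgl. Qed.

Lemma bits_cons n : exists v r, bits n = v :: r.
Proof.
have : nseq n true \in bits n by rewrite mem_bitsE size_nseq.
by case: (bits n) => // v r _; exists v, r.
Qed.

Lemma ssum_gt0 l Q s : (forall s, 0 < Q s) -> 0 < ssum l Q s.
Proof.
move=> Q0; rewrite /ssum; have [v [r ->]] := bits_cons (size l).
rewrite big_cons ltr_pwDl//; apply: sumr_ge0 => *; exact: ltW.
Qed.

Lemma ssum_ge0 l Q s : (forall s', eqoff (sset l) s' s -> 0 <= Q s') -> 0 <= ssum l Q s.
Proof. by move=> h; apply: sumr_ge0 => v _; apply/h/eqoff_asgl. Qed.

End ssum.

Lemma ssum_perm (R : realType) (l l' : seq int) (Q : Omega -> R) :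
  uniq l -> perm_eq l l' -> ssum l Q = ssum l' Q.
Proof.
elim: l l' Q => [|x l IH] l' Q.
  by move=> _; rewrite perm_sym => /perm_nilP ->.
move=> ul pl; have ul' : uniq l' by rewrite -(perm_uniq pl).
have xl' : x \in l' by rewrite -(perm_mem pl) mem_head.
case/splitPr: xl' pl ul' => l1 l2 pl ul'.
have d : disj l1 (x :: l2).
  move: ul'; rewrite cat_uniq => /and3P[_ /hasPn h _] y y1.
  by apply/negP => /h; rewrite y1.
have pl2 : perm_eq l (l2 ++ l1).
  rewrite -(perm_cons x); apply: (perm_trans pl).
  by rewrite (perm_catC l1 (x :: l2)) perm_refl.
move: ul => /= /andP[xl ul].
have dx (r : seq int) : x \notin r -> disj [:: x] r by move=> xr y; rewrite inE => /eqP ->.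
rewrite (ssum_catC _ d) cat_cons -(cat1s x l) -(cat1s x (l2 ++ l1)).
rewrite (ssum_catl _ (dx _ xl)) ssum_catl; first by rewrite (IH _ Q ul pl2).
by apply: dx; rewrite -(perm_mem pl2).
Qed.

(** * Weighted averages over the spins of a finite set *)

Section wavg.
Variable R : realType.
Implicit Types (Q F W : Omega -> R) (l : seq int).

(** The conditional expectation of [F] given the spins off [l], for a density proportional to
    [W]. *)
Definition wavg W l F (s : Omega) : R :=
  ssum l (fun s => W s * F s) s / ssum l W s.

Section basic.
Variables (W : Omega -> R) (W0 : forall s, 0 < W s).

Lemma wavg0 F : wavg W [::] F = F.
Proof. by apply/funext => s; rewrite /wavg !ssum0 mulrAC divff ?mul1r// gt_eqF. Qed.

Lemma wavg_inv l F : inv_on (sset l) (wavg W l F).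
Proof. by move=> s s' e; rewrite /wavg; congr (_ / _); exact: ssum_inv. Qed.

Lemma wavgMr l F G s : inv_on (sset l) G ->
  wavg W l (fun s => F s * G s) s = wavg W l F s * G s.
Proof.
move=> iG; rewrite /wavg mulrAC -(ssumM _ _ iG); congr (_ / _).
by apply: eq_ssum => s' _; rewrite mulrA.
Qed.

Lemma wavg1 l s : wavg W l (fun=> 1) s = 1.
Proof.
rewrite /wavg (eq_ssum (F := W)) ?divff ?gt_eqF ?ssum_gt0// => s' _.
by rewrite mulr1.
Qed.

Lemma wavg_id l G s : inv_on (sset l) G -> wavg W l G s = G s.
Proof.
move=> iG; have := wavgMr (fun=> 1) s iG; rewrite wavg1 mul1r => <-.
by congr wavg; apply/funext => ?; rewrite mul1r.
Qed.

Lemma wavgD l F G s :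
  wavg W l (fun s => F s + G s) s = wavg W l F s + wavg W l G s.
Proof.
rewrite /wavg -mulrDl -ssumD; congr (_ / _).
by apply: eq_ssum => s' _; rewrite mulrDr.
Qed.

Lemma wavgZ l c F s : wavg W l (fun s => c * F s) s = c * wavg W l F s.
Proof.
rewrite /wavg mulrA -ssumZ; congr (_ / _).
by apply: eq_ssum => s' _; rewrite mulrCA.
Qed.

Lemma wavgB l F G s :
  wavg W l (fun s => F s - G s) s = wavg W l F s - wavg W l G s.
Proof.
rewrite wavgD; congr (_ + _); rewrite -mulN1r -wavgZ.
by congr wavg; apply/funext => ?; rewrite mulN1r.
Qed.

Lemma wavg_sum I (r : seq I) (P : pred I) l (F : I -> Omega -> R) s :
  wavg W l (fun s => \sum_(i <- r | P i) F i s) s =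
  \sum_(i <- r | P i) wavg W l (F i) s.
Proof.
elim: r => [|i r IH].
  rewrite big_nil (_ : (fun _ => _) = fun=> 0 * 1); first by rewrite wavgZ mul0r.
  by apply/funext => t; rewrite big_nil mul0r.
rewrite big_cons -IH; case: ifP => Pi.
  by rewrite -wavgD; congr wavg; apply/funext => t; rewrite big_cons Pi.
by congr wavg; apply/funext => t; rewrite big_cons Pi.
Qed.

Lemma wavg_le l F G s : (forall s', eqoff (sset l) s' s -> F s' <= G s') ->
  wavg W l F s <= wavg W l G s.
Proof.
move=> h; rewrite ler_pM2r ?invr_gt0 ?ssum_gt0//; apply: ssum_le => s' e.
by rewrite ler_pM2l// h.
Qed.

Lemma eq_wavg l F G s : (forall s', eqoff (sset l) s' s -> F s' = G s') ->
  wavg W l F s = wavg W l G s.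
Proof. by move=> h; congr (_ / _); apply: eq_ssum => s' /h ->. Qed.

Lemma wavg_ge0 l F s : (forall s', eqoff (sset l) s' s -> 0 <= F s') ->
  0 <= wavg W l F s.
Proof.
move=> h; apply: divr_ge0; apply: ssum_ge0 => s' e; last exact: ltW.
by apply: mulr_ge0; [exact: ltW|exact: h].
Qed.

Lemma wavg_norm l F s : `|wavg W l F s| <= wavg W l (fun s => `|F s|) s.
Proof.
rewrite ler_norml; apply/andP; split; last first.
  by apply: wavg_le => s' _; exact: ler_norm.
rewrite lerNl -mulN1r -wavgZ; apply: wavg_le => s' _.
by rewrite mulN1r -normrN ler_norm.
Qed.

Lemma wavg_sqr l F s : wavg W l F s ^+ 2 <= wavg W l (fun s => F s ^+ 2) s.
Proof.
set m := wavg W l F s; rewrite -subr_ge0.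
have -> : wavg W l (fun s => F s ^+ 2) s - m ^+ 2 =
          wavg W l (fun s => (F s - m) ^+ 2) s.
  rewrite (eq_wavg (F := fun s => (F s - m) ^+ 2)
    (G := fun t => (F t ^+ 2 - (2 * m) * F t) + m ^+ 2 * 1)); last by move=> *; ring.
  by rewrite wavgD wavgB !wavgZ wavg1 -/m; ring.
by apply: wavg_ge0 => *; exact: sqr_ge0.
Qed.

(** One weight serves at both levels: the inner average does not depend on the spins in [l2], so
    summing over them reproduces the normalising sum by which it was divided. *)
Lemma wavg_tower l1 l2 F : disj l1 l2 ->
  wavg W (l1 ++ l2) F = wavg W (l1 ++ l2) (wavg W l2 F).
Proof.
move=> d; apply/funext => s; rewrite /wavg; congr (_ / _).
rewrite !ssum_catl//; apply: eq_ssum => s' _.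
rewrite -[in RHS]/(wavg W l2 F) [RHS](ssumM _ _ (@wavg_inv l2 F)).
by rewrite /wavg mulrCA divff ?mulr1// gt_eqF// ssum_gt0.
Qed.

Lemma wavg_catC l1 l2 F : disj l1 l2 -> wavg W (l1 ++ l2) F = wavg W (l2 ++ l1) F.
Proof. by move=> d; apply/funext => s; rewrite /wavg !(ssum_catC _ d). Qed.

Definition wt l v s := W (asg l v s) / ssum l W s.

Lemma wavgE l F s :
  wavg W l F s = \sum_(v <- bits (size l)) wt l v s * F (asg l v s).
Proof.
by rewrite /wavg mulr_suml; apply: eq_bigr => v _; rewrite /wt mulrAC.
Qed.

Lemma wt_gt0 l v s : 0 < wt l v s.
Proof. by rewrite divr_gt0// ssum_gt0. Qed.

Lemma wt_sum l s : \sum_(v <- bits (size l)) wt l v s = 1.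
Proof.
by rewrite -[RHS](wavg1 l s) wavgE; apply: eq_bigr => v _; rewrite mulr1.
Qed.

(* F may refer to coordinates outside l, on which s and s' may differ *)
Lemma wavg_ratio l F F' c s s' :
  (forall v v', v \in bits (size l) -> v' \in bits (size l) ->
     W (asg l v s) * W (asg l v' s') <=
     c * (W (asg l v' s) * W (asg l v s'))) ->
  (forall v, v \in bits (size l) ->
     0 <= F (asg l v s) <= F' (asg l v s')) ->
  wavg W l F s <= c * wavg W l F' s'.
Proof.
move=> hW hF; rewrite /wavg ler_pdivrMr ?ssum_gt0//.
rewrite (_ : forall a b d e : R, a * (b / d) * e = a * (b * e) / d) => [|a b d e]; last by ring.
rewrite ler_pdivlMr ?ssum_gt0// /ssum mulr_suml mulr_suml mulr_sumr.
rewrite [leLHS]big_seq [leRHS]big_seq; apply: ler_sum => v vl.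
rewrite !mulr_sumr [leLHS]big_seq [leRHS]big_seq; apply: ler_sum => v' vl'.
have /andP[F0 FF] := hF v vl.
apply: (@le_trans _ _ (c * (W (asg l v' s) * W (asg l v s')) * F (asg l v s))).
  by have := ler_wpM2r F0 (hW _ _ vl vl'); nra.
have : 0 <= c * (W (asg l v' s) * W (asg l v s')).
  by apply: le_trans (hW _ _ vl vl'); rewrite mulr_ge0 ?ltW.
move=> /ler_wpM2l => /(_ _ _ FF); lra.
Qed.

End basic.

(** The cross-product condition says that [W] and [W'] are proportional along the patterns on [l],
    with a ratio that may depend on the spins off [l]; the ratio cancels. *)
Lemma wavg_weight (W W' : Omega -> R) l F s :
  (forall s, 0 < W s) ->  (forall s, 0 < W' s) ->
  (forall v v', v \in bits (size l) -> v' \in bits (size l) ->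
    W (asg l v s) * W' (asg l v' s) = W (asg l v' s) * W' (asg l v s)) ->
  wavg W l F s = wavg W' l F s.
Proof.
move=> W0 W0' h; have nz V : (forall s, 0 < V s) -> ssum l V s != 0.
  by move=> V0; rewrite gt_eqF// ssum_gt0.
apply/eqP; rewrite /wavg eqr_div ?nz//; apply/eqP.
rewrite /ssum !mulr_suml big_seq [RHS]big_seq; apply: eq_bigr => v vl.
rewrite !mulr_sumr big_seq [RHS]big_seq; apply: eq_bigr => v' vl'.
by have := h _ _ vl vl' => e; rewrite mulrAC e; ring.
Qed.

End wavg.

(** * Unordered sums, with and without signs *)

Section esum_extra.
Variables (R : realType) (T : choiceType).
Implicit Types (D E : set T) (f g : T -> R).
Local Open Scope ereal_scope.

Lemma esum_subset D E (a : T -> \bar R) : D `<=` E ->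
  \esum_(i in D) a i <= \esum_(i in E) a i.
Proof.
move=> DE; apply: ge_ereal_sup => _ [X [finX XD] <-].
by apply: ereal_sup_ubound; exists X => //; split => // x /XD /DE.
Qed.

(** Subadditivity for pieces that may overlap: an unordered sum is a supremum over finite sets, and
    a finite set is covered by finitely many pieces. *)
Lemma esum_cover D (Dj : nat -> set T) (a : T -> \bar R) C :
  (forall x, 0 <= a x) -> (forall x, D x -> exists j, Dj j x) ->
  (forall N, \sum_(j < N) \esum_(i in Dj j) a i <= C) ->
  \esum_(i in D) a i <= C.
Proof.
move=> a0 cov bnd; apply: ge_ereal_sup => _ [X [finX XD] <-].
have [N hN] : exists N : nat, forall x, X x -> exists2 j, (j < N)%N & Dj j x.
  have /finite_seqP[s Xs] := finX; elim: s X Xs finX XD => [|y s IH] X -> finX XD.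
    by exists 0%N => x; rewrite /= in_nil.
  have [|||N hN] := IH [set` s]; [by []|exact: finite_seq| |].
    by move=> z zs; apply: XD => /=; rewrite inE zs orbT.
  have [|j Dy] := cov y; first by apply: XD; rewrite /= mem_head.
  exists (maxn N j.+1) => x; rewrite /= inE => /orP[/eqP ->|/hN[k kN Dk]].
    by exists j; rewrite // leq_max leqnn orbT.
  by exists k => //; rewrite leq_max kN.
apply: le_trans (bnd N).
apply: (@le_trans _ _ (\sum_(x \in X) \sum_(j < N) if x \in Dj j then a x else 0)).
  apply: lee_fsum => // x /hN[j jN Dx].
  rewrite (bigD1 (Ordinal jN))//= mem_set// leeDl// sume_ge0// => i _.
  by case: ifP.
rewrite fsbig_finite// exchange_big /=; apply: lee_sum => j _.
rewrite -fsbig_finite// esum_mkcond; apply: ereal_sup_ubound.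
by exists X.
Qed.

(** Written in the form in which [hamiltonian] computes its series, so that energies become
    instances of it. *)
Definition asum D f : R :=
  fine (esum D (fun x => (f x)%:E)^\+ - esum D (fun x => (f x)%:E)^\-).

Definition asummable D f := \esum_(x in D) `|f x|%:E < +oo.

Lemma asummableW D f : asummable D f -> summable D (fun x => (f x)%:E).
Proof. by []. Qed.

Lemma asummable_le D f g : (forall x, D x -> `|f x| <= `|g x|)%R ->
  asummable D g -> asummable D f.
Proof.
move=> h; apply: le_lt_trans; apply: le_esum => x /h; by rewrite lee_fin.
Qed.

Lemma fin_esum D (a : T -> \bar R) : (forall x, 0 <= a x) ->
  \esum_(x in D) a x < +oo -> \esum_(x in D) a x \is a fin_num.
Proof. by move=> a0 h; rewrite ge0_fin_numE// esum_ge0. Qed.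

(** Positive parts are not additive. The sum is represented as the difference of F^+ + G^+ and F^- +
    G^-, and by [esumB] the value does not depend on the representation as a difference of
    nonnegative summable families. *)
Lemma asumD D f g : asummable D f -> asummable D g ->
  asum D (fun x => f x + g x)%R = (asum D f + asum D g)%R.
Proof.
move=> /asummableW sf /asummableW sg.
have sfp := summable_funepos sf; have sfn := summable_funeneg sf.
have sgp := summable_funepos sg; have sgn := summable_funeneg sg.
set F := (fun x => (f x)%:E) in sf sfp sfn *; set G := (fun x => (g x)%:E) in sg sgp sgn *.
have e x : D x -> (F^\+ x + G^\+ x) - (F^\- x + G^\- x) = (f x + g x)%R%:E.
  move=> _; rewrite /F /G !funeposE !funenegE -!EFinN -!EFin_max -!(EFinD, EFinN).
  congr EFin; rewrite /Num.max; do 4 case: ifP => ?; lra.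
have fpos (h : T -> \bar R) : summable D h -> (forall x, 0 <= h x) -> esum D h \is a fin_num.
  move=> sh h0; apply: fin_esum => //; apply: le_lt_trans sh.
  by apply: le_esum => x _; rewrite gee0_abs.
have pos (h : T -> R) x : 0 <= (EFin \o h)^\+ x by exact: funepos_ge0.
have neg (h : T -> R) x : 0 <= (EFin \o h)^\- x by exact: funeneg_ge0.
have := @esumB R T D (F^\+ \+ G^\+) (F^\- \+ G^\-)
  (summableD sfp sgp) (summableD sfn sgn)
  (fun i _ => adde_ge0 (pos f i) (pos g i)) (fun i _ => adde_ge0 (neg f i) (neg g i)).
rewrite !esumD//.
move=> E; rewrite /asum.
have -> : esum D (fun x => (f x + g x)%R%:E)^\+ =
    esum D ((F^\+ \+ G^\+) \- (F^\- \+ G^\-))^\+.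
  by apply: eq_esum => x Dx; rewrite funeposE [RHS]funeposE [in RHS]/= (e x Dx).
have -> : esum D (fun x => (f x + g x)%R%:E)^\- =
    esum D ((F^\+ \+ G^\+) \- (F^\- \+ G^\-))^\-.
  by apply: eq_esum => x Dx; rewrite funenegE [RHS]funenegE [in RHS]/= (e x Dx).
have -> : esum D ((F^\+ \+ G^\+) \- (F^\- \+ G^\-))^\+
          - esum D ((F^\+ \+ G^\+) \- (F^\- \+ G^\-))^\- =
         esum D F^\+ + esum D G^\+ - (esum D F^\- + esum D G^\-) by rewrite -E.
have := fpos _ sfp (pos f); have := fpos _ sfn (neg f).
have := fpos _ sgp (pos g); have := fpos _ sgn (neg g).
rewrite -/F -/G.
move=> /fineK <- /fineK <- /fineK <- /fineK <-.
rewrite -!(EFinD, EFinN) /=; ring.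
Qed.

Lemma asumN D f : asum D (fun x => - f x)%R = (- asum D f)%R.
Proof.
rewrite /asum.
have -> : (fun x => (- f x)%R%:E) = \- (fun x => (f x)%:E) by apply/funext.
rewrite funeposN funenegN.
set a := esum _ _; set b := esum _ _.
have [a0 b0] : 0 <= a /\ 0 <= b.
  by split; apply: esum_ge0 => x _; [exact: funeneg_ge0|exact: funepos_ge0].
by case: a b a0 b0 => [a| |] [b| |]//= _ _; rewrite ?opprB// ?oppr0.
Qed.

Lemma asummableN D f : asummable D f -> asummable D (fun x => - f x)%R.
Proof. by apply: asummable_le => x _; rewrite normrN. Qed.

Lemma asummableD D f g : asummable D f -> asummable D g ->
  asummable D (fun x => f x + g x)%R.
Proof. move=> /asummableW sf /asummableW sg; exact: (summableD sf sg). Qed.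

Lemma asumB D f g : asummable D f -> asummable D g ->
  asum D (fun x => f x - g x)%R = (asum D f - asum D g)%R.
Proof. by move=> sf sg; rewrite asumD// ?asumN//; exact: asummableN. Qed.

Lemma asum_le_esum D f : asummable D f ->
  (asum D f)%:E <= \esum_(x in D) `|f x|%:E.
Proof.
move=> /asummableW sf; have sfp := summable_funepos sf; have sfn := summable_funeneg sf.
have fpos (h : T -> \bar R) : summable D h -> (forall x, 0 <= h x) -> esum D h \is a fin_num.
  move=> sh h0; apply: fin_esum => //; apply: le_lt_trans sh.
  by apply: le_esum => x _; rewrite gee0_abs.
have pos x : 0 <= (fun x => (f x)%:E)^\+ x by exact: funepos_ge0.
have neg x : 0 <= (fun x => (f x)%:E)^\- x by exact: funeneg_ge0.
rewrite /asum fineK; last by rewrite fin_numB !fpos.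
apply: (@le_trans _ _ (esum D (fun x => (f x)%:E)^\+)).
  by rewrite leeBlDr ?fpos// leeDl// esum_ge0.
apply: le_esum => x _; rewrite funeposE -EFin_max lee_fin.
by rewrite ge_max ler_norm normr_ge0.
Qed.

End esum_extra.

(** * Energy of interaction between two regions *)

Lemma diam_ge (A : {fset int}) x y : x \in A -> y \in A -> (`|x - y|%N <= diam A)%N.
Proof.
move=> xA yA; rewrite /diam.
apply: (@leq_trans (\max_(z <- A) `|x - z|%N)).
  by apply: (@leq_bigmax_seq _ _ xpredT (fun z : int => absz (x - z)) y).
by apply: (@leq_bigmax_seq _ _ xpredT (fun w : int => \max_(z <- A) absz (w - z))%N x).
Qed.

Definition trans (x : int) (A : {fset int}) : {fset int} := [fset (y + x)%R | y in A]%fset.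

Lemma mem_trans x A y : (y \in trans x A) = (y - x \in A).
Proof.
apply/imfsetP/idP => [[z /= zA ->]|yA]; first by rewrite addrK.
by exists (y - x) => //; rewrite subrK.
Qed.

Lemma transK x A : trans (- x) (trans x A) = A.
Proof. by apply/fsetP => y; rewrite !mem_trans opprK addrK. Qed.

Lemma transNK x A : trans x (trans (- x) A) = A.
Proof. by rewrite -{1}[x]opprK transK. Qed.

Section energy.
Variables (R : realType) (U : {fset int} -> Omega -> R).
Hypotheses (U_int : interaction U) (U_diam : diam_summable U).
Local Open Scope ereal_scope.

Let at0 : set {fset int} := [set A : {fset int} | (0 : int) \in A].

Lemma supnorm_ge0 (f : Omega -> R) : 0 <= supnorm f.
Proof.
apply: (@le_trans _ _ `|f (fun=> true)|%:E); first by rewrite lee_fin.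
by apply: ereal_sup_ubound; exists (fun=> true).
Qed.

Lemma le_supnorm (f : Omega -> R) s : `|f s|%:E <= supnorm f.
Proof. by apply: ereal_sup_ubound; exists s. Qed.

Lemma supnorm_trans x A : supnorm (U (trans x A)) = supnorm (U A).
Proof.
case: U_int => _ inv _; congr ereal_sup; apply/seteqP; split => _ [s _ <-].
  exists (Defs.shift (- x) s) => //; rewrite -(inv x A); congr (`|U _ _|%:E).
  by apply/funext => y; rewrite /Defs.shift opprK subrK.
by exists (Defs.shift x s) => //; rewrite inv.
Qed.

Definition r1 : R := fine (\esum_(A in at0) supnorm (U A)).
(** [tt j] controls the interaction of one site with everything at distance at least [j]. Its sums
    over the distances beyond [m] are bounded by [ee m], which controls the interaction of two
    half-lines with [m] sites between them. The factor 4 comes from the four terms of a mixed second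
    difference. *)
Definition tt (j : nat) : R :=
  (4 * fine (\esum_(A in [set A | at0 A /\ (j <= diam A)%N]) supnorm (U A)))%R.
Definition ee (m : nat) : R :=
  (4 * fine (\esum_(A in at0) ((diam A - m)%N%:R%:E * supnorm (U A)))%E)%R.

Let Dle m : \esum_(A in at0) ((diam A - m)%N%:R%:E * supnorm (U A)) < +oo.
Proof.
apply: le_lt_trans U_diam; apply: le_esum => A _.
by apply: lee_wpmul2r; [exact: supnorm_ge0|rewrite lee_fin ler_nat leq_subr].
Qed.

Let Tle j : \esum_(A in [set A | at0 A /\ (j <= diam A)%N]) supnorm (U A) < +oo.
Proof.
case: U_int => _ _; apply: le_lt_trans; apply: esum_subset => A [].
by [].
Qed.

Lemma tt_fin j : (\esum_(A in [set A | at0 A /\ (j <= diam A)%N]) supnorm (U A))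
   = (tt j / 4)%:E.
Proof.
rewrite /tt mulrC mulKf// fineK//; apply: fin_esum (Tle _).
by move=> A; exact: supnorm_ge0.
Qed.

Lemma ee_fin m : (\esum_(A in at0) ((diam A - m)%N%:R%:E * supnorm (U A)))
   = (ee m / 4)%:E.
Proof.
rewrite /ee mulrC mulKf// fineK//; apply: fin_esum (Dle _).
by move=> A; rewrite mule_ge0 ?supnorm_ge0.
Qed.

Lemma tt_ge0 j : (0 <= tt j)%R.
Proof.
rewrite /tt mulr_ge0// fine_ge0// esum_ge0// => A _; exact: supnorm_ge0.
Qed.

Lemma ee_ge0 j : (0 <= ee j)%R.
Proof.
by rewrite /ee mulr_ge0// fine_ge0// esum_ge0// => A _; rewrite mule_ge0 ?supnorm_ge0.
Qed.

Lemma tt_anti i j : (i <= j)%N -> (tt j <= tt i)%R.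
Proof.
move=> ij; suff : ((tt j / 4)%:E <= (tt i / 4)%:E) by rewrite lee_fin; lra.
by rewrite -!tt_fin; apply: esum_subset => A [A0 jA]; split => //; exact: leq_trans jA.
Qed.

Lemma ee_tt j : ee j = (tt j.+1 + ee j.+1)%R.
Proof.
suff : ((ee j / 4)%:E = (tt j.+1 / 4)%:E + (ee j.+1 / 4)%:E).
  by move=> -[]; lra.
rewrite -!ee_fin -!tt_fin.
rewrite (_ : [set A | _ /\ _] = at0 `&` [set A | (j < diam A)%N])//.
rewrite esum_mkcondr -esumD; last 2 first.
  - by move=> A _; case: ifP => // _; exact: supnorm_ge0.
  - by move=> A _; rewrite mule_ge0 ?supnorm_ge0.
apply: eq_esum => A _; case: ifPn; rewrite ?inE /= => h.
  have -> : (diam A - j)%N = (diam A - j.+1).+1 by lia.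
  rewrite -natr1 EFinD ge0_muleDl ?lee_fin// addeC; congr (_ + _).
  by rewrite mul1e.
have /negP := h; rewrite in_setE /= => jd.
have [-> ->] : (diam A - j = 0 /\ diam A - j.+1 = 0)%N by lia.
by rewrite mul0e add0e.
Qed.

Lemma sum_tt m n : (\sum_(m <= j < m + n) tt j.+1 = ee m - ee (m + n))%R.
Proof.
elim: n => [|n IH]; first by rewrite addn0 big_geq// subrr.
by rewrite addnS big_nat_recr ?leq_addr//= IH (ee_tt (m + n)); lra.
Qed.

Lemma ee_anti i j : (i <= j)%N -> (ee j <= ee i)%R.
Proof.
move=> /subnKC <-; rewrite -subr_ge0 -sum_tt; apply: sumr_ge0 => *; exact: tt_ge0.
Qed.

(** Dominated convergence by hand: a finite family [X] carries the sum of [diam_summable] up to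
    [e / 4], and once [M] exceeds all diameters in [X] these sets no longer contribute to [ee M]. *)
Lemma ee_cvg (e : R) : (0 < e)%R -> exists M, forall m, (M <= m)%N -> (ee m <= e)%R.
Proof.
move=> e0; suff [M hM] : exists M, (ee M <= e)%R.
  by exists M => m Mm; apply: le_trans hM; exact: ee_anti.
have := U_diam; rewrite /diam_summable => hlt.
have fn : \esum_(A in at0) ((diam A)%:R%:E * supnorm (U A)) \is a fin_num.
  by apply: fin_esum => // A; rewrite mule_ge0 ?supnorm_ge0.
have e4 : (0 < e / 4)%R by lra.
have [_ [X [finX X0] <-] hX] := ub_ereal_sup_adherent e4 fn.
rewrite -/(esum _ _) in hX.
have /finite_seqP[s Xs] := finX.
exists (\max_(A <- s) diam A)%N.
set M := (\max_(A <- s) diam A)%N.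
suff : ((ee M / 4)%:E <= (e / 4)%:E) by rewrite lee_fin; lra.
rewrite -ee_fin.
have le1 : \sum_(A \in X) ((diam A)%:R%:E * supnorm (U A)) +
    \esum_(A in at0) ((diam A - M)%N%:R%:E * supnorm (U A)) <=
    \esum_(A in at0) ((diam A)%:R%:E * supnorm (U A)).
  have -> : \sum_(A \in X) ((diam A)%:R%:E * supnorm (U A)) =
            \esum_(A in at0) (if A \in X then (diam A)%:R%:E * supnorm (U A) else 0).
    rewrite -esum_mkcondr (_ : at0 `&` X = X); last first.
      by apply/seteqP; split => A; [case|move=> XA; split => //; exact: X0].
    have := @esum_fset R _ X (fun A => ((diam A)%:R%:E * supnorm (U A))) finX.
    move=> <-; first by congr esum; apply/seteqP; split => A /=; rewrite in_setE.
    by move=> A _; rewrite mule_ge0 ?supnorm_ge0.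
  rewrite -esumD; last 2 first.
  - by move=> A _; case: ifP => // _; rewrite mule_ge0 ?supnorm_ge0.
  - by move=> A _; rewrite mule_ge0 ?supnorm_ge0.
  apply: le_esum => A _; case: ifPn => [|_]; last first.
    by rewrite add0e lee_wpmul2r ?supnorm_ge0// lee_fin ler_nat leq_subr.
  rewrite inE Xs /= => As.
  have -> : (diam A - M = 0)%N.
    by apply/eqP; rewrite subn_eq0 /M; exact: (@leq_bigmax_seq _ _ xpredT (fun A => diam A)).
  by rewrite mul0e adde0.
move: hX le1; rewrite ee_fin.
move: fn => /fineK <-; rewrite -EFinB.
set S := \sum_(A \in X) _.
move: S => [x| |]//.
  move=> h1 h2; have : (x%:E + (ee M / 4)%:E <= x%:E + (e / 4)%:E).
    apply: (le_trans h2); rewrite -leeBlDr//; exact: ltW.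
  by rewrite -!EFinD !lee_fin => h; lra.
Qed.

Definition hits (X : set int) (A : {fset int}) : Prop := exists2 x, x \in A & X x.

(* the mixed second difference of U A is at most 4 * supnorm (U A) *)
Definition cle (X Y : set int) (c : R) : Prop :=
  \esum_(A in [set A | hits X A /\ hits Y A]) supnorm (U A) <= (c / 4)%:E.

Lemma hits_sub X X' A : X `<=` X' -> hits X A -> hits X' A.
Proof. by move=> s [x xA Xx]; exists x => //; exact: s. Qed.

Lemma cle_sub X Y X' Y' c c' : X' `<=` X -> Y' `<=` Y -> (c <= c')%R ->
  cle X Y c -> cle X' Y' c'.
Proof.
move=> sX sY cc h; apply: (@le_trans _ _ (c / 4)%:E); last by rewrite lee_fin; lra.
by apply: le_trans h; apply: esum_subset => A [hX hY]; split; [exact: hits_sub sX hX|exact: hits_sub sY hY].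
Qed.

Lemma cle_sym X Y c : cle X Y c -> cle Y X c.
Proof. by apply: le_trans; apply: esum_subset => A [? ?]; split. Qed.

Lemma cle_ge0 X Y c : cle X Y c -> (0 <= c)%R.
Proof.
move=> h; suff : 0 <= (c / 4)%:E by rewrite lee_fin; lra.
by apply: le_trans h; apply: esum_ge0 => A _; exact: supnorm_ge0.
Qed.

Lemma cle_bigcup (Xj : nat -> set int) X Y (cj : nat -> R) c :
  X `<=` \bigcup_j Xj j -> (forall j, cle (Xj j) Y (cj j)) ->
  (forall N, \sum_(j < N) cj j <= c)%R -> cle X Y c.
Proof.
move=> cov h bnd.
apply: (@esum_cover _ _ _ (fun j => [set A | hits (Xj j) A /\ hits Y A])).
- by move=> A; exact: supnorm_ge0.
- by move=> A [[x xA /cov[j _ Xjx]] hY]; exists j; split => //; exists x.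
move=> N; apply: (@le_trans _ _ (\sum_(j < N) (cj j / 4)%:E)).
  by apply: lee_sum => j _; exact: h.
by rewrite sumEFin lee_fin -mulr_suml ler_pM2r ?invr_gt0// bnd.
Qed.

Lemma cle0 Y : cle set0 Y 0.
Proof.
rewrite /cle mul0r (_ : [set A | _] = set0) ?esum_set0//.
by apply/seteqP; split => // A [[x _ []]].
Qed.

Lemma cle_setU X X' Y c c' : cle X Y c -> cle X' Y c' -> cle (X `|` X') Y (c + c').
Proof.
move=> h h'; pose Xj j := if j is j'.+1 then if j' is 0%N then X' else set0 else X.
pose cj j : R := if j is j'.+1 then if j' is 0%N then c' else 0%R else c.
apply: (@cle_bigcup Xj _ _ cj).
- by move=> x [Xx|Xx]; [exists 0%N|exists 1%N].
- by case=> [|[|j]] //=; exact: cle0.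
have c0 := cle_ge0 h; have c0' := cle_ge0 h'.
case=> [|[|N]]; first by rewrite big_ord0; lra.
  by rewrite big_ord_recl big_ord0 /=; lra.
by rewrite !big_ord_recl /= big1; [lra|].
Qed.

Lemma cle_seq (l : seq int) Y (c : int -> R) :
  (forall x, x \in l -> cle [set x] Y (c x)) -> cle (sset l) Y (\sum_(x <- l) c x).
Proof.
elim: l => [|x l IH] h.
  rewrite big_nil; apply: cle_sub (cle0 Y) => // x; by rewrite /sset /= in_nil.
rewrite big_cons; apply: (@cle_sub ([set x] `|` sset l) Y) => //.
  by move=> y; rewrite /sset /= inE => /orP[/eqP ->|?]; [left|right].
apply: cle_setU; first by apply: h; exact: mem_head.
by apply: IH => y yl; apply: h; rewrite inE yl orbT.
Qed.

(** Translated by [- x], a set that contains [x] and meets [Y] contains 0 and has diameter at least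
    [j]. *)
Lemma cle_pt x Y j : (forall y, Y y -> (j <= `|x - y|)%N) -> cle [set x] Y (tt j).
Proof.
move=> hY; rewrite /cle -tt_fin.
rewrite (@reindex_esum _ _ _ [set A | at0 A /\ hits [set y | Y (y + x)%R] A] _ (trans x)).
  rewrite (eq_esum (b := fun A => supnorm (U A))); last by move=> A _; rewrite supnorm_trans.
  apply: esum_subset => A [A0 [y yA Yy]]; split => //.
  by apply: leq_trans (diam_ge A0 yA); have := hY _ Yy; lia.
split.
- move=> A [A0 [y yA Yy]]; split; last by exists (y + x)%R; rewrite ?mem_trans ?addrK.
  by exists x => //; rewrite mem_trans subrr.
- by move=> A B _ _ e; rewrite -(transK x A) e transK.
- move=> A [[z xA /= zx] [y yA Yy]]; rewrite zx in xA; exists (trans (- x) A); last by exact: transNK.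
  split; first by rewrite /at0 /= mem_trans opprK add0r.
  by exists (y - x)%R; rewrite /= ?subrK// mem_trans opprK subrK.
Qed.

(** The left half-line is cut into single sites; the one at distance m + 1 + j from [k] costs
    [tt (m + j).+1], and these costs telescope by [sum_tt]. In particular the energy across a cut of
    the line is finite. *)
Lemma cle_half k m : cle [set x | (x < k - m%:Z)%R] [set y | (k <= y)%R] (ee m).
Proof.
apply: (@cle_bigcup (fun j => [set (k - m%:Z - 1 - j%:Z)%R]) _ _ (fun j => tt (m + j).+1)).
- move=> x /= xk; exists (absz (k - m%:Z - 1 - x)%R) => //=; lia.
- by move=> j; apply: cle_pt => y /= ky; lia.
move=> N; have := sum_tt m N; rewrite -{1}(add0n m) big_addn addKn big_mkord => e.
under eq_bigr do rewrite addnC.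
by rewrite e; have := ee_ge0 (m + N); lra.
Qed.

End energy.

Lemma asum_subset (R : realType) (T : choiceType) (D E : set T) (f : T -> R) :
  D `<=` E -> (forall x, E x -> ~ D x -> f x = 0) -> asum E f = asum D f.
Proof.
move=> DE f0; have aux (a : T -> \bar R) : (forall x, (0 <= a x)%E) ->
    (forall x, E x -> ~ D x -> a x = 0%E) -> esum E a = esum D a.
  move=> a0 aD; rewrite (esumID D)// (_ : E `&` D = D); last first.
    by apply/seteqP; split => x; [case|move=> Dx; split => //; exact: DE].
  by rewrite [X in (_ + X)%E]esum1 ?adde0// => x [Ex nDx]; exact: aD.
rewrite /asum !aux//; move=> x Ex nD.
- by rewrite funenegE f0// oppe0 maxxx.
- by rewrite funeposE f0// maxxx.
Qed.

(** * Finite-volume Gibbs averages *)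

Section gam.
Variables (R : realType) (U : {fset int} -> Omega -> R).
Hypotheses (U_int : interaction U) (U_diam : diam_summable U).

Definition touch (L : {fset int}) : set {fset int} :=
  [set A : {fset int} | exists2 x : int, x \in A & x \in L].

Lemma touch_sum L : (\esum_(A in touch L) supnorm (U A) < +oo)%E.
Proof.
pose l : seq int := L.
have h : cle U (sset l) setT (\sum_(x <- l) tt U 0).
  by apply: cle_seq => x _; apply: cle_pt.
apply: (@le_lt_trans _ _ ((\sum_(x <- l) tt U 0) / 4)%:E); last exact: ltry.
apply: le_trans h; apply: esum_subset => A [x xA xL]; split; by exists x.
Qed.

Lemma ham_summable L s : asummable (touch L) (fun A => U A s).
Proof.
apply: le_lt_trans (touch_sum L); apply: le_esum => A _; exact: le_supnorm.
Qed.

(** Spins and boundary condition are read off one configuration, so that energies and averages are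
    functions on [Omega]. *)
Definition ham (L : {fset int}) s := hamiltonian U L s s.

Lemma glue_id L s : Defs.glue L s s = s.
Proof. by apply/funext => x; rewrite /Defs.glue; case: ifP. Qed.

Lemma hamE L s : ham L s = asum (touch L) (fun A => U A s).
Proof. by rewrite /ham /hamiltonian glue_id. Qed.

Lemma hamB L s s' : ham L s - ham L s' = asum (touch L) (fun A => U A s - U A s').
Proof. by rewrite !hamE asumB//; exact: ham_summable. Qed.

(** The four configurations are the corners of a rectangle, changed on [X] in one direction and on
    [Y] in the other. The mixed difference of [U A] vanishes unless [A] meets both [X] and [Y],
    whatever [L] is. *)
Lemma ham_mixed L X Y c s00 s01 s10 s11 : cle U X Y c ->
  eqoff X s00 s10 -> eqoff X s01 s11 -> eqoff Y s00 s01 -> eqoff Y s10 s11 ->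
  ham L s00 + ham L s11 <= ham L s01 + ham L s10 + c.
Proof.
move=> hc eX eX' eY eY'.
have sm s s' := asummableD (ham_summable L s) (asummableN (ham_summable L s')).
rewrite -subr_ge0.
have -> : ham L s01 + ham L s10 + c - (ham L s00 + ham L s11) =
   c - ((ham L s00 - ham L s01) - (ham L s10 - ham L s11)) by ring.
rewrite subr_ge0 !hamB -asumB; [|exact: sm|exact: sm].
rewrite -lee_fin; apply: le_trans (asum_le_esum _) _.
  by apply: asummableD; [exact: sm|apply: asummableN; exact: sm].
pose B := [set A | hits X A /\ hits Y A].
have U0 s s' A Z : eqoff Z s s' -> ~ hits Z A -> U A s = U A s'.
  case: U_int => loc _ _ e nh; apply: loc => x xA; apply: e => Zx.
  by apply: nh; exists x.
have step A : (`|U A s00 - U A s01 - (U A s10 - U A s11)|%:E <=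
     if A \in B then 4%:E * supnorm (U A) else 0)%E.
  case: ifPn => [_|].
    have b s := le_supnorm (U A) s.
    move: (b s00) (b s01) (b s10) (b s11).
    case: (supnorm (U A)) => [r| |]; rewrite ?lee_fin.
    - move=> b1 b2 b3 b4.
      apply: le_trans (ler_normB _ _) _.
      have := ler_normB (U A s00) (U A s01); have := ler_normB (U A s10) (U A s11).
      lra.
    - by move=> *; rewrite mulry gtr0_sg// mul1e leey.
    - by [].
  rewrite notin_setE => nB; have [hX|nX] := pselect (hits X A).
    have nY : ~ hits Y A by move=> hY; apply: nB.
    by rewrite (U0 _ _ _ _ eY nY) (U0 _ _ _ _ eY' nY) !subrr normr0.
  by rewrite (U0 _ _ _ _ eX nX) (U0 _ _ _ _ eX' nX) subrr normr0.
apply: le_trans (le_esum (fun A _ => step A)) _.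
apply: (@le_trans _ _ (\esum_(A in B) (4%:E * supnorm (U A)))%E).
  rewrite [leRHS]esum_mkcond; apply: esum_subset; exact: subsetT.
have -> : (c%:E = 4%:E * (c / 4)%:E :> \bar R)%E by rewrite -EFinM mulrC divfK.
have fB : (\esum_(A in B) supnorm (U A) <= (c / 4)%:E)%E := hc.
apply: ge_ereal_sup => _ [Z [finZ ZB] <-].
rewrite -ge0_mule_fsumr; last by move=> A; exact: supnorm_ge0.
apply: lee_wpmul2l => //; apply: le_trans fB; apply: ereal_sup_ubound.
by exists Z.
Qed.

Definition bw (l : seq int) (s : Omega) : R := expR (- ham [fset x in l]%fset s).
(** The Gibbs specification: the spins in [l] are averaged and those of the argument off [l] serve
    as boundary condition. *)
Definition gam (l : seq int) (F : Omega -> R) : Omega -> R := wavg (bw l) l F.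

Lemma bw_gt0 l s : 0 < bw l s. Proof. exact: expR_gt0. Qed.

Lemma bw_mixed l X Y c s00 s01 s10 s11 : cle U X Y c ->
  eqoff X s00 s10 -> eqoff X s01 s11 -> eqoff Y s00 s01 -> eqoff Y s10 s11 ->
  bw l s01 * bw l s10 <= expR c * (bw l s00 * bw l s11).
Proof.
move=> hc eX eX' eY eY'; rewrite /bw -!expRD ler_expR.
have := ham_mixed [fset x in l]%fset hc eX eX' eY eY'; lra.
Qed.

(** Sets that meet [L] but not [l] have the same energy for all patterns on [l], hence contribute a
    constant factor to the weights. This is the source of the consistency of the averages in
    different volumes. *)
Lemma gam_big l L F : {subset l <= L} -> wavg (bw L) l F = gam l F.
Proof.
move=> lL; apply/funext => s; apply: wavg_weight; try exact: bw_gt0.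
move=> v v' _ _; rewrite /bw -!expRD; congr expR.
suff : ham [fset x in L]%fset (asg l v s) - ham [fset x in L]%fset (asg l v' s) =
       ham [fset x in l]%fset (asg l v s) - ham [fset x in l]%fset (asg l v' s).
  by lra.
rewrite !hamB; apply: asum_subset.
  by move=> A [x xA xl]; exists x => //; move: xl; rewrite !inE; exact: lL.
move=> A _ nA; case: U_int => loc _ _; rewrite (loc _ _ (asg l v' s)) ?subrr//.
move=> x xA; rewrite !asg_notin//.
  by apply/negP => xl; apply: nA; exists x => //; rewrite !inE.
by apply/negP => xl; apply: nA; exists x => //; rewrite !inE.
Qed.

(** Numerator and normalising sum are compared jointly, for each pair of patterns, so that changing
    the boundary condition on [X] costs the factor [expR c] once and not twice. *)
Lemma gam_ratio l X c F F' s s' :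
  cle U X (sset l) c -> eqoff (X `|` sset l) s s' ->
  (forall v, v \in bits (size l) -> 0 <= F (asg l v s) <= F' (asg l v s')) ->
  gam l F s <= expR c * gam l F' s'.
Proof.
move=> hc e hF; apply: wavg_ratio hF; first exact: bw_gt0.
move=> v v' _ _.
have eX w : eqoff X (asg l w s) (asg l w s').
  by move=> x Xx; rewrite /asg; case: ifPn => // /negP xl; apply: e => -[].
have el w w' t : eqoff (sset l) (asg l w t) (asg l w' t).
  by move=> y /negP yl; rewrite !asg_notin.
exact: (bw_mixed l hc (eX v') (eX v) (el _ _ _) (el _ _ _)).
Qed.

Lemma gam_tower l1 l2 F : disj l1 l2 -> gam (l1 ++ l2) F = gam (l1 ++ l2) (gam l2 F).
Proof.
move=> d; rewrite /gam (wavg_tower (@bw_gt0 _) _ d); congr wavg.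
by apply: gam_big => x; rewrite mem_cat orbC => ->.
Qed.

Lemma gam_catC l1 l2 F : disj l1 l2 -> gam (l1 ++ l2) F = gam (l2 ++ l1) F.
Proof.
move=> d; rewrite /gam (wavg_catC _ _ d); apply: gam_big => x.
by rewrite !mem_cat orbC.
Qed.

End gam.

Lemma gam_perm (R : realType) (U : {fset int} -> Omega -> R) l l' F :
  uniq l -> uniq l' -> l =i l' -> gam U l F = gam U l' F.
Proof.
move=> ul ul' e; have pl : perm_eq l l' by exact: uniq_perm.
have ef : [fset x in l]%fset = [fset x in l']%fset by apply/fsetP => x; rewrite !inE e.
by apply/funext => s; rewrite /gam /wavg /bw ef !(ssum_perm _ ul pl).
Qed.

Lemma wt_ratio (R : realType) (U : {fset int} -> Omega -> R) : interaction U ->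
  forall l X c s s' v, cle U X (sset l) c -> eqoff (X `|` sset l) s s' ->
  wt (bw U l) l v s <= expR c * wt (bw U l) l v s'.
Proof.
move=> U_int l X c s s' v hc e.
have Z0 t : 0 < ssum l (bw U l) t by apply: ssum_gt0 => ?; exact: bw_gt0.
rewrite /wt ler_pdivrMr//.
rewrite (_ : forall a b d e : R, a * (b / d) * e = a * (b * e) / d) => [|a b d f]; last by ring.
rewrite ler_pdivlMr// /ssum !mulr_sumr; apply: ler_sum => v' _.
have eX w : eqoff X (asg l w s) (asg l w s').
  by move=> x Xx; rewrite /asg; case: ifPn => // /negP xl; apply: e => -[].
have el w w' t : eqoff (sset l) (asg l w t) (asg l w' t).
  by move=> y /negP yl; rewrite !asg_notin.
rewrite (mulrC (bw U l (asg l v s'))).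
exact: (bw_mixed U_int l hc (eX v') (eX v) (el _ _ _) (el _ _ _)).
Qed.

(** * Intervals of sites *)

Definition sites (a : int) (n : nat) : seq int := [seq a + i%:Z | i <- iota 0 n].

Lemma mem_sites a n x : (x \in sites a n) = (a <= x < a + n%:Z).
Proof.
apply/mapP/idP => [[i]|h]; first by rewrite mem_iota => h ->; lia.
exists (absz (x - a)%R); last by lia.
by rewrite mem_iota; lia.
Qed.

Lemma sites_uniq a n : uniq (sites a n).
Proof. by rewrite map_inj_uniq ?iota_uniq// => i j; lia. Qed.

Lemma size_sites a n : size (sites a n) = n.
Proof. by rewrite size_map size_iota. Qed.

Lemma sites_cat a m n : sites a (m + n) = sites a m ++ sites (a + m%:Z) n.
Proof.
rewrite /sites iotaD map_cat; congr (_ ++ _); rewrite add0n -{1}(addn0 m) iotaDl -map_comp.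
by apply: eq_map => i /=; rewrite PoszD addrA.
Qed.

Lemma sitesS a n : sites a n.+1 = a :: sites (a + 1) n.
Proof. by rewrite -add1n sites_cat /= /sites /= addr0. Qed.

(** * Loss of memory, uniformly in the boundary condition *)

Section loss.
Variables (R : realType) (U : {fset int} -> Omega -> R).
Hypotheses (U_int : interaction U) (U_diam : diam_summable U).

Definition osc (l : seq int) (Q : set int) (F : Omega -> R) (B : R) :=
  forall s s', eqoff (Q `|` sset l) s s' -> `|gam U l F s - gam U l F s'| <= B.

Definition unit_fun (F : Omega -> R) := forall s, 0 <= F s <= 1.

Lemma gam_unit l F : unit_fun F -> unit_fun (gam U l F).
Proof.
move=> F01 s; rewrite /gam wavg_ge0/=; last 2 first.
- exact: bw_gt0.
- by move=> s' _; case/andP: (F01 s').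
rewrite -[leRHS](wavg1 (bw_gt0 U l) l s); apply: wavg_le => [|s' _]; first exact: bw_gt0.
by case/andP: (F01 s').
Qed.

(** The ratio bound g <= e^c g' with 0 <= g <= 1 gives g - g' <= (1 - e^(-c)) g <= c. *)
Lemma gam_lip l X c F s s' : unit_fun F -> inv_on X F -> cle U X (sset l) c ->
  eqoff (X `|` sset l) s s' -> `|gam U l F s - gam U l F s'| <= c.
Proof.
move=> F01 iF hc.
have main t t' : eqoff (X `|` sset l) t t' -> gam U l F t - gam U l F t' <= c.
  move=> e; have : gam U l F t <= expR c * gam U l F t'.
    apply: (gam_ratio U_int hc e) => v _; have /andP[F0 _] := F01 (asg l v t).
    rewrite F0 /= le_eqVlt; apply/orP; left; apply/eqP; apply: iF => x Xx.
    by rewrite /asg; case: ifPn => // /negP xl; apply: e => -[].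
  rewrite mulrC -ler_pdivrMr ?expR_gt0// -expRN => h.
  have := expR_ge1Dx (- c); have /andP[g0 g1] := gam_unit l F01 t.
  have := cle_ge0 hc; nra.
move=> e; rewrite ler_norml; have := main _ _ e; have := main _ _ (eqoff_sym e).
by move=> h1 h2; apply/andP; split; lra.
Qed.

(** The left-hand side is the sum of [k v - k' w] against the product of the weights [a] and [b]. *)
Lemma sum_bits_cross n (a b k k' : seq bool -> R) B (d : R) :
  (forall v, 0 <= a v) -> (forall v, 0 <= b v) ->
  \sum_(v <- bits n) a v = 1 -> \sum_(v <- bits n) b v = d ->
  (forall v w, k v - k' w <= B) ->
  d * \sum_(v <- bits n) a v * k v - \sum_(w <- bits n) b w * k' w <= d * B.
Proof.
move=> a0 b0 sa sb hk.
have -> : d * \sum_(v <- bits n) a v * k v - \sum_(w <- bits n) b w * k' w =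
    \sum_(v <- bits n) \sum_(w <- bits n) a v * b w * (k v - k' w).
  rewrite -[X in _ - X]mul1r -sa -sb !mulr_suml.
  rewrite (eq_bigr (fun w => \sum_(v <- bits n) a v * b w * k v)); last first.
    by move=> w _; rewrite mulr_sumr; apply: eq_bigr => v _; ring.
  rewrite exchange_big -sumrB; apply: eq_bigr => v _.
  by rewrite mulr_sumr -sumrB; apply: eq_bigr => w _; ring.
have -> : d * B = \sum_(v <- bits n) \sum_(w <- bits n) a v * b w * B.
  rewrite -sb -[B in LHS]mul1r -sa mulrA (mulrC (\sum_(v <- bits n) b v)) !mulr_suml.
  by apply: eq_bigr => v _; rewrite mulr_sumr mulr_suml.
apply: ler_sum => v _; apply: ler_sum => w _; apply: ler_wpM2l => //.
exact: mulr_ge0.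
Qed.

Lemma osc_le l Q Q' F B B' : Q' `<=` Q -> B <= B' -> osc l Q F B -> osc l Q' F B'.
Proof.
move=> sQ sB h s s' e; apply: le_trans (h _ _ _) sB.
by apply: (eqoff_sub _ e); apply: setSU.
Qed.

(** The average over the larger set is an average of averages over [l2] with various spins in [l1],
    all within [B] of each other. *)
Lemma osc_ext l1 l2 Q F B : disj l1 l2 -> osc l2 (Q `|` sset l1) F B ->
  osc (l1 ++ l2) Q F B.
Proof.
move=> d h.
have main s s' : eqoff (Q `|` sset (l1 ++ l2)) s s' ->
    gam U (l1 ++ l2) F s - gam U (l1 ++ l2) F s' <= B.
  move=> e; rewrite gam_tower// /gam !(wavgE (bw U (l1 ++ l2))).
  set L := l1 ++ l2.
  have := @sum_bits_cross (size L) (fun v => wt (bw U L) L v s) (fun v => wt (bw U L) L v s')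
    (fun v => wavg (bw U l2) l2 F (asg L v s)) (fun v => wavg (bw U l2) l2 F (asg L v s')) B 1.
  rewrite !mul1r; apply.
  - by move=> v; apply/ltW/wt_gt0; exact: bw_gt0.
  - by move=> v; apply/ltW/wt_gt0; exact: bw_gt0.
  - by apply: wt_sum; exact: bw_gt0.
  - by apply: wt_sum; exact: bw_gt0.
  move=> v w; apply: le_trans (ler_norm _) _; apply: h => x nx.
  rewrite !asg_notin.
  - apply: e => -[Qx|]; first by apply: nx; left; left.
    by rewrite /sset /= mem_cat => /orP[?|?]; apply: nx; [left; right|right].
  - by rewrite mem_cat; apply/negP => /orP[?|?]; apply: nx; [left; right|right].
  - by rewrite mem_cat; apply/negP => /orP[?|?]; apply: nx; [left; right|right].
move=> s s' e; rewrite ler_norml; have := main _ _ e; have := main _ _ (eqoff_sym e).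
by move=> h1 h2; apply/andP; split; lra.
Qed.

(** A Doeblin minorisation. Replacing [s] by [s'] inside the average over [l2] costs [e], as the
    spins in [l1] are kept. Replacing the law of the pattern on [L] costs (1 - e^(-c)) B, since by
    the energy bound the new law dominates e^(-c) times the old one, and only the remaining mass
    sees the oscillation [B]. *)
Lemma osc_step l1 l2 Q F B c e : disj l1 l2 -> unit_fun F -> inv_on Q F ->
  cle U Q (sset (l1 ++ l2)) c -> cle U Q (sset l2) e ->
  osc l2 (Q `|` sset l1) F B ->
  osc (l1 ++ l2) Q F ((1 - expR (- c)) * B + e).
Proof.
move=> d F01 iF hc he h; set L := l1 ++ l2; set K := wavg (bw U l2) l2 F.
have main s s' : eqoff (Q `|` sset L) s s' ->
    gam U L F s - gam U L F s' <= (1 - expR (- c)) * B + e.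
  move=> es; rewrite gam_tower// /gam !(wavgE (bw U L)).
  set dl := expR (- c).
  pose a v := wt (bw U L) L v s; pose a' v := wt (bw U L) L v s'.
  have a0 v : 0 <= a v by apply/ltW/wt_gt0; exact: bw_gt0.
  have sa : \sum_(v <- bits (size L)) a v = 1 by apply: wt_sum; exact: bw_gt0.
  have sa' : \sum_(v <- bits (size L)) a' v = 1 by apply: wt_sum; exact: bw_gt0.
  have b0 v : 0 <= a' v - dl * a v.
    rewrite subr_ge0 /dl expRN mulrC ler_pdivrMr ?expR_gt0// mulrC.
    exact: (wt_ratio U_int v hc es).
  have kk v : K (asg L v s) - K (asg L v s') <= e.
    apply: le_trans (ler_norm _) _; apply: (gam_lip F01 iF he) => x nx.
    rewrite /asg; case: ifPn => // xL; apply: es => -[Qx|]; last exact/negP.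
    by apply: nx; left.
  have := @sum_bits_cross (size L) a (fun v => a' v - dl * a v)
    (fun v => K (asg L v s')) (fun v => K (asg L v s')) B (1 - dl) a0 b0 sa.
  rewrite sumrB sa' -mulr_sumr sa mulr1 => /(_ erefl) sc.
  have : forall v w, K (asg L v s') - K (asg L w s') <= B.
    move=> v w; apply: le_trans (ler_norm _) _; apply: h => x nx.
    rewrite !asg_notin// mem_cat; apply/negP => /orP[?|?]; apply: nx;
      by [left; right|right].
  move=> /sc {sc}.
  have -> : \sum_(v <- bits (size L)) (a' v - dl * a v) * K (asg L v s') =
      \sum_(v <- bits (size L)) a' v * K (asg L v s') -
      dl * \sum_(v <- bits (size L)) a v * K (asg L v s').
    by rewrite mulr_sumr -sumrB; apply: eq_bigr => v _; ring.
  have : \sum_(v <- bits (size L)) a v * K (asg L v s) -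
         \sum_(v <- bits (size L)) a v * K (asg L v s') <= e.
    rewrite -sumrB -[leRHS]mul1r -sa mulr_suml; apply: ler_sum => v _.
    by rewrite -mulrBr; apply: ler_wpM2l.
  move=> h1 h2; apply: le_trans (_ : _ <= e + (1 - dl) * B) _; last by lra.
  move: h1 h2; rewrite /a' /a.
  set x1 := \sum_(v <- _) _; set x2 := \sum_(v <- _) _; set x3 := \sum_(v <- _) _.
  lra.
move=> s s' es; rewrite ler_norml; have := main _ _ es; have := main _ _ (eqoff_sym es).
by move=> h1 h2; apply/andP; split; lra.
Qed.

Lemma eq_osc l l' Q F B : uniq l -> uniq l' -> l =i l' -> osc l Q F B -> osc l' Q F B.
Proof.
move=> ul ul' e h s s' es; rewrite -(gam_perm _ _ ul ul' e); apply: h.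
by apply: eqoff_sub es; apply: setUS => x; rewrite /sset /= e.
Qed.

(** Two uses are treated at once: a window growing in both directions, for triviality of the tail,
    and a window growing to the right only, whose past is held fixed. *)
Definition outer (two : bool) (lo hi : int) : set int :=
  [set x | hi <= x \/ (two /\ x < lo)].

Lemma cle_outer (two : bool) lo hi m (l : seq int) :
  (forall x, x \in l -> (two -> lo + m%:Z <= x) /\ x < hi - m%:Z) ->
  cle U (outer two lo hi) (sset l) (ee U m + ee U m).
Proof.
move=> hl.
have h1 := cle_half U_int U_diam hi m.
have h2 := cle_half U_int U_diam (lo + m%:Z) m.
case: two hl => hl.
  apply: (@cle_sub _ U ([set x | hi <= x] `|` [set x | x < lo]) (sset l)) => //.
    by move=> x [|[_]]; [left|right].
  apply: cle_setU.
    apply: cle_sub (cle_sym h1) => // x /hl[_]; rewrite /=; lia.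
  apply: cle_sub h2 => // x; last by move=> /hl[/(_ isT)].
  by rewrite /=; lia.
apply: (@cle_sub _ U [set x | hi <= x] (sset l) _ _ (ee U m)) => //.
- by move=> x [//|[]].
- by have := ee_ge0 U m; lra.
apply: cle_sub (cle_sym h1) => // x /hl[_]; rewrite /=; lia.
Qed.

Let grow (two : bool) (p : nat) := if two then p else 0%N.

(** Layers of width [m] are added around the window. However long the window is, its energy of
    interaction with the exterior is at most [c], so each layer contracts the oscillation by the
    same factor 1 - dl; the direct influence across a layer is at most 2 ee(m). After [J] layers the
    volume may grow freely by [osc_ext]. *)
Lemma mem_loss (two : bool) ell (eta : R) : 0 < eta -> exists M : nat,
  forall (a : int) F, unit_fun F -> inv_on (outer two a (a + ell%:Z)) F ->
  forall p p' : nat, (M <= p)%N -> (M <= p')%N ->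
  osc (sites (a - (grow two p)%:Z) (grow two p + ell + p')%N)
      (outer two (a - (grow two p)%:Z) (a + ell%:Z + p'%:Z)) F eta.
Proof.
move=> eta0; pose c := ee U 0 + ee U 0; pose dl := expR (- c).
have dl0 : 0 < dl by exact: expR_gt0.
have c0 : 0 <= c by have := ee_ge0 U 0; rewrite /c; lra.
have dl1 : dl <= 1 by rewrite /dl -expR0 ler_expR; lra.
(* With this [m] the map B -> (1 - dl) B + 2 ee(m) sends eta/2 to at most eta/2, so the errors of
   all layers together stay below eta/2. *)
have [m hm] : exists m, ee U m + ee U m <= eta / 2 * dl.
  have e4 : 0 < eta / 4 * dl by rewrite mulr_gt0// divr_gt0.
  by have [m /(_ m (leqnn m)) h] := ee_cvg U_int U_diam e4; exists m; lra.
have [J hJ] : exists J, (1 - dl) ^+ J <= eta / 2.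
  have := @cvg_expr R (1 - dl); rewrite ger0_norm; last lra.
  move=> /(_ _); have l1 : 1 - dl < 1 by lra.
  move=> /(_ l1) /cvgrPdist_le /(_ (eta / 2)); have e20 : 0 < eta / 2 by lra.
  move=> /(_ e20) [J _ /(_ J (leqnn J))]; rewrite sub0r normrN => h.
  by exists J; apply: le_trans (ler_norm _) h.
exists (J * m)%N => a F F01 iF p p' hp hp'.
pose lj j := sites (a - (grow two (j * m))%:Z) (grow two (j * m) + ell + j * m)%N.
pose Qj j := outer two (a - (grow two (j * m))%:Z) (a + ell%:Z + (j * m)%N%:Z).
have main j : osc (lj j) (Qj j) F ((1 - dl) ^+ j + eta / 2).
  elim: j => [|j IH].
    move=> s s' _; rewrite expr0; have /andP[g0 g1] := gam_unit (lj 0%N) F01 s.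
    have /andP[g0' g1'] := gam_unit (lj 0%N) F01 s'.
    by rewrite ler_norml; apply/andP; split; lra.
  pose an := (if two then sites (a - (j.+1 * m)%N%:Z) m else [::]) ++
             sites (a + ell%:Z + (j * m)%N%:Z) m.
  have dis : disj an (lj j).
    move=> x; rewrite mem_cat mem_sites /lj /grow mem_sites.
    by destruct two; rewrite ?mem_sites ?in_nil /=; lia.
  apply: (@eq_osc (an ++ lj j)).
  - rewrite cat_uniq sites_uniq andbT; apply/andP; split; last first.
      by apply/hasPn => x xl; apply/negP => /dis; rewrite xl.
    rewrite cat_uniq sites_uniq andbT; apply/andP; split; first by destruct two; rewrite ?sites_uniq.
    apply/hasPn => x; rewrite mem_sites; destruct two; rewrite ?in_nil// mem_sites; lia.
  - exact: sites_uniq.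
  - move=> x; rewrite !mem_cat /lj /grow !mem_sites.
    by destruct two; rewrite ?mem_sites ?in_nil /=; lia.
  apply: (@osc_le _ (Qj j.+1) _ _ ((1 - expR (- c)) * ((1 - dl) ^+ j + eta / 2) +
      (ee U m + ee U m))) => //.
    rewrite -/dl exprS mulrDr -addrA lerD2l; nra.
  apply: osc_step => //.
  - move=> s s' e; apply: iF => x nx; apply: e; apply: contra_not nx.
    by rewrite /Qj /outer /grow /=; destruct two; lia.
  - apply: cle_outer => x; rewrite mem_cat mem_cat !mem_sites /grow.
    by destruct two; rewrite ?mem_sites ?in_nil; lia.
  - apply: cle_outer => x; rewrite mem_sites /grow.
    by destruct two; lia.
  apply: osc_le IH => // x [|].
    by rewrite /Qj /outer /grow /=; destruct two; lia.
  by rewrite /sset /= mem_cat mem_sites /Qj /outer /grow /=; destruct two; rewrite ?mem_sites ?in_nil; lia.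
pose an := (if two then sites (a - p%:Z) (p - J * m)%N else [::]) ++
           sites (a + ell%:Z + (J * m)%N%:Z) (p' - J * m)%N.
have dis : disj an (lj J).
  move=> x; rewrite mem_cat mem_sites /lj /grow mem_sites.
  by destruct two; rewrite ?mem_sites ?in_nil /=; lia.
apply: (@eq_osc (an ++ lj J)).
- rewrite cat_uniq sites_uniq andbT; apply/andP; split; last first.
    by apply/hasPn => x xl; apply/negP => /dis; rewrite xl.
  rewrite cat_uniq sites_uniq andbT; apply/andP; split; first by destruct two; rewrite ?sites_uniq.
  apply/hasPn => x; rewrite mem_sites; destruct two; rewrite ?in_nil// mem_sites; lia.
- exact: sites_uniq.
- move=> x; rewrite !mem_cat /lj /grow !mem_sites.
  by destruct two; rewrite ?mem_sites ?in_nil /=; lia.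
apply: osc_ext => //; apply: osc_le (main J) => //; last by lra.
move=> x [|].
  by rewrite /Qj /outer /grow /=; destruct two; lia.
by rewrite /sset /= mem_cat mem_sites /Qj /outer /grow /=; destruct two; rewrite ?mem_sites ?in_nil; lia.
Qed.

End loss.

(** * Squares of sums, and telescoping along flips *)

Lemma wsum_sqr (R : realType) (I : Type) (r : seq I) (w z : I -> R) :
  (forall i, 0 <= w i) ->
  (\sum_(i <- r) w i * z i) ^+ 2 <=
  (\sum_(i <- r) w i) * (\sum_(i <- r) w i * z i ^+ 2).
Proof.
move=> w0; elim: r => [|i r IH]; first by rewrite !big_nil; lra.
rewrite !big_cons.
have A0 : 0 <= \sum_(j <- r) w j by apply: sumr_ge0.
have C0 : 0 <= \sum_(j <- r) w j * z j ^+ 2.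
  by apply: sumr_ge0 => j _; rewrite mulr_ge0// sqr_ge0.
move: IH A0 C0; move: (\sum_(j <- r) w j) (\sum_(j <- r) w j * z j ^+ 2) => A C.
move: (\sum_(j <- r) w j * z j) (z i) (w i) (w0 i) => B x y y0 IH A0 C0.
have : 2 * x * B <= A * x ^+ 2 + C.
  have [A00|An0] := eqVneq A 0.
    have : B ^+ 2 <= 0 by rewrite (le_trans IH)// A00 mul0r.
    rewrite -[B ^+ 2 <= 0]subr_ge0 sub0r oppr_ge0 => B2.
    have : B ^+ 2 == 0 by rewrite eq_le B2 sqr_ge0.
    by rewrite expf_eq0 /= => /eqP ->; rewrite A00; nra.
  have Ap : 0 < A by rewrite lt_neqAle eq_sym An0.
  rewrite -(ler_pM2l Ap); have := sqr_ge0 (A * x - B); nra.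
by move=> h; have := ler_wpM2l y0 h; nra.
Qed.

Lemma sum_sqr (R : realType) (I : Type) (r : seq I) (z : I -> R) :
  (\sum_(i <- r) z i) ^+ 2 <= (size r)%:R * (\sum_(i <- r) z i ^+ 2).
Proof.
have := @wsum_sqr R I r (fun=> 1) z (fun=> ler01).
rewrite big_const_seq count_predT iter_addr addr0 -[1 *+ _]/(_%:R).
by under eq_bigr do rewrite mul1r; under [in X in _ <= _ * X -> _]eq_bigr do rewrite mul1r.
Qed.

Lemma flip_upd x s : flip x s = upd s x (~~ s x).
Proof. by apply/funext => y; rewrite /flip /upd; case: eqP => // ->. Qed.

Lemma upd_same s x : upd s x (s x) = s.
Proof. by apply/funext => y; rewrite /upd; case: eqP => // ->. Qed.

Lemma upd_eq s x b : upd s x b x = b.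
Proof. by rewrite /upd eqxx. Qed.

Lemma upd_neq s x b y : y != x -> upd s x b y = s y.
Proof. by rewrite /upd => /negbTE ->. Qed.

Lemma upd_asgC s x b l v : x \notin l -> upd (asg l v s) x b = asg l v (upd s x b).
Proof.
move=> xl; rewrite !upd_asg asgC// => y; by rewrite inE => /eqP ->.
Qed.

Definition grad2 (R : realType) (F : Omega -> R) (x : int) (s : Omega) : R :=
  (F (flip x s) - F s) ^+ 2.

Lemma grad2_ge0 (R : realType) (F : Omega -> R) x s : 0 <= grad2 F x s.
Proof. exact: sqr_ge0. Qed.

(** Sites are changed one at a time, from the end of the list; [rho x] is the configuration met just
    before [x] is treated. Where the spin need not change, the gradient term is kept as a
    nonnegative surplus. *)
Lemma tele (R : realType) (F : Omega -> R) (xs : seq int) w s : uniq xs ->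
  size w = size xs -> exists rho : int -> Omega,
  (forall x, eqoff (sset xs) (rho x) s) /\
  `|F s - F (asg xs w s)| <= \sum_(x <- xs) `|F (flip x (rho x)) - F (rho x)|.
Proof.
elim: xs w => [|x xs IH] [|b w] //=.
  by move=> _ _; exists (fun=> s); split => //; rewrite asg0 subrr normr0 big_nil.
move=> /andP[xxs uxs] [sw]; have [rho [e h]] := IH w uxs sw.
exists (fun y => if y == x then asg xs w s else rho y); split.
  move=> y z nz; case: ifP => _; last by apply: e => zx; apply: nz; rewrite /sset /= inE zx orbT.
  by rewrite asg_notin//; apply/negP => zx; apply: nz; rewrite /sset /= inE zx orbT.
rewrite big_cons eqxx asg_cons; set t := asg xs w s.
rewrite -[F s - _](subrKA (F t)) addrC; apply: (le_trans (ler_normD _ _)); apply: lerD.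
  rewrite flip_upd; have [->|] := eqVneq b (t x).
    by rewrite upd_same subrr normr0 normr_ge0.
  move=> bx; have -> : b = ~~ t x by case: (t x) bx; case: b.
  by rewrite distrC.
apply: (le_trans h); rewrite big_seq [leRHS]big_seq; apply: ler_sum => y yxs.
by case: eqP => // yx; move: xxs; rewrite -yx yxs.
Qed.

(** The intermediate configurations depend on [s] and [w]; bounding a gradient at one of them by its
    sum over all patterns on [xs] removes this dependence. *)
Lemma tele2 (R : realType) (F : Omega -> R) (xs : seq int) w s : uniq xs ->
  size w = size xs ->
  (F s - F (asg xs w s)) ^+ 2 <=
  (size xs)%:R * \sum_(x <- xs) ssum xs (grad2 F x) s.
Proof.
move=> uxs sw; have [rho [e h]] := tele F s uxs sw.
have : (F s - F (asg xs w s)) ^+ 2 <=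
    (\sum_(x <- xs) `|F (flip x (rho x)) - F (rho x)|) ^+ 2.
  by rewrite -(real_normK (num_real (F s - _))) lerXn2r ?nnegrE// sumr_ge0.
move=> /le_trans; apply; apply: (le_trans (sum_sqr _ _)).
apply: ler_wpM2l => //; apply: ler_sum => x _.
rewrite real_normK ?num_real// /ssum.
rewrite (bigD1_seq (obs xs (rho x)))/= ?obs_bits ?bits_uniq//.
have -> : asg xs (obs xs (rho x)) s = rho x.
  apply/funext => y; rewrite asg_obs; case: ifPn => // /negP ny.
  by rewrite e.
by rewrite lerDl sumr_ge0// => v _; exact: grad2_ge0.
Qed.

(** * Revealing the spins from left to right *)

Section chain.
Variables (R : realType) (U : {fset int} -> Omega -> R).
Hypotheses (U_int : interaction U) (U_diam : diam_summable U).
Implicit Types (F Q : Omega -> R) (s : Omega).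

Local Notation G k m := (gam U (sites k m)).

Definition ind (b : bool) : R := b%:R.
Definition pp k m s : R := G k m.+1 (fun s => ind (s k)) s.
Definition pb (b : bool) k m s : R := if b then pp k m s else 1 - pp k m s.
(** When the spin at [k] is revealed, the conditional expectation jumps by (ind (s k) - pp) times
    this quantity. *)
Definition DD k m F s : R := G (k + 1) m F (upd s k true) - G (k + 1) m F (upd s k false).

Lemma G0 k F : G k 0 F = F.
Proof. by rewrite /gam /= /sites /= wavg0// => s; exact: bw_gt0. Qed.

Lemma gam_inv l F : inv_on (sset l) (gam U l F).
Proof. exact: wavg_inv. Qed.

Lemma disj_cons k m : disj [:: k] (sites (k + 1) m).
Proof. by move=> x; rewrite inE => /eqP ->; rewrite mem_sites; lia. Qed.

Lemma sset_sites k m x : sset (sites k m) x <-> k <= x < k + m%:Z.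
Proof. by rewrite /sset /= mem_sites. Qed.

Lemma pp_unit k m : unit_fun (pp k m).
Proof. by apply: gam_unit => s; rewrite /ind; case: (s k) => /=; rewrite ?lexx ler01. Qed.

Lemma pb_ge0 b k m s : 0 <= pb b k m s.
Proof. by have /andP[h1 h2] := pp_unit k m s; case: b => //=; lra. Qed.

Lemma G_step k m F s : G k m.+1 F s =
  pp k m s * G (k + 1) m F (upd s k true) + (1 - pp k m s) * G (k + 1) m F (upd s k false).
Proof.
rewrite /pp sitesS -cat1s (gam_tower U_int F (@disj_cons k m)).
set K := gam U (sites (k + 1) m) F; set L := [:: k] ++ _.
have iK b : inv_on (sset L) (fun t => K (upd t k b)).
  move=> t t' e; apply: gam_inv => x nx; rewrite /upd; case: eqP => // /eqP xk.
  by apply: e; rewrite /sset /= inE => /orP[|]; [exact/negP|].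
have EK : K = fun t => ind (t k) * K (upd t k true) +
    (K (upd t k false) - ind (t k) * K (upd t k false)).
  apply/funext => t; rewrite /ind; case E : (t k) => /=.
    by rewrite -{1}(upd_same t k) E; ring.
  by rewrite -{1}(upd_same t k) E; ring.
have e1 b : gam U L (fun t => ind (t k) * K (upd t k b)) s =
    gam U L (fun t => ind (t k)) s * K (upd s k b) by rewrite /gam (wavgMr _ _ _ (iK b)).
have e2 : gam U L (fun t => K (upd t k false)) s = K (upd s k false).
  by rewrite /gam (wavg_id (bw_gt0 U L) _ (iK false)).
rewrite {1}EK /gam wavgD wavgB -!/(gam U L _ _) !e1 e2; ring.
Qed.

(** On the degenerate rectangle with corners s', s, s, s' the mixed bound reads bw(s)^2 <= e^(tt 0)
    bw(s')^2, which suffices because e^(tt 0) >= 1. *)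
Lemma bw_flip l x s s' : eqoff [set x] s s' -> bw U l s <= expR (tt U 0) * bw U l s'.
Proof.
move=> e; have hc : cle U [set x] setT (tt U 0) by exact: cle_pt.
have eT (a b : Omega) : eqoff setT a b by move=> y /(_ I).
have := bw_mixed U_int l hc (eqoff_sym e) e (eT _ _) (eT _ _).
move=> h; have t0 := tt_ge0 U 0.
have E1 : 1 <= expR (tt U 0) by rewrite -expR0 ler_expR.
have b0 := bw_gt0 U l s; have b0' := bw_gt0 U l s'.
rewrite leNgt; apply/negP => lt.
move: h b0 b0' lt; move: (bw U l s) (bw U l s') (expR (tt U 0)) E1 => a b e1 E1 h a0 b0 lt.
have h1 : e1 * b * a < a * a by rewrite ltr_pM2r.
have h2 : e1 * b * (e1 * b) <= e1 * b * a by rewrite ler_wpM2l ?(ltW lt)//; nra.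
have h3 : e1 * (b * b) <= e1 * (b * (e1 * b)).
  apply: ler_wpM2l; first lra.
  by apply: ler_wpM2l; nra.
lra.
Qed.

(** The ellipticity constant: the weights of the two values of a spin have ratio at most
    [expR (tt U 0)], so each value has conditional probability at least [dlt], in every volume and
    for every boundary condition. *)
Definition dlt : R := (1 + expR (tt U 0))^-1.

Lemma dlt_gt0 : 0 < dlt.
Proof. by rewrite invr_gt0 addr_gt0// expR_gt0. Qed.

Lemma pb_ge b k m s : dlt <= pb b k m s.
Proof.
have kn : k \notin sites (k + 1) m by rewrite mem_sites; lia.
pose Z b := ssum (sites (k + 1) m) (bw U (sites k m.+1)) (upd s k b).
have Z0 c : 0 < Z c by apply: ssum_gt0 => ?; exact: bw_gt0.
have ZZ c c' : Z c <= expR (tt U 0) * Z c'.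
  rewrite /Z /ssum mulr_sumr; apply: ler_sum => v _; apply: bw_flip => x nx.
  rewrite /asg; case: ifP => // _; rewrite !upd_neq//; apply/eqP; exact: nx.
have E : pp k m s = Z true / (Z true + Z false).
  rewrite /pp /gam /wavg sitesS (ssum_cons _ _ kn) (ssum_cons _ _ kn) -sitesS; congr (_ / _).
  rewrite (eq_ssum (F := bw U (sites k m.+1))); last first.
    by move=> t e; rewrite e ?upd_eq /ind ?mulr1//; exact/negP.
  rewrite -/(Z true) [X in _ + X](_ : _ = 0) ?addr0//.
  rewrite /ssum big1// => v _.
  by rewrite asg_notin// upd_eq /ind mulr0.
have zz : 0 < Z true + Z false by rewrite addr_gt0.
have pE : pb b k m s = Z b / (Z true + Z false).
  by rewrite /pb E; case: b => //; apply: (mulIf (lt0r_neq0 zz)); rewrite mulrBl !divfK ?lt0r_neq0//; ring.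
rewrite pE /dlt -(mul1r _^-1) ler_pdivrMr ?addr_gt0 ?expR_gt0//.
rewrite mulrAC ler_pdivlMr// mul1r.
by have := ZZ true b; have := ZZ false b; case: b {pE} => //; have := ZZ true false; have := ZZ false true; lra.
Qed.

Lemma G_step_b k m F s : G k m.+1 F s =
  pb true k m s * G (k + 1) m F (upd s k true) + pb false k m s * G (k + 1) m F (upd s k false).
Proof. exact: G_step. Qed.

Lemma G_ge0 k m F s : (forall s, 0 <= F s) -> 0 <= G k m F s.
Proof. by move=> F0; apply: wavg_ge0 => [|s' _]; [exact: bw_gt0|]. Qed.

Lemma G_le k m F Q s : (forall s, F s <= Q s) -> G k m F s <= G k m Q s.
Proof. by move=> F0; apply: wavg_le => [|s' _]; [exact: bw_gt0|]. Qed.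

Lemma G_drop b k m F s : (forall s, 0 <= F s) ->
  dlt * G (k + 1) m F (upd s k b) <= G k m.+1 F s.
Proof.
move=> F0; rewrite G_step_b.
have g0 c : 0 <= G (k + 1) m F (upd s k c) by exact: G_ge0.
have := ler_wpM2r (g0 b) (pb_ge b k m s).
have := mulr_ge0 (pb_ge0 true k m s) (g0 true).
have := mulr_ge0 (pb_ge0 false k m s) (g0 false).
by case: b; lra.
Qed.

Lemma G_drops N k m F s : (forall s, 0 <= F s) ->
  dlt ^+ N * ssum (sites k N) (G (k + N%:Z) m F) s <= G k (N + m) F s.
Proof.
move=> F0; elim: N k s => [|N IH] k s; first by rewrite mul1r ssum0 addr0.
rewrite sitesS ssum_cons; last by rewrite mem_sites; lia.
rewrite addSn G_step_b mulrDr.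
have E : k + N.+1%:Z = k + 1 + N%:Z by lia.
have aux b : dlt ^+ N.+1 * ssum (sites (k + 1) N) (G (k + N.+1%:Z) m F) (upd s k b) <=
    pb b k (N + m) s * G (k + 1) (N + m) F (upd s k b).
  rewrite exprS -mulrA E; apply: ler_pM => //.
  - exact: ltW dlt_gt0.
  - by rewrite mulr_ge0 ?exprn_ge0 ?(ltW dlt_gt0)//; apply: ssum_ge0 => t _; exact: G_ge0.
  - exact: pb_ge.
by apply: lerD; exact: aux.
Qed.

Lemma DD_inv k m F : inv_on (sset (sites k m.+1)) (DD k m F).
Proof.
move=> s s' e; rewrite /DD.
have h b : G (k + 1) m F (upd s k b) = G (k + 1) m F (upd s' k b).
  apply: gam_inv => x nx; rewrite /upd; case: eqP => // /eqP xk; apply: e.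
  by rewrite sitesS /sset /= inE => /orP[|//]; exact/negP.
by rewrite !h.
Qed.

(** With p the probability of [true] at [a], revealing that spin contributes p (1 - p) DD^2 to the
    variance, and p (1 - p) <= 1. *)
Lemma var_decomp n a F s :
  G a n (fun s => F s ^+ 2) s - G a n F s ^+ 2 <=
  \sum_(j < n) G a n (fun s => DD (a + j%:Z) (n - j.+1) F s ^+ 2) s.
Proof.
elim: n a s => [|n IH] a s; first by rewrite !G0 subrr big_ord0.
rewrite big_ord_recl /= addr0 subSS subn0.
have -> : G a n.+1 (fun s => DD a n F s ^+ 2) s = DD a n F s ^+ 2.
  have iD : inv_on (sset (sites a n.+1)) (fun s => DD a n F s ^+ 2).
    by move=> t t' /DD_inv ->.
  exact: (wavg_id (bw_gt0 U _) s iD).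
rewrite !(G_step_b _ _ _ s) (eq_bigr (fun j : 'I_n =>
  pb true a n s * G (a + 1) n (fun s => DD (a + 1 + j%:Z) (n - j.+1) F s ^+ 2) (upd s a true) +
  pb false a n s * G (a + 1) n (fun s => DD (a + 1 + j%:Z) (n - j.+1) F s ^+ 2) (upd s a false))); last first.
  move=> j _; rewrite G_step_b subSS /bump /= add1n.
  by rewrite (_ : a + j.+1%:Z = a + 1 + j%:Z)//; lia.
rewrite big_split /= -!mulr_sumr.
have h1 := ler_wpM2l (pb_ge0 true a n s) (IH (a + 1) (upd s a true)).
have h2 := ler_wpM2l (pb_ge0 false a n s) (IH (a + 1) (upd s a false)).
move: h1 h2; rewrite /DD.
set A := \sum_(j < n) _; set B := \sum_(j < n) _.
move: (G _ _ _ _) (G _ _ _ _) (G (a + 1) n F _) (G (a + 1) n F _) => x y z w.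
have /andP[p0 p1] := pp_unit a n s; rewrite /pb.
move: (pp a n s) p0 p1 => p p0 p1 h1 h2.
have : p * (1 - p) * (z - w) ^+ 2 <= (z - w) ^+ 2.
  by rewrite ler_piMl ?sqr_ge0//; nra.
nra.
Qed.

(** Both averages are revealed in parallel from [k] on. At the site k + j the one-step probabilities
    for the two pasts differ by at most [be j], and exchanging them costs that much times |DD|;
    after the last step only the change of [F] itself remains. DD is taken at the changed past but
    averaged under the law of the original one, which [G_past] corrects later. Only the sites [X]
    where the pasts really differ enter [be]. *)
Lemma past_change xs w (X : set int) (be : nat -> R) k m F s :
  X `<=` sset xs -> (forall x, x \in xs -> x < k) ->
  eqoff X s (asg xs w s) ->
  (forall j, (j < m)%N -> cle U X (sset (sites (k + j%:Z) (m - j))) (be j)) ->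
  `|G k m F s - G k m F (asg xs w s)| <=
  G k m (fun t => `|F t - F (asg xs w t)|) s +
  \sum_(j < m) be j * G k m (fun t => `|DD (k + j%:Z) (m - j.+1) F (asg xs w t)|) s.
Proof.
move=> Xxs; elim: m k s be => [|m IH] k s be xsk eX hb.
  by rewrite !G0 big_ord0 addr0.
have kxs : k \notin xs by apply/negP => /xsk; rewrite ltxx.
have uk b : upd (asg xs w s) k b = asg xs w (upd s k b) by rewrite upd_asgC.
have hp : `|pp k m s - pp k m (asg xs w s)| <= be 0%N.
  have := hb 0%N isT; rewrite addr0 subn0 => hc; apply: (gam_lip U_int _ _ hc).
  - by move=> t; rewrite /ind; case: (t k) => /=; rewrite ?lexx ler01.
  - by move=> t t' e; rewrite e// => /Xxs; rewrite /sset /=; apply/negP.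
  - by apply: eqoff_sub eX; left.
have IHb b := IH (k + 1) (upd s k b) (fun j => be j.+1).
have {}IHb b : `|G (k + 1) m F (upd s k b) - G (k + 1) m F (upd (asg xs w s) k b)| <=
   G (k + 1) m (fun t => `|F t - F (asg xs w t)|) (upd s k b) +
  \sum_(j < m) be j.+1 * G (k + 1) m (fun t => `|DD (k + 1 + j%:Z) (m - j.+1) F (asg xs w t)|) (upd s k b).
  rewrite uk; apply: IHb.
  - by move=> x /xsk; lia.
  - by move=> x nx; rewrite -uk /upd; case: eqP => // _; exact: eX.
  - move=> j jm; have := hb j.+1 jm; rewrite subSS.
    by rewrite (_ : k + j.+1%:Z = k + 1 + j%:Z)//; lia.
rewrite big_ord_recl /= addr0 subSS subn0.
have D0 : G k m.+1 (fun t => `|DD k m F (asg xs w t)|) s = `|DD k m F (asg xs w s)|.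
  have iD : inv_on (sset (sites k m.+1)) (fun t => `|DD k m F (asg xs w t)|).
    move=> t t' e; rewrite (@DD_inv k m F (asg xs w t) (asg xs w t'))// => x nx.
    by rewrite /asg; case: ifP => // _; exact: e.
  exact: (wavg_id (bw_gt0 U _) s iD).
rewrite D0 !(G_step_b _ _ _ s) (G_step_b _ _ _ (asg xs w s)).
rewrite (eq_bigr (fun j : 'I_m =>
  pb true k m s * (be j.+1 * G (k + 1) m (fun t => `|DD (k + 1 + j%:Z) (m - j.+1) F (asg xs w t)|) (upd s k true)) +
  pb false k m s * (be j.+1 * G (k + 1) m (fun t => `|DD (k + 1 + j%:Z) (m - j.+1) F (asg xs w t)|) (upd s k false)))); last first.
  move=> j _; rewrite G_step_b subSS /bump /= add1n.
  by rewrite (_ : k + j.+1%:Z = k + 1 + j%:Z); [ring|lia].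
rewrite big_split /= -!mulr_sumr.
have h1 := ler_wpM2l (pb_ge0 true k m s) (IHb true).
have h2 := ler_wpM2l (pb_ge0 false k m s) (IHb false).
move: h1 h2.
set A := \sum_(j < m) _; set B := \sum_(j < m) _.
have -> : pb true k m s * G (k + 1) m F (upd s k true) +
   pb false k m s * G (k + 1) m F (upd s k false) -
   (pb true k m (asg xs w s) * G (k + 1) m F (upd (asg xs w s) k true) +
    pb false k m (asg xs w s) * G (k + 1) m F (upd (asg xs w s) k false)) =
  pb true k m s * (G (k + 1) m F (upd s k true) - G (k + 1) m F (upd (asg xs w s) k true)) +
  pb false k m s * (G (k + 1) m F (upd s k false) - G (k + 1) m F (upd (asg xs w s) k false)) +
  (pp k m s - pp k m (asg xs w s)) * DD k m F (asg xs w s).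
  have id (p p' x1 x0 y1 y0 : R) : p * x1 + (1 - p) * x0 - (p' * y1 + (1 - p') * y0) =
      p * (x1 - y1) + (1 - p) * (x0 - y0) + (p - p') * (y1 - y0) by ring.
  exact: id.
move=> h1 h2; apply: (le_trans (ler_normD _ _)).
apply: (le_trans (lerD (ler_normD _ _) (lexx _))).
have nb b x : `|pb b k m s * x| = pb b k m s * `|x|.
  by rewrite normrM (ger0_norm (pb_ge0 b k m s)).
rewrite (nb true) (nb false) (normrM (pp k m s - _)).
have h3 := ler_wpM2r (normr_ge0 (DD k m F (asg xs w s))) hp.
have comb (p p' x1 x0 y be0 g1 g0 a1 a0 : R) : x1 <= p * (g1 + a1) -> x0 <= p' * (g0 + a0) ->
    y <= be0 -> x1 + x0 + y <= p * g1 + p' * g0 + (be0 + (p * a1 + p' * a0)).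
  by clear; rewrite !mulrDr => *; lra.
exact: comb h1 h2 h3.
Qed.

Lemma G_past k m xs w c Q s : (forall s, 0 <= Q s) ->
  (forall x, x \in xs -> x < k) -> cle U (sset xs) (sset (sites k m)) c ->
  G k m (fun t => Q (asg xs w t)) s <= expR c * G k m Q (asg xs w s).
Proof.
move=> Q0 xsk hc; apply: (gam_ratio U_int hc).
  move=> x nx; rewrite asg_notin//; apply/negP => xx; apply: nx; left; exact: xx.
move=> v _; rewrite Q0 asgC ?lexx// => x xx; rewrite mem_sites; have := xsk x xx; lia.
Qed.

End chain.

(** * The block estimate *)

(** The index is shifted because [th 0] is reserved for the site just left of the block, where the
    two pasts differ with certainty. The square leaves one factor [th] after division by [th] in the
    Cauchy-Schwarz inequality. *)
Definition coupled (R : realType) (ell : nat) (P1 P0 : seq bool -> R) (th : nat -> R) :=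
  exists pi : seq bool -> seq bool -> R, [/\
    forall u v, 0 <= pi u v,
    forall u, u \in bits ell -> \sum_(v <- bits ell) pi u v = P1 u,
    forall v, v \in bits ell -> \sum_(u <- bits ell) pi u v = P0 v &
    forall i, (i < ell)%N -> \sum_(u <- bits ell) \sum_(v <- bits ell)
      pi u v * (nth false u i != nth false v i)%:R <= th i.+1 ^+ 2].

Section block.
Variables (R : realType) (U : {fset int} -> Omega -> R).
Hypotheses (U_int : interaction U) (U_diam : diam_summable U).
Implicit Types (F Q : Omega -> R) (s : Omega).

Local Notation G k m := (gam U (sites k m)).

Definition law (a : int) (ell m : nat) (s : Omega) (u : seq bool) : R :=
  G a (ell + m) (fun t => (obs (sites a ell) t == u)%:R) s.

Lemma block_decomp a ell m F s : G a (ell + m) F s =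
  \sum_(u <- bits ell) law a ell m s u * G (a + ell%:Z) m F (asg (sites a ell) u s).
Proof.
have d : disj (sites a ell) (sites (a + ell%:Z) m).
  by move=> x; rewrite !mem_sites; lia.
rewrite /law sites_cat (gam_tower U_int F d).
set K := gam U (sites (a + ell%:Z) m) F; set L := _ ++ _.
have EK : K = fun t => \sum_(u <- bits ell)
    (obs (sites a ell) t == u)%:R * K (asg (sites a ell) u t).
  apply/funext => t; rewrite (bigD1_seq (obs (sites a ell) t)) /= ?bits_uniq//; last first.
    by have := obs_bits (sites a ell) t; rewrite size_sites.
  rewrite eqxx mul1r asg_obsK big1 ?addr0// => u; rewrite eq_sym => /negbTE ->.
  by rewrite mul0r.
rewrite {1}EK /gam wavg_sum; apply: eq_bigr => u _.
rewrite (@wavgMr _ _ _ _ (fun t => K (asg (sites a ell) u t)))//.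
move=> t t' e; apply: gam_inv => x nx; rewrite /asg; case: ifPn => // /negP xl.
by apply: e; rewrite /sset /= mem_cat => /orP[].
Qed.

Lemma law_ge0 a ell m s u : 0 <= law a ell m s u.
Proof. by apply: G_ge0. Qed.

Lemma law_sum a ell m s : \sum_(u <- bits ell) law a ell m s u = 1.
Proof.
rewrite -(wavg1 (bw_gt0 U (sites a (ell + m))) (sites a (ell + m)) s).
rewrite -/(gam U _ (fun=> 1)) block_decomp; apply: eq_bigr => u _.
by rewrite /gam wavg1 ?mulr1//; exact: bw_gt0.
Qed.

(** Two crude changes of measure: [expR c] for the law to the right of the block under a changed
    past, and one factor 1/dlt per site for passing from a sum over patterns to an average. *)
Lemma G_ssum_past k N m c Q s : (forall s, 0 <= Q s) ->
  cle U (sset (sites k N)) (sset (sites (k + N%:Z) m)) c ->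
  forall s', eqoff (sset (sites k N)) s s' ->
  G (k + N%:Z) m (ssum (sites k N) Q) s' <=
  expR c / dlt U ^+ N * G k (N + m) Q s.
Proof.
move=> Q0 hc s' e.
have -> : G (k + N%:Z) m (ssum (sites k N) Q) s' =
    \sum_(v <- bits N) G (k + N%:Z) m (fun t => Q (asg (sites k N) v t)) s'.
  by rewrite /gam -wavg_sum; congr wavg; apply/funext => t; rewrite /ssum size_sites.
apply: (@le_trans _ _ (expR c * ssum (sites k N) (G (k + N%:Z) m Q) s)).
  rewrite /ssum size_sites mulr_sumr; apply: ler_sum => v _.
  rewrite (asg_eqoff v e); apply: G_past => // x.
  by rewrite mem_sites; lia.
rewrite -mulrA; apply: ler_wpM2l; first exact: expR_ge0.
have d0 : 0 < dlt U ^+ N by rewrite exprn_gt0// dlt_gt0.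
rewrite -(ler_pM2l d0) mulrA divff ?gt_eqF// mul1r.
exact: G_drops.
Qed.

(** The weight of the j-th site beyond the block: position i of k, ..., k + ell lies at distance ell
    + 1 + j - i from it and is charged [th i] for a disagreement. *)
Definition bj (th : nat -> R) ell j := \sum_(i < ell.+1) th i * tt U (ell.+1 + j - i).

(** DD is the mean under the coupling of differences of averages beyond the block, one past being
    [true :: u] and the other [false :: v]. By [past_change] it is at most A + e^c B, with [A] the
    change of [F] when the sites from [k] to the end of the block are altered and [B] the effect
    through the sites beyond it. *)
Lemma block k ell m F s th c phi :
  cle U (sset (sites k ell.+1)) (sset (sites (k + ell.+1%:Z) m)) c ->
  (forall i, 0 < th i) -> 1 <= th 0%N ->
  coupled ell (law (k + 1) ell m (upd s k true)) (law (k + 1) ell m (upd s k false)) th ->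
  \sum_(j < m) bj th ell j <= phi ->
  DD U k (ell + m) F s ^+ 2 <=
    2 * (ell.+1%:R * (expR c / dlt U ^+ ell.+1)) *
      \sum_(x <- sites k ell.+1) G k (ell + m).+1 (grad2 F x) s +
    2 * (expR c ^+ 2 * phi / dlt U) *
      \sum_(j < m) bj th ell j *
        G k (ell + m).+1 (fun t => DD U (k + ell.+1%:Z + j%:Z) (m - j.+1) F t ^+ 2) s.
Proof.
move=> hc th0 th1 [pi [pi0 piL piR pid]] hphi.
set S := sites (k + 1) ell; set xs := sites k ell.+1; set k' := k + ell.+1%:Z.
have ek' : k' = k + 1 + ell%:Z by rewrite /k'; lia.
have exs : xs = k :: S by rewrite /xs sitesS.
have kS : k \notin S by rewrite mem_sites; lia.
have sS : size S = ell by exact: size_sites.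
have sxs : size xs = ell.+1 by exact: size_sites.
pose al b u := asg S u (upd s k b).
have alE b u : al b u = asg xs (b :: u) s by rewrite exs asg_cons /al upd_asgC.
pose dis (u v : seq bool) i := nth false (true :: u) i != nth false (false :: v) i.
pose Y j v := G k' m (fun t => `|DD U (k' + j%:Z) (m - j.+1) F t|) (al false v).
pose loc u v := G k' m (fun t => `|F t - F (asg xs (false :: v) t)|) (al true u).
pose be u v j := \sum_(i < ell.+1) (dis u v i)%:R * tt U (ell.+1 + j - i).
have be0 u v j : 0 <= be u v j.
  by apply: sumr_ge0 => i _; rewrite mulr_ge0// tt_ge0.
have piS : \sum_(u <- bits ell) \sum_(v <- bits ell) pi u v = 1.
  rewrite -(law_sum (k + 1) ell m (upd s k true)) big_seq [RHS]big_seq.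
  by apply: eq_bigr => u; exact: piL.
have past u v : u \in bits ell -> v \in bits ell ->
    `|G k' m F (al true u) - G k' m F (al false v)| <=
    loc u v + expR c * \sum_(j < m) be u v j * Y j v.
  move=> ub vb; have e0 : al false v = asg xs (false :: v) (al true u).
    by rewrite !alE asgK.
  (* Only the positions where the two patterns disagree transmit an influence to the right. *)
  rewrite e0; pose X := sset [seq k + i%:Z | i <- iota 0 ell.+1 & dis u v i].
  have pc := @past_change _ U U_int xs (false :: v) X (be u v) k' m F (al true u).
  apply: le_trans (pc _ _ _ _) _.
  - move=> x /mapP[i]; rewrite mem_filter mem_iota => /andP[_ i1] ->.
    by rewrite /sset /= mem_sites; lia.
  - by move=> x; rewrite mem_sites /k'; lia.
  - rewrite -e0 !alE => x nx; rewrite /asg; case: ifPn => // xxs.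
    move: (xxs); rewrite mem_sites => hx.
    have ix : index x xs = absz (x - k)%R.
      have ex : x = nth 0 xs (absz (x - k)%R).
        rewrite (nth_map 0%N) ?size_iota; last lia.
        by rewrite nth_iota; lia.
      by rewrite {1}ex index_uniq ?sites_uniq// sxs; lia.
    rewrite ix; apply/eqP/negPn/negP => ne; apply: nx.
    apply/mapP; exists (absz (x - k)%R); last by lia.
    by rewrite mem_filter /dis ne mem_iota; lia.
  - move=> j jm; rewrite /X.
    have := @cle_seq _ U [seq k + i%:Z | i <- iota 0 ell.+1 & dis u v i]
      (sset (sites (k' + j%:Z) (m - j))) (fun x => tt U (absz (k' + j%:Z - x)%R)).
    rewrite big_map big_filter => h; apply: cle_sub (h _) => //; last first.
      move=> x xl; apply: cle_pt => // y; rewrite /sset /= mem_sites.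
      by move: xl => /mapP[i]; rewrite mem_filter mem_iota => /andP[_ i1] ->; rewrite /k'; lia.
    rewrite big_mkcond /be -(big_mkord xpredT (fun i => (dis u v i)%:R * tt U (ell.+1 + j - i))).
    rewrite /index_iota subn0; rewrite big_seq [leRHS]big_seq; apply: ler_sum => i.
    rewrite mem_iota => i1; case: ifP => _; last by rewrite mul0r.
    rewrite mul1r; apply: tt_anti => //; rewrite /k'; lia.
  apply: lerD => //; rewrite mulr_sumr; apply: ler_sum => j _.
  rewrite [leRHS]mulrCA; apply: ler_wpM2l => //; rewrite /Y e0.
  apply: (@G_past _ U U_int k' m xs (false :: v) c
    (fun t => `|DD U (k' + j%:Z) (m - j.+1) F t|)) => //.
  by move=> x; rewrite mem_sites /k'; lia.
have DE : DD U k (ell + m) F s = \sum_(u <- bits ell) \sum_(v <- bits ell)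
    pi u v * (G k' m F (al true u) - G k' m F (al false v)).
  rewrite /DD !block_decomp -ek' -/S.
  under [RHS]eq_bigr do under eq_bigr do rewrite mulrBr.
  under [RHS]eq_bigr do rewrite sumrB.
  rewrite sumrB; congr (_ - _).
    rewrite big_seq [RHS]big_seq; apply: eq_bigr => u ub.
    by rewrite -mulr_suml piL.
  rewrite exchange_big big_seq [RHS]big_seq; apply: eq_bigr => v vb.
  by rewrite -mulr_suml piR.
pose A := \sum_(u <- bits ell) \sum_(v <- bits ell) pi u v * loc u v.
pose B := \sum_(u <- bits ell) \sum_(v <- bits ell) pi u v * \sum_(j < m) be u v j * Y j v.
have DAB : `|DD U k (ell + m) F s| <= A + expR c * B.
  rewrite DE; apply: (le_trans (ler_norm_sum _ _ _)).
  rewrite /A /B mulr_sumr -big_split /= big_seq [leRHS]big_seq; apply: ler_sum => u ub.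
  apply: (le_trans (ler_norm_sum _ _ _)).
  rewrite mulr_sumr -big_split /= big_seq [leRHS]big_seq; apply: ler_sum => v vb.
  rewrite normrM (ger0_norm (pi0 _ _)) (mulrCA (expR c)) -mulrDr.
  by apply: ler_wpM2l => //; exact: past.
have Q2 x s' : 0 <= grad2 F x s' := grad2_ge0 F x s'.
have hA : A ^+ 2 <= ell.+1%:R * (expR c / dlt U ^+ ell.+1) *
      \sum_(x <- xs) G k (ell + m).+1 (grad2 F x) s.
  set T := _ * _.
  have locT u v : v \in bits ell -> loc u v ^+ 2 <= T.
    move=> vb; apply: (le_trans (wavg_sqr (bw_gt0 U _) _ _ _)).
    apply: (@le_trans _ _ (G k' m (fun t => ell.+1%:R * \sum_(x <- xs) ssum xs (grad2 F x) t) (al true u))).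
      apply: wavg_le => [|t _]; first exact: bw_gt0.
      rewrite real_normK ?num_real// -sxs; apply: tele2; first exact: sites_uniq.
      by rewrite sxs /= (bits_size vb).
    rewrite /gam wavgZ wavg_sum /T -mulrA; apply: ler_wpM2l => //.
    rewrite mulr_sumr; apply: ler_sum => x _.
    rewrite -/(gam U _ _) -addSn; apply: G_ssum_past => // y ny.
    by rewrite alE asg_notin//; apply/negP.
  have -> : A = \sum_(p <- [seq (u, v) | u <- bits ell, v <- bits ell]) pi p.1 p.2 * loc p.1 p.2.
    by rewrite big_allpairs.
  apply: (le_trans (wsum_sqr _ _ _)); first by move=> p; exact: pi0.
  rewrite !big_allpairs piS mul1r -[leRHS]mul1r -piS mulr_suml.
  apply: ler_sum => u _; rewrite mulr_suml big_seq [leRHS]big_seq; apply: ler_sum => v vb.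
  by apply: ler_wpM2l => //; exact: locT.
have ge0law v : 0 <= law (k + 1) ell m (upd s k false) v by exact: law_ge0.
have t0 j := tt_ge0 U j.
have hB : B ^+ 2 <= phi * ((dlt U)^-1 * \sum_(j < m) bj th ell j *
        G k (ell + m).+1 (fun t => DD U (k' + j%:Z) (m - j.+1) F t ^+ 2) s).
  pose r := [seq (p, q) | p <- [seq (u, v) | u <- bits ell, v <- bits ell],
                          q <- [seq (j, i) | j <- iota 0 m, i <- iota 0 ell.+1]].
  (* The factor [th] is moved from the weight to the squared term: the total weight becomes the sum
     of P(disagreement at i) tt / th(i), at most the sum of th(i) tt, that is, at most [phi]. *)
  pose w (z : (seq bool * seq bool) * (nat * nat)) :=
    pi z.1.1 z.1.2 * (dis z.1.1 z.1.2 z.2.2)%:R * tt U (ell.+1 + z.2.1 - z.2.2) / th z.2.2.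
  have w0 z : 0 <= w z by rewrite /w divr_ge0 ?(ltW (th0 _))// mulr_ge0// mulr_ge0.
  have BE : B = \sum_(z <- r) w z * (th z.2.2 * Y z.2.1 z.1.2).
    rewrite /r !big_allpairs; apply: eq_bigr => u _; apply: eq_bigr => v _.
    rewrite big_allpairs mulr_sumr -(big_mkord xpredT (fun j => pi u v * (be u v j * Y j v))).
    rewrite /index_iota subn0; apply: eq_bigr => j _.
    rewrite /be mulr_suml mulr_sumr.
    rewrite -(big_mkord xpredT (fun i => pi u v * ((dis u v i)%:R * tt U (ell.+1 + j - i) * Y j v))).
    rewrite /index_iota subn0; apply: eq_bigr => i _; rewrite /w /=.
    rewrite (_ : _ / _ * (_ * _) = pi u v * (dis u v i)%:R * tt U (ell.+1 + j - i) * Y j v * (th i / th i)); last by ring.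
    by rewrite divff ?gt_eqF// mulr1; ring.
  rewrite BE; apply: (le_trans (wsum_sqr _ _ w0)); apply: ler_pM.
  - by apply: sumr_ge0 => z _.
  - by apply: sumr_ge0 => z _; rewrite mulr_ge0// sqr_ge0.
  - apply: le_trans hphi; rewrite /r big_allpairs exchange_big big_allpairs /=.
    rewrite -(big_mkord xpredT (bj th ell)) /index_iota subn0; apply: ler_sum => j _.
    rewrite /bj -(big_mkord xpredT (fun i => th i * tt U (ell.+1 + j - i))) /index_iota subn0.
    rewrite big_seq [leRHS]big_seq; apply: ler_sum => i; rewrite -[0%N :: iota 1 ell]/(iota 0 ell.+1) mem_iota add0n => /andP[_ iell].
    rewrite big_allpairs /w /=.
    have hd : \sum_(u <- bits ell) \sum_(v <- bits ell) pi u v * (dis u v i)%:R <= th i ^+ 2.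
      (* Position 0 is the site [k], where disagreement is certain; here [1 <= th 0] is used. *)
      case: i iell => [|i] iell; last exact: pid.
      rewrite (eq_bigr (fun u => \sum_(v <- bits ell) pi u v)) ?piS; last first.
        by move=> u _; apply: eq_bigr => v _; rewrite mulr1.
      nra.
    rewrite (eq_bigr (fun u => (\sum_(v <- bits ell) pi u v * (dis u v i)%:R) * (tt U (ell.+1 + j - i) / th i))); last first.
      by move=> u _; rewrite mulr_suml; apply: eq_bigr => v _; rewrite !mulrA.
    rewrite -mulr_suml.
    have tt0 : 0 <= tt U (ell.+1 + j - i) / th i by rewrite divr_ge0 ?(ltW (th0 _)).
    apply: (le_trans (ler_wpM2r tt0 hd)); rewrite le_eqVlt; apply/orP; left; apply/eqP.
    by field; rewrite gt_eqF.
  rewrite /r big_allpairs exchange_big big_allpairs /= mulr_sumr.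
  rewrite -(big_mkord xpredT (fun j => (dlt U)^-1 * (bj th ell j *
     G k (ell + m).+1 (fun t => DD U (k' + j%:Z) (m - j.+1) F t ^+ 2) s))).
  rewrite /index_iota subn0; apply: ler_sum => j _.
  pose Z := (dlt U)^-1 * G k (ell + m).+1 (fun t => DD U (k' + j%:Z) (m - j.+1) F t ^+ 2) s.
  rewrite mulrCA -/Z.
  have hZ : \sum_(v <- bits ell) law (k + 1) ell m (upd s k false) v * Y j v ^+ 2 <= Z.
    apply: (@le_trans _ _ (G (k + 1) (ell + m) (fun t => DD U (k' + j%:Z) (m - j.+1) F t ^+ 2) (upd s k false))).
      rewrite block_decomp -ek' -/S; apply: ler_sum => v _; apply: ler_wpM2l => //.
      apply: (le_trans (wavg_sqr (bw_gt0 U _) _ _ _)); rewrite le_eqVlt; apply/orP; left; apply/eqP.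
      by congr wavg; apply/funext => t; rewrite real_normK// num_real.
    rewrite /Z -(ler_pM2l (dlt_gt0 U)) [leRHS]mulrA divff ?gt_eqF ?dlt_gt0// mul1r.
    by apply: G_drop => // t; exact: sqr_ge0.
  have Z0 : 0 <= Z.
    apply: le_trans hZ; apply: sumr_ge0 => v _; by rewrite mulr_ge0// sqr_ge0.
  rewrite /bj -(big_mkord xpredT (fun i => th i * tt U (ell.+1 + j - i))) /index_iota subn0.
  rewrite mulr_suml; apply: ler_sum => i _.
  rewrite big_allpairs /w /=.
  (* In the second factor the indicator of disagreement is dropped. Since [Y] depends on [v] only,
     summing over [u] leaves the marginal law of [v]. *)
  apply: (@le_trans _ _ (\sum_(u <- bits ell) \sum_(v <- bits ell) th i * tt U (ell.+1 + j - i) * (pi u v * Y j v ^+ 2))).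
    apply: ler_sum => u _; apply: ler_sum => v _.
    rewrite exprMn (_ : _ / _ * _ = (dis u v i)%:R * (th i * tt U (ell.+1 + j - i) * (pi u v * Y j v ^+ 2))); last first.
      by field; rewrite gt_eqF.
    rewrite ler_piMl//; last by case: (dis u v i); rewrite ?lexx ?ler01.
    exact: (mulr_ge0 (mulr_ge0 (ltW (th0 i)) (t0 _)) (mulr_ge0 (pi0 _ _) (sqr_ge0 _))).
  have tt0 : 0 <= th i * tt U (ell.+1 + j - i) by exact: mulr_ge0 (ltW (th0 i)) (t0 _).
  rewrite exchange_big; apply: le_trans (ler_wpM2l tt0 hZ).
  rewrite mulr_sumr big_seq [leRHS]big_seq; apply: ler_sum => v vb.
  by rewrite -mulr_sumr -mulr_suml piR.
have : DD U k (ell + m) F s ^+ 2 <= 2 * A ^+ 2 + 2 * (expR c ^+ 2 * B ^+ 2).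
  have : DD U k (ell + m) F s ^+ 2 <= (A + expR c * B) ^+ 2.
    by rewrite -(real_normK (num_real (DD U k (ell + m) F s))) lerXn2r ?nnegrE// (le_trans _ DAB).
  have := sqr_ge0 (A - expR c * B); nra.
move=> /le_trans; apply; apply: lerD.
  by rewrite -mulrA; apply: ler_wpM2l.
move: hB; set SS := \sum_(j < m) _ => hB.
have -> : 2 * (expR c ^+ 2 * phi / dlt U) * SS =
    2 * (expR c ^+ 2 * (phi * ((dlt U)^-1 * SS))) by ring.
by apply: ler_wpM2l => //; apply: ler_wpM2l hB; exact: sqr_ge0.
Qed.

End block.

Lemma sum_shift (R : realType) (f : nat -> R) n i :
  (forall j, 0 <= f j) -> (forall j, (n <= j)%N -> f j = 0) ->
  \sum_(j < n) f (j + i)%N <= \sum_(j < n) f j.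
Proof.
move=> f0 fn.
rewrite -(big_mkord xpredT (fun j => f (j + i)%N)) -(big_mkord xpredT f).
have -> : \sum_(0 <= j < n) f (j + i)%N = \sum_(i <= j < n + i) f j.
  by rewrite -{2}(add0n i) big_addn addnK.
have -> : \sum_(0 <= j < n) f j = \sum_(0 <= j < n + i) f j.
  rewrite (@big_cat_nat _ _ _ n 0 (n + i)) ?leq_addr//= [X in _ + X]big1_seq ?addr0// => j.
  by rewrite mem_index_iota => /andP[_ /andP[nj _]]; exact: fn.
rewrite (@big_cat_nat _ _ _ i 0 (n + i)) ?leq_addl//= lerDr.
by apply: sumr_ge0.
Qed.

(** * The Poincare inequality in finite volume *)

Section finite_poincare.
Variables (R : realType) (U : {fset int} -> Omega -> R).
Hypotheses (U_int : interaction U) (U_diam : diam_summable U).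
Implicit Types (F Q : Omega -> R) (s : Omega).

Local Notation G k m := (gam U (sites k m)).

Lemma coupled_prod ell (P1 P0 : seq bool -> R) :
  (forall u, 0 <= P1 u) -> (forall u, 0 <= P0 u) ->
  \sum_(u <- bits ell) P1 u = 1 -> \sum_(u <- bits ell) P0 u = 1 ->
  coupled ell P1 P0 (fun=> 1).
Proof.
move=> p1 p0 s1 s0; exists (fun u v => P1 u * P0 v); split.
- by move=> u v; exact: mulr_ge0.
- by move=> u _; rewrite -mulr_sumr s0 mulr1.
- by move=> v _; rewrite -mulr_suml s1 mul1r.
move=> i _; apply: (@le_trans _ _ (\sum_(u <- bits ell) \sum_(v <- bits ell) P1 u * P0 v)); last first.
  by rewrite expr1n -[leRHS]s1; apply: ler_sum => u _; rewrite -mulr_sumr s0 mulr1.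
apply: ler_sum => u _; apply: ler_sum => v _.
by rewrite ler_piMr ?mulr_ge0//; case: (_ != _); rewrite ?lexx ?ler01.
Qed.

Lemma G_tower a n j Q s : (j <= n)%N ->
  G a n (G (a + j%:Z) (n - j) Q) s = G a n Q s.
Proof.
move=> jn; have d : disj (sites a j) (sites (a + j%:Z) (n - j)).
  by move=> x; rewrite !mem_sites; lia.
have E : sites a n = sites a j ++ sites (a + j%:Z) (n - j) by rewrite -sites_cat subnKC.
by rewrite E -gam_tower.
Qed.

Lemma dlt_le1 : dlt U <= 1.
Proof.
have := dlt_gt0 U; rewrite /dlt => h.
by rewrite invf_le1 ?addr_gt0 ?expR_gt0// lerDl expR_ge0.
Qed.

(** Summed over all sites, the block estimate bounds the sum SD of the squares of DD by gradients
    plus [kap * phi * SD], and the last hypothesis makes this at most SD / 2. *)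
Lemma fin_poincare ell M (th : nat -> R) (phi : R) :
  (forall i, 0 < th i) -> 1 <= th 0%N ->
  (forall m, \sum_(j < m) bj U th ell j <= phi) ->
  (forall k m s, (M <= m)%N ->
    coupled ell (law U (k + 1) ell m (upd s k true)) (law U (k + 1) ell m (upd s k false)) th) ->
  2 * (expR (ee U 0) ^+ 2 * phi / dlt U) * phi <= 1 / 2 ->
  exists2 C : R, 0 < C & forall a n F s,
    G a n (fun s => F s ^+ 2) s - G a n F s ^+ 2 <=
    C * \sum_(x <- sites a n) G a n (grad2 F x) s.
Proof.
move=> th0 th01 hphi hcoup hkap.
set c := ee U 0; pose N := (ell + M).+1; set kap := 2 * _ in hkap.
have bj0 j : 0 <= bj U th ell j.
  by apply: sumr_ge0 => i _; rewrite mulr_ge0 ?tt_ge0 ?(ltW (th0 _)).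
have phi0 : 0 <= phi by have := hphi 0%N; rewrite big_ord0.
have kap0 : 0 <= kap.
  rewrite /kap !mulr_ge0// ?invr_ge0 ?(ltW (dlt_gt0 U))//; exact: sqr_ge0.
pose CN (N : nat) : R := 2 * (N%:R * (expR c / dlt U ^+ N)).
have CN_le p q : (p <= q)%N -> CN p <= CN q.
  move=> pq; apply: ler_wpM2l => //; apply: ler_pM => //.
  - by rewrite divr_ge0 ?expR_ge0// exprn_ge0// (ltW (dlt_gt0 U)).
  - by rewrite ler_nat.
  apply: ler_wpM2l; first exact: expR_ge0.
  rewrite lef_pV2 ?posrE ?exprn_gt0 ?dlt_gt0//.
  by rewrite ler_wiXn2l// ?dlt_le1// (ltW (dlt_gt0 U)).
have CN0 p : 0 <= CN p.
  apply: mulr_ge0 => //; apply: mulr_ge0 => //; apply: divr_ge0; first exact: expR_ge0.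
  by rewrite exprn_ge0// (ltW (dlt_gt0 U)).
(* [N] bounds the length of every block together with its left neighbour, hence also the number of
   blocks in which a given gradient occurs; the factor 2 comes from the absorption. *)
exists (2 * CN N * N%:R).
  rewrite mulr_gt0// ?ltr0n// mulr_gt0// mulr_gt0// mulr_gt0 ?ltr0n//.
  by rewrite divr_gt0 ?expR_gt0// exprn_gt0 ?dlt_gt0.
move=> a n F s; apply: (le_trans (var_decomp U_int n a F s)).
(* Extension by 0 beyond the volume, so that shifted sums can be compared without boundary terms. *)
pose d j := if (j < n)%N then G a n (fun s => DD U (a + j%:Z) (n - j.+1) F s ^+ 2) s else 0.
pose g i := if (i < n)%N then G a n (grad2 F (a + i%:Z)) s else 0.
have d0 j : 0 <= d j by rewrite /d; case: ifP => // _; apply: G_ge0 => t; exact: sqr_ge0.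
have g0 j : 0 <= g j by rewrite /g; case: ifP => // _; apply: G_ge0 => t; exact: sqr_ge0.
have -> : \sum_(j < n) G a n (fun s => DD U (a + j%:Z) (n - j.+1) F s ^+ 2) s = \sum_(j < n) d j.
  by apply: eq_bigr => j _; rewrite /d ltn_ord.
have -> : \sum_(x <- sites a n) G a n (grad2 F x) s = \sum_(i < n) g i.
  rewrite /sites big_map -(big_mkord xpredT g) /index_iota subn0 big_seq [RHS]big_seq.
  by apply: eq_bigr => i; rewrite mem_iota /g => /andP[_ ->].
have cl k N' m : cle U (sset (sites k N')) (sset (sites (k + N'%:Z) m)) c.
  apply: cle_sub (cle_half U_int U_diam (k + N'%:Z) 0) => //.
    by move=> x /sset_sites; rewrite /=; lia.
  by move=> x /sset_sites; rewrite /=; lia.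
have gsum (j N' : nat) : (j + N' <= n)%N ->
    \sum_(x <- sites (a + j%:Z) N') G a n (grad2 F x) s = \sum_(i < N') g (j + i)%N.
  move=> jN; rewrite /sites big_map -(big_mkord xpredT (fun i => g (j + i)%N)) /index_iota subn0.
  rewrite big_seq [RHS]big_seq; apply: eq_bigr => i; rewrite mem_iota => /andP[_ iN].
  by rewrite /g ifT; [congr gam; congr grad2; rewrite PoszD addrA|lia].
have gmono (j p q : nat) : (p <= q)%N -> \sum_(i < p) g (j + i)%N <= \sum_(i < q) g (j + i)%N.
  move=> pq; rewrite -(subnKC pq) big_split_ord /= lerDl sumr_ge0// => i _; exact: g0.
have key j : (j < n)%N -> d j <= CN N * \sum_(i < N) g (j + i)%N +
    kap * \sum_(i < n) bj U th ell i * d (j + ell.+1 + i)%N.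
  move=> jn.
  have tail0 : 0 <= \sum_(i < n) bj U th ell i * d (j + ell.+1 + i)%N.
    by apply: sumr_ge0 => i _; rewrite mulr_ge0.
  (* Too close to the right end, the block is extended to the end of the volume and coupled
     independently: no site remains beyond it, and its length is bounded by ell + M. *)
  have [near|far] := ltnP (n - j.+1) (ell + M).
    set r := (n - j.+1)%N in near.
    have cp t : coupled r (law U (a + j%:Z + 1) r 0 (upd t (a + j%:Z) true))
       (law U (a + j%:Z + 1) r 0 (upd t (a + j%:Z) false)) (fun=> 1).
      by apply: coupled_prod => [u|u||]; rewrite ?law_ge0 ?law_sum.
    have bl t := @block _ U U_int (a + j%:Z) r 0 F t (fun=> 1) c 0
      (cl _ _ _) (fun=> ltr01) (lexx _) (cp t).
    have {}bl t : DD U (a + j%:Z) r F t ^+ 2 <= CN r.+1 *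
        \sum_(x <- sites (a + j%:Z) r.+1) G (a + j%:Z) (n - j) (grad2 F x) t.
      have := bl t; rewrite !big_ord0 mulr0 addr0 !addn0 => /(_ (lexx _)).
      by rewrite /CN (_ : r.+1 = n - j)%N// /r; lia.
    have : d j <= CN r.+1 * \sum_(i < r.+1) g (j + i)%N.
      rewrite /d jn -gsum; last by rewrite /r; lia.
      apply: (le_trans (G_le U a n s bl)).
      rewrite /gam wavgZ wavg_sum; apply: ler_wpM2l => //.
      apply: ler_sum => x _; rewrite -!/(gam U _ _) G_tower//; lia.
    move=> /le_trans; apply; apply: ler_wpDr; first exact: mulr_ge0.
    apply: ler_pM => //; first by apply: sumr_ge0.
      by apply: CN_le; rewrite /N; lia.
    by apply: gmono; rewrite /N; lia.
  pose m := (n - j.+1 - ell)%N.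
  have Em : (n - j.+1 = ell + m)%N by rewrite /m; lia.
  have En : (n - j = (ell + m).+1)%N by rewrite /m; lia.
  have bl t := @block _ U U_int (a + j%:Z) ell m F t th c phi
      (cl _ _ _) th0 th01 (hcoup (a + j%:Z) m t (ltac:(rewrite /m; lia))) (hphi m).
  have : d j <= CN ell.+1 * \sum_(i < ell.+1) g (j + i)%N +
      kap * \sum_(i < m) bj U th ell i * d (j + ell.+1 + i)%N.
    rewrite /d jn -gsum; last by move: Em; lia.
    rewrite Em; apply: (le_trans (G_le U a n s bl)); rewrite -En.
    rewrite /gam wavgD !wavgZ !wavg_sum; apply: lerD;
      apply: ler_wpM2l; try exact: CN0; try exact: kap0.
      by apply: ler_sum => x _; rewrite -!/(gam U _ _) G_tower//; lia.
    apply: ler_sum => i _; rewrite wavgZ; apply: ler_wpM2l => //.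
    rewrite -!/(gam U _ _) G_tower; last lia.
    have im := ltn_ord i; rewrite ifT; last by move: Em; lia.
    apply: G_le => t; rewrite le_eqVlt; apply/orP; left; apply/eqP.
    by congr (DD _ _ _ _ _ ^+ 2); lia.
  move=> /le_trans; apply; apply: lerD.
    apply: ler_pM => //; first by apply: sumr_ge0.
      by apply: CN_le; rewrite /N; lia.
    by apply: gmono; rewrite /N; lia.
  apply: ler_wpM2l => //; have mn : (m <= n)%N by rewrite /m; lia.
  rewrite -(subnKC mn) big_split_ord /= lerDl sumr_ge0// => i _.
  exact: mulr_ge0.
have dn j : (n <= j)%N -> d j = 0 by rewrite /d ltnNge => ->.
have gn j : (n <= j)%N -> g j = 0 by rewrite /g ltnNge => ->.
set SD := \sum_(j < n) d j; set SG := \sum_(i < n) g i.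
have SD0 : 0 <= SD by apply: sumr_ge0.
have : SD <= CN N * (N%:R * SG) + kap * (phi * SD).
  apply: (@le_trans _ _ (\sum_(j < n) (CN N * \sum_(i < N) g (j + i)%N +
    kap * \sum_(i < n) bj U th ell i * d (j + ell.+1 + i)%N))).
    by apply: ler_sum => j _; apply: key.
  rewrite big_split /= -!mulr_sumr; apply: lerD; apply: ler_wpM2l => //.
    rewrite exchange_big /=.
    have -> : N%:R * SG = \sum_(i < N) SG.
      by rewrite sumr_const card_ord mulr_natl.
    by apply: ler_sum => i _; exact: sum_shift.
  rewrite exchange_big /=; apply: (@le_trans _ _ (\sum_(i < n) bj U th ell i * SD)).
    have shifted i : \sum_(j < n) d (j + ell.+1 + i)%N <= SD.
      by under eq_bigr do rewrite -addnA; exact: sum_shift.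
    apply: ler_sum => i _; rewrite -mulr_sumr; exact: (ler_wpM2l (bj0 i) (shifted i)).
  by rewrite -mulr_suml; apply: ler_wpM2r.
have SG0 : 0 <= SG by apply: sumr_ge0.
have := ler_wpM2r SD0 hkap; move: (CN N) => C.
rewrite (_ : 2 * C * N%:R * SG = 2 * (C * (N%:R * SG))); last by ring.
by rewrite (mulrA kap) ; lra.
Qed.

End finite_poincare.

(** * Cylinders generate the Borel sets *)

Section config_measurable.
Variable I : countType.

Definition cyl (l : seq (I * bool)) : set (config I) :=
  [set s : config I | all (fun p => (s : I -> bool) p.1 == p.2) l].

Definition cyls : set (set (config I)) := [set A | exists l, A = cyl l].

Lemma cyl_setI : setI_closed cyls.
Proof.
move=> _ _ [l ->] [l' ->]; exists (l ++ l'); apply/seteqP; split => s;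
  rewrite /cyl /= all_cat.
  by case=> -> ->.
by move=> /andP[].
Qed.

Lemma cyl_nil : cyl [::] = setT.
Proof. by apply/seteqP; split. Qed.

Lemma measurable_coord (x : I) (b : bool) :
  measurable ([set s | (s : I -> bool) x == b] : set (config I)).
Proof.
apply: sub_sigma_algebra.
have -> : [set s : config I | (s : I -> bool) x == b] =
    (@proj I (fun=> bool) x) @^-1` [set b].
  by apply/seteqP; split => s /= /eqP.
apply: open_comp; last by exact: discrete_open.
move=> s _; exact: proj_continuous.
Qed.

Lemma measurable_cyl l : measurable (cyl l).
Proof.
elim: l => [|[x b] l IH]; first by rewrite cyl_nil.
have -> : cyl ((x, b) :: l) = [set s | (s : I -> bool) x == b] `&` cyl l.
  by apply/seteqP; split => s; rewrite /cyl /=; [move=> /andP[]|case=> -> ->].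
by apply: measurableI => //; exact: measurable_coord.
Qed.

(** The cylinders around [s] are a filter base, which converges to [s] because it does so at each
    coordinate. *)
Lemma open_cyl (A : set (prod_topology (fun _ : I => bool))) s :
  open A -> A s -> exists l, cyl l s /\ cyl l `<=` A.
Proof.
move=> oA As.
pose F : set_system (prod_topology (fun _ : I => bool)) :=
  filter_from [set l | cyl l s] cyl.
have FF : Filter F.
  apply: filter_from_filter; first by exists [::].
  move=> l l' sl sl'; exists (l ++ l'); first by rewrite /cyl /= all_cat sl sl'.
  by move=> t; rewrite /cyl /= all_cat => /andP[].
have Fs : F --> (s : prod_topology (fun _ : I => bool)).
  apply/cvg_sup => x B /= [C [[D oD <-] Ds] sB].
  apply: filterS sB _; exists [:: (x, s x)]; first by rewrite /cyl /= eqxx.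
  by move=> t; rewrite /cyl /= andbT => /eqP e; rewrite /preimage /= e; exact: Ds.
have /Fs[l sl lA] : nbhs (s : prod_topology (fun _ : I => bool)) A by apply: open_nbhs_nbhs.
by exists l.
Qed.

(** The index set is countable, so there are only countably many cylinders and an open set is the
    countable union of those that it contains. *)
Lemma measurable_cyls : @measurable _ (config I) = <<s cyls >>.
Proof.
apply/seteqP; split.
  apply: smallest_sub; first exact: smallest_sigma_algebra.
  move=> A oA.
  have -> : A = \bigcup_(l : seq (I * bool)) (if `[< cyl l `<=` A >] then cyl l else set0).
    apply/seteqP; split => [s As|s [l _]].
      have [l [ls lA]] := open_cyl oA As.
      by exists l => //; rewrite asboolT.
    by case: asboolP => // lA; exact: lA.
  apply: (@countable_bigcupT_measurable _ (g_sigma_algebraType cyls)).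
    exact: countableP.
  move=> l; case: asboolP => _; last exact: measurable0.
  by apply: sub_sigma_algebra; exists l.
apply: smallest_sub; first exact: smallest_sigma_algebra.
by move=> _ [l ->]; exact: measurable_cyl.
Qed.

Lemma config_measurable d (T : measurableType d) (h : T -> config I) :
  (forall x, measurable [set w | (h w : I -> bool) x]) -> measurable_fun setT h.
Proof.
move=> mh; apply: (measurability cyls); first exact: measurable_cyls.
move=> _ [_ [l ->] <-]; rewrite setTI.
elim: l => [|[x b] l IH]; first by rewrite cyl_nil preimage_setT.
have -> : h @^-1` cyl ((x, b) :: l) =
    (if b then [set w | (h w : I -> bool) x] else ~` [set w | (h w : I -> bool) x])
    `&` h @^-1` cyl l.
  apply/seteqP; split => w; rewrite /cyl /preimage /=.
    by move=> /andP[/eqP <- ->]; split => //; case: ifP => //= /negP.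
  by case: b => -[/= e ->]; [rewrite e|rewrite andbT; case: (h w x) e].
apply: measurableI => //; case: b => //; exact: measurableC.
Qed.

Lemma config_measure_unique (R : realType) (m1 m2 : {measure set (config I) -> \bar R}) :
  (m1 setT < +oo)%E -> (forall l, m1 (cyl l) = m2 (cyl l)) ->
  forall A, measurable A -> m1 A = m2 A.
Proof.
move=> fin h A; rewrite measurable_cyls => mA.
apply: (@g_sigma_algebra_measure_unique _ _ _ cyls _ (fun=> setT)) => //.
- by move=> _ [l ->]; exact: measurable_cyl.
- by move=> _; exists [::]; rewrite cyl_nil.
- by rewrite bigcup_const//; exists 0%N.
- exact: cyl_setI.
- by move=> _ [l ->].
Qed.

End config_measurable.

(** * Expectations of bounded measurable functions *)

Section expect.
Context d (T : measurableType d) (R : realType) (P : probability T R).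
Implicit Types f g : T -> R.

Definition bm f := measurable_fun setT f /\ exists M, forall x, `|f x| <= M.
Definition Ex f : R := \int[P]_x f x.

Lemma bm_int f : bm f -> P.-integrable setT (EFin \o f).
Proof.
move=> [mf [M hM]]; apply: measurable_bounded_integrable => //.
  by rewrite (le_lt_trans (probability_le1 _ _))// ltry.
exists M; split; first exact: num_real.
by move=> x Mx t _; apply: le_trans (hM t) (ltW Mx).
Qed.

Lemma bm_cst (c : R) : bm (fun=> c).
Proof. by split; [exact: measurable_cst|exists `|c|]. Qed.

Lemma bmD f g : bm f -> bm g -> bm (fun x => f x + g x).
Proof.
move=> [mf [M hM]] [mg [N hN]]; split; first exact: measurable_funD.
by exists (M + N) => x; apply: le_trans (ler_normD _ _) (lerD _ _).
Qed.

Lemma bmM f g : bm f -> bm g -> bm (fun x => f x * g x).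
Proof.
move=> [mf [M hM]] [mg [N hN]]; split; first exact: measurable_funM.
by exists (M * N) => x; rewrite normrM; apply: ler_pM.
Qed.

Lemma bmZ c f : bm f -> bm (fun x => c * f x).
Proof. by move=> bf; apply: bmM => //; exact: bm_cst. Qed.

Lemma bmB f g : bm f -> bm g -> bm (fun x => f x - g x).
Proof.
move=> bf bg; have := bmD bf (bmZ (-1) bg).
by congr bm; apply/funext => x; rewrite mulN1r.
Qed.

Lemma bm_sqr f : bm f -> bm (fun x => f x ^+ 2).
Proof. by move=> bf; have := bmM bf bf; congr bm; apply/funext => x; rewrite expr2. Qed.

Lemma bm_sum I (r : seq I) (F : I -> T -> R) : (forall i, bm (F i)) ->
  bm (fun x => \sum_(i <- r) F i x).
Proof.
move=> h; elim: r => [|i r IH].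
  by have := bm_cst 0; congr bm; apply/funext => x; rewrite big_nil.
by have := bmD (h i) IH; congr bm; apply/funext => x; rewrite big_cons.
Qed.

Lemma bm_comp d' (T' : measurableType d') (h : T' -> T) f :
  measurable_fun setT h -> bm f -> measurable_fun setT (f \o h) /\ exists M, forall x, `|f (h x)| <= M.
Proof.
by move=> mh [mf [M hM]]; split; [exact: measurableT_comp|exists M].
Qed.

Lemma bm_indic (A : set T) : measurable A -> bm (\1_A).
Proof.
move=> mA; split; first exact: measurable_indic.
by exists 1 => x; rewrite indicE; case: (x \in A); rewrite ?normr1 ?normr0 ?lexx ?ler01.
Qed.

Lemma EFin_Ex f : bm f -> (Ex f)%:E = (\int[P]_x (f x)%:E)%E.
Proof. by move=> bf; rewrite /Ex /Rintegral fineK//; exact: integrable_fin_num (bm_int bf). Qed.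

Lemma ExD f g : bm f -> bm g -> Ex (fun x => f x + g x) = Ex f + Ex g.
Proof. by move=> bf bg; rewrite /Ex RintegralD//; exact: bm_int. Qed.

Lemma ExB f g : bm f -> bm g -> Ex (fun x => f x - g x) = Ex f - Ex g.
Proof. by move=> bf bg; rewrite /Ex RintegralB//; exact: bm_int. Qed.

Lemma ExZ c f : bm f -> Ex (fun x => c * f x) = c * Ex f.
Proof. by move=> bf; rewrite /Ex RintegralZl//; exact: bm_int. Qed.

Lemma Ex_cst c : Ex (fun=> c) = c.
Proof.
rewrite /Ex Rintegral_cst// -[RHS]mulr1; congr (_ * _).
exact: (congr1 fine (probability_setT P)).
Qed.

Lemma Ex_sum I (r : seq I) (F : I -> T -> R) : (forall i, bm (F i)) ->
  Ex (fun x => \sum_(i <- r) F i x) = \sum_(i <- r) Ex (F i).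
Proof.
move=> h; elim: r => [|i r IH].
  by rewrite big_nil -[RHS](Ex_cst 0); congr Ex; apply/funext => x; rewrite big_nil.
rewrite big_cons -IH -ExD//; last exact: bm_sum.
by congr Ex; apply/funext => x; rewrite big_cons.
Qed.

Lemma Ex_le f g : bm f -> bm g -> (forall x, f x <= g x) -> Ex f <= Ex g.
Proof. by move=> bf bg fg; apply: le_Rintegral => //; exact: bm_int. Qed.

Lemma Ex_ge0 f : (forall x, 0 <= f x) -> 0 <= Ex f.
Proof. by move=> f0; apply: Rintegral_ge0. Qed.

Lemma Ex_close f g (e : R) : bm f -> bm g -> (forall x, `|f x - g x| <= e) ->
  `|Ex f - Ex g| <= e.
Proof.
move=> bf bg h; rewrite ler_norml.
have H1 : Ex f <= Ex (fun x => g x + e).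
  apply: Ex_le => //; first exact: bmD bg (bm_cst e).
  by move=> x; have := h x; rewrite ler_norml => /andP[]; lra.
have H2 : Ex g <= Ex (fun x => f x + e).
  apply: Ex_le => //; first exact: bmD bf (bm_cst e).
  by move=> x; have := h x; rewrite ler_norml => /andP[]; lra.
move: H1 H2; rewrite !ExD ?Ex_cst//; try exact: bm_cst.
by move=> ? ?; apply/andP; split; lra.
Qed.

Lemma Ex_indic (A : set T) : measurable A -> Ex (\1_A) = fine (P A).
Proof. by move=> mA; rewrite /Ex /Rintegral integral_indic// setIT. Qed.

Lemma Ex_sqr_le f : bm f -> Ex f ^+ 2 <= Ex (fun x => f x ^+ 2).
Proof.
move=> bf; rewrite -subr_ge0; set m := Ex f.
have -> : Ex (fun x => f x ^+ 2) - m ^+ 2 = Ex (fun x => (f x - m) ^+ 2).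
  have -> : (fun x => (f x - m) ^+ 2) =
      (fun x => (f x ^+ 2 - (2 * m) * f x) + m ^+ 2) by apply/funext => x; ring.
  rewrite ExD; [|exact: bmB (bm_sqr bf) (bmZ _ bf)|exact: bm_cst].
  rewrite ExB; [|exact: bm_sqr|exact: bmZ].
  by rewrite ExZ// Ex_cst -/m; ring.
by apply: Ex_ge0 => x; exact: sqr_ge0.
Qed.

(** For values in [0,1] this is N f rounded down, divided by N. The approximation is uniform, so
    identities pass from indicators to bounded functions without a convergence theorem. *)
Definition layer (f : T -> R) (N : nat) (x : T) : R :=
  \sum_(k <- iota 1 N) N%:R^-1 * \1_[set y | k%:R / N%:R <= f y] x.

Lemma layer_close f N x : (0 < N)%N -> 0 <= f x <= 1 -> `|layer f N x - f x| <= N%:R^-1.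
Proof.
move=> N0 /andP[f0 f1]; have N0' : 0 < N%:R :> R by rewrite ltr0n.
pose m := Num.truncn (N%:R * f x).
have mle : m%:R <= N%:R * f x by rewrite truncn_le// mulr_ge0.
have mlt : N%:R * f x < m.+1%:R by exact: truncnS_gt.
have mN : (m <= N)%N.
  by rewrite -(ler_nat R) (le_trans mle)// ler_piMr// ltW.
have -> : layer f N x = m%:R / N%:R.
  rewrite /layer -(subnKC mN) iotaD big_cat /=.
  rewrite (@eq_big_seq _ _ _ _ (iota 1 m) _ (fun=> (N%:R)^-1)); last first.
    move=> k; rewrite mem_iota => /andP[_ km]; rewrite subnKC// indicE mem_set ?mulr1//=.
    rewrite ler_pdivrMr// mulrC (le_trans _ mle)// ler_nat; lia.
  rewrite big_const_seq count_predT size_iota iter_addr addr0 [X in _ + X]big1_seq; last first.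
    move=> k /andP[_]; rewrite mem_iota => /andP[mk _]; rewrite indicE memNset ?mulr0//=.
    apply/negP; rewrite -ltNge subnKC// ltr_pdivlMr// mulrC (lt_le_trans mlt)// ler_nat; lia.
  by rewrite addr0 mulr_natl subnKC.
rewrite ler_norml; apply/andP; split.
  rewrite -subr_ge0 -(pmulr_rge0 _ N0') (_ : _ * _ = m%:R + 1 - N%:R * f x).
    by rewrite subr_ge0 natr1 ltW.
  by field; rewrite gt_eqF.
rewrite -subr_ge0 -(pmulr_rge0 _ N0') (_ : _ * _ = 1 + N%:R * f x - m%:R); first lra.
by field; rewrite gt_eqF.
Qed.

Lemma measurable_level f (c : R) : measurable_fun setT f ->
  measurable [set y | c <= f y].
Proof.
move=> mf; have := mf measurableT _ (measurable_itv `[c, +oo[).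
by rewrite setTI; congr measurable; apply/seteqP; split => x /=; rewrite in_itv /= andbT.
Qed.

Lemma bm_layer f N : measurable_fun setT f -> bm (layer f N).
Proof.
move=> mf; apply: bm_sum => k; apply: bmZ; apply: bm_indic.
exact: measurable_level.
Qed.

End expect.

(** * Restriction and extension of configurations *)

(** A measurable right inverse of [res P], by which functions of the spins in [P] are handled as
    functions on [Omega]. *)
Definition ext (P : pred int) (y : config_on P) : Omega :=
  fun x => if insub x is Some u then (y : {x : int | P x} -> bool) u else false.

Lemma ext_res (P : pred int) (s : Omega) x : P x -> ext (res P s) x = s x.
Proof. by move=> Px; rewrite /ext insubT. Qed.

Lemma res_ext P (y : config_on P) : res P (ext y) = y.
Proof. by apply/funext => u; rewrite /res /ext valK. Qed.

Lemma res_eq (P : pred int) (s s' : Omega) : (forall x, P x -> s x = s' x) <-> res P s = res P s'.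
Proof.
split=> [h|h x Px]; first by apply/funext => u; rewrite /res h//; exact: valP.
by rewrite -(ext_res s Px) h ext_res.
Qed.

Lemma measurable_spin (x : int) : measurable ([set s | s x] : set Omega).
Proof.
have := @measurable_coord int x true; congr measurable.
by apply/seteqP; split => s /=; [move/eqP|move=> ->].
Qed.

Lemma measurable_res P : measurable_fun setT (res P : Omega -> config_on P).
Proof. by apply: config_measurable => u; exact: measurable_spin. Qed.

Lemma measurable_ext P : measurable_fun setT (@ext P : config_on P -> Omega).
Proof.
apply: config_measurable => x; rewrite /ext; case: insubP => [u _ _|_].
  have := @measurable_coord _ u true; congr measurable.
  by apply/seteqP; split => s /=; [move/eqP|move=> ->].
by rewrite (_ : [set _ | _] = set0)//; apply/seteqP; split.
Qed.

Lemma measurable_asg l v : measurable_fun setT (asg l v : Omega -> Omega).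
Proof.
apply: config_measurable => x; rewrite /asg; case: (x \in l); last exact: measurable_spin.
set b := nth _ _ _; case: b.
  have -> : [set w : Omega | true] = setT by apply/seteqP; split.
  exact: measurableT.
have -> : [set w : Omega | false] = set0 by apply/seteqP; split.
exact: measurable0.
Qed.

Lemma measurable_upd x b : measurable_fun setT (fun s : Omega => upd s x b : Omega).
Proof.
have -> : (fun s : Omega => upd s x b : Omega) = asg [:: x] [:: b] by apply/funext => s; rewrite asg1.
exact: measurable_asg.
Qed.

Lemma measurable_flip x : measurable_fun setT (flip x : Omega -> Omega).
Proof.
apply: config_measurable => y; rewrite /flip; case: (y == x); last exact: measurable_spin.
have := measurableC (measurable_spin y); congr measurable.
by apply/seteqP; split => s /= /negP.
Qed.

Lemma measurable_obs l v : measurable ([set s | obs l s == v] : set Omega).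
Proof.
elim: l v => [|x l IH] [|b v].
- by rewrite (_ : [set _ | _] = setT)//; apply/seteqP; split.
- by rewrite (_ : [set _ | _] = set0)//; apply/seteqP; split.
- by rewrite (_ : [set _ | _] = set0)//; apply/seteqP; split.
have -> : [set s : Omega | obs (x :: l) s == b :: v] =
   [set s : Omega | s x == b] `&` [set s : Omega | obs l s == v].
  by apply/seteqP; split => s; rewrite /= eqseq_cons; [move=> /andP[]|case=> -> ->].
by apply: measurableI; [exact: measurable_coord|exact: IH].
Qed.

Section local_functions.
Variable R : realType.
Implicit Types F : Omega -> R.

Lemma indE l v : (fun s => (obs l s == v)%:R) = \1_[set s | obs l s == v] :> (Omega -> R).
Proof. by apply/funext => s; rewrite indicE; congr ((nat_of_bool _)%:R); apply/idP/idP; rewrite inE. Qed.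

Lemma bm_obs l v : bm (fun s : Omega => (obs l s == v)%:R : R).
Proof. by rewrite indE; apply: bm_indic; exact: measurable_obs. Qed.

Lemma bm_local l F : inv_on (~` sset l) F -> bm F.
Proof.
move=> iF; have -> : F = fun s => \sum_(v <- bits (size l))
    F (asg l v (fun=> false)) * (obs l s == v)%:R.
  apply/funext => s; rewrite (bigD1_seq (obs l s)) /= ?obs_bits ?bits_uniq//.
  rewrite eqxx mulr1 big1 ?addr0.
    apply: iF => x /contrapT xl; rewrite asg_obs; case: ifP => //.
    by move: xl; rewrite /sset /= => ->.
  by move=> u; rewrite eq_sym => /negbTE ->; rewrite mulr0.
by apply: bm_sum => v; apply: bmZ; exact: bm_obs.
Qed.

(** [F] is the limit of functions of finitely many spins, obtained by setting the spins outside a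
    box to [false]. *)
Lemma measurable_quasilocal F :
  (forall e, 0 < e -> exists N : nat, forall s s',
    (forall x, - N%:Z <= x < N%:Z -> s x = s' x) -> `|F s - F s'| <= e) ->
  measurable_fun setT F.
Proof.
move=> h; pose c (N : nat) (s : Omega) : Omega :=
  fun x => if - N%:Z <= x < N%:Z then s x else false.
apply: (@measurable_fun_cvg _ _ _ _ (fun N s => F (c N s))).
  move=> N.
  have : bm (fun s => F (c N s)).
    apply: (@bm_local (sites (- N%:Z) (N + N))) => s s' e; congr F; apply/funext => x.
    rewrite /c; case: ifPn => // hx; apply: e; apply.
    by rewrite /sset /= mem_sites; lia.
  by case.
move=> s _; apply/cvgrPdist_le => e e0; have [N hN] := h _ e0.
exists N => // n /= Nn; apply: hN => x hx; rewrite /c ifT//; lia.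
Qed.

End local_functions.

(** * The DLR equations *)

Section dlr.
Variables (R : realType) (U : {fset int} -> Omega -> R) (mu : probability Omega R).
Hypotheses (U_int : interaction U) (U_diam : diam_summable U) (mu_gibbs : gibbs U mu).
Implicit Types (F : Omega -> R) (l : seq int).

Definition pr l v : Omega -> R := gam U l (fun s => (obs l s == v)%:R).

Lemma obs_unit l v : unit_fun (fun s : Omega => (obs l s == v)%:R : R).
Proof. by move=> s; case: (_ == _); rewrite /= ?lexx ?ler01. Qed.

Lemma prE l v s : uniq l -> v \in bits (size l) -> pr l v s = wt (bw U l) l v s.
Proof.
move=> ul vl; rewrite /pr /gam wavgE (bigD1_seq v) ?bits_uniq//= obs_asg ?(bits_size vl)//.
rewrite eqxx mulr1 big_seq_cond big1 ?addr0// => w /andP[wl wv].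
by rewrite obs_asg ?(bits_size wl)// (negbTE wv) mulr0.
Qed.

Lemma gam_prE l F s : uniq l ->
  gam U l F s = \sum_(v <- bits (size l)) pr l v s * F (asg l v s).
Proof.
move=> ul; rewrite /gam wavgE big_seq [RHS]big_seq; apply: eq_bigr => v vl.
by rewrite prE.
Qed.

Lemma bnd_seq l : exists N : nat, forall x, x \in l -> - N%:Z <= x < N%:Z.
Proof.
elim: l => [|y l [N hN]]; first by exists 0%N.
exists (maxn N (absz y).+1) => x; rewrite inE => /orP[/eqP ->|/hN]; lia.
Qed.

(** By [gam_lip], changing the boundary condition only far away moves the average by at most 2
    ee(m), so it is quasilocal. *)
Lemma bm_gam_local l l' F : unit_fun F -> inv_on (~` sset l') F -> bm (gam U l F).
Proof.
move=> F01 iF; split; last first.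
  by exists 1 => s; have /andP[g0 g1] := gam_unit U l F01 s; rewrite ger0_norm.
apply: measurable_quasilocal => e e0; have e20 : 0 < e / 2 by lra.
have [m /(_ m (leqnn m)) hm] := ee_cvg U_int U_diam e20.
have [N1 hN1] := bnd_seq l; have [N2 hN2] := bnd_seq l'.
pose N := (N1 + N2 + m)%N; exists N => s s' h.
have hc : cle U (outer true (- N%:Z) N%:Z) (sset l) (ee U m + ee U m).
  by apply: cle_outer => // x /hN1; rewrite /N; lia.
apply: le_trans (_ : ee U m + ee U m <= e); last by lra.
apply: (gam_lip U_int F01 _ hc).
  move=> t t' et; apply: iF => x /contrapT xl'; apply: et => -[|[_]];
  by have := hN2 _ xl'; rewrite /N; lia.
move=> x nx; apply: h; apply/negPn/negP => hx; apply: nx; left.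
by rewrite /outer /=; move: hx; lia.
Qed.

Lemma bm_pr l v : bm (pr l v).
Proof.
apply: (@bm_gam_local l l); first exact: obs_unit.
move=> s s' e; congr ((nat_of_bool (_ == v))%:R); apply/eq_in_map => x xl.
by apply: e; apply.
Qed.

Lemma bm_gam l F : uniq l -> bm F -> bm (gam U l F).
Proof.
move=> ul bF; have -> : gam U l F = fun s => \sum_(v <- bits (size l)) pr l v s * F (asg l v s).
  by apply/funext => s; exact: gam_prE.
apply: bm_sum => v; apply: bmM; first exact: bm_pr.
exact: bm_comp (measurable_asg l v) bF.
Qed.

Definition out l : pred int := outside [fset x in l]%fset.

Lemma outE l x : out l x = (x \notin l).
Proof. by rewrite /out /outside inE. Qed.

Lemma sum_kernel l (k : {measure set (config_on (inside [fset x in l]%fset)) -> \bar R}) s :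
  uniq l ->
  (\sum_(v <- bits (size l)) k [set res (inside [fset x in l]%fset) (asg l v s)] = k setT)%E.
Proof.
set P := inside _; move=> ul.
have Pl x : P x = (x \in l) by rewrite /P /inside inE.
have e0 v : [set res P (asg l v s)] = cyl [seq (u, asg l v s (val u)) | u <- pmap insub l].
  apply/seteqP; split => [_ -> /=|y /= hy].
    by apply/allP => _ /mapP[u _ ->] /=; rewrite /res.
  apply/funext => u; have ul' : u \in pmap insub l by rewrite mem_pmap_sub; have := valP u; rewrite Pl.
  by move/allP : hy => /(_ (u, asg l v s (val u))) /(_ _) /eqP -> //; apply/mapP; exists u.
have mB v : measurable [set res P (asg l v s)] by rewrite e0; exact: measurable_cyl.
rewrite (fsbig_seq _ _ (bits_uniq (size l))) -measure_fin_bigcup//.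
- congr (k _); apply/seteqP; split => // y _.
  exists (obs l (ext y)); first by have := obs_bits l (ext y).
  apply/funext => u; rewrite /res asg_obs; have := valP u; rewrite Pl => ->.
  by rewrite -[in LHS](res_ext y).
- move=> v w /= vl wl [_ [/= -> /res_eq h]].
  rewrite -(obs_asg s ul (bits_size vl)) -(obs_asg s ul (bits_size wl)).
  by apply/eq_in_map => x xl; rewrite h// Pl.
Qed.

(** At almost every boundary condition the kernel of [gibbs] is proportional to [bw] along the
    patterns on [l]; being a probability, it has total mass 1, which forces the constant to be the
    inverse of the normalising sum. *)
Lemma gibbs_set l v (A : set (config_on (out l))) : uniq l -> v \in bits (size l) ->
  measurable A ->
  (mu (res (out l) @^-1` A `&` [set s | obs l s == v]) =
   \int[mu]_(s in res (out l) @^-1` A) (pr l v s)%:E)%E.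
Proof.
move=> ul vl mA; have [k kc kae] := mu_gibbs [fset x in l]%fset.
pose P := inside [fset x in l]%fset; pose o : Omega := fun=> false.
have Pl x : P x = (x \in l) by rewrite /P /inside inE.
have inE' z w : v \in bits (size l) -> res P (asg l v z) = res P w <-> obs l w == v.
  move=> _; rewrite -res_eq; split=> [h|/eqP <- x].
    rewrite -(obs_asg z ul (bits_size vl)); apply/eqP/eq_in_map => x xl.
    by rewrite h// Pl.
  by rewrite Pl asg_obs => ->.
have mB : measurable [set res P (asg l v o)].
  have -> : [set res P (asg l v o)] = @ext P @^-1` [set s | obs l s == v].
    apply/seteqP; split => [_ -> /=|y /=].
      by apply/(inE' o _ vl); rewrite res_ext.
    by move/(inE' o _ vl); rewrite res_ext.
  by rewrite -[_ @^-1` _]setTI; apply: measurable_ext => //; exact: measurable_obs.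
have := kc A _ mA mB; rewrite (_ : res P @^-1` _ = [set s | obs l s == v]); last first.
  by apply/seteqP; split => s /=; [move/esym/(inE' o s vl)|move/(inE' o s vl)/esym].
move=> ->; apply: ae_eq_integral.
- by rewrite -[_ @^-1` _]setTI; exact: measurable_res.
- apply: measurable_funS (_ : measurable_fun setT _) => //.
  apply: (measurableT_comp (measurable_kernel k _ mB)); exact: measurable_res.
- apply/measurable_EFinP; apply: measurable_funS (bm_pr l v).1 => //.
apply: filterS kae => z [c hc] _.
have hk w : k (res (out l) z) [set res P (asg l w z)] = (c * bw U l (asg l w z))%:E.
  rewrite hc /bw /ham; congr ((_ * expR (- _))%:E); rewrite /hamiltonian.
  by rewrite glue_id (_ : Defs.glue _ _ _ = asg l w z)//; apply/funext => x;
    rewrite /Defs.glue /asg inE; case: (x \in l).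
have hs : c * ssum l (bw U l) z = 1.
  apply/EFin_inj; have := sum_kernel (k (res (out l) z)) z ul.
  under eq_bigr do rewrite hk.
  by rewrite prob_kernel sumEFin -mulr_sumr.
rewrite (_ : res P (asg l v o) = res P (asg l v z)); last first.
  by apply/(inE' o _ vl); rewrite obs_asg// (bits_size vl).
rewrite hk prE// /wt; congr EFin.
have Z0 : 0 < ssum l (bw U l) z by apply: ssum_gt0 => ?; exact: bw_gt0.
have -> : c = (ssum l (bw U l) z)^-1.
  by apply: (mulIf (lt0r_neq0 Z0)); rewrite hs mulVf// lt0r_neq0.
by rewrite mulrC.
Qed.

Lemma Ex_setint (A : set Omega) F : measurable A ->
  (\int[mu]_(s in A) (F s)%:E = \int[mu]_s (\1_A s * F s)%:E)%E.
Proof.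
move=> mA; rewrite integral_mkcond; apply: eq_integral => s _.
by rewrite patchE indicE; case: (s \in A); rewrite ?mul1r ?mul0r.
Qed.

Lemma gibbs_set' l v (A : set Omega) : uniq l -> v \in bits (size l) ->
  measurable A -> inv_on (sset l) (\1_A : Omega -> R) ->
  fine (mu (A `&` [set s | obs l s == v])) = Ex mu (fun s => \1_A s * pr l v s).
Proof.
move=> ul vl mA iA; apply/EFin_inj.
rewrite EFin_Ex; last by apply: bmM (bm_pr _ _); exact: bm_indic.
rewrite fineK ?fin_num_measure//; last by apply: measurableI => //; exact: measurable_obs.
have EA : A = res (out l) @^-1` (@ext (out l) @^-1` A).
  have e s : eqoff (sset l) s (ext (res (out l) s)).
    by move=> x nx; rewrite ext_res// outE; exact/negP.
  apply/seteqP; split => s /=; have := iA _ _ (e s); rewrite !indicE.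
    by move=> h As; move: h; rewrite mem_set//; case: (boolP (_ \in A)); rewrite ?inE// => _ /eqP; rewrite oner_eq0.
  move=> h As; move: h; rewrite (mem_set As); case: (boolP (_ \in A)); rewrite ?inE// => _ /eqP.
  by rewrite eq_sym oner_eq0.
rewrite {1}EA gibbs_set//; last by rewrite -[_ @^-1` _]setTI; exact: measurable_ext.
by rewrite -EA Ex_setint.
Qed.

Lemma dlr_set l (B : set Omega) : uniq l -> measurable B ->
  Ex mu (\1_B) = Ex mu (gam U l (\1_B)).
Proof.
move=> ul mB.
have -> : gam U l (\1_B) = fun s => \sum_(v <- bits (size l)) pr l v s * \1_B (asg l v s).
  by apply/funext => s; exact: gam_prE.
have bB v : bm (fun s : Omega => \1_B (asg l v s) : R).
  exact: bm_comp (measurable_asg l v) (bm_indic R mB).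
rewrite Ex_sum; last by move=> v; apply: bmM (bB v); exact: bm_pr.
pose Bv v : set Omega := asg l v @^-1` B.
have mBv v : measurable (Bv v) by rewrite /Bv -[_ @^-1` _]setTI; exact: measurable_asg.
have EB : \1_B = fun s => \sum_(v <- bits (size l)) \1_(Bv v `&` [set s | obs l s == v]) s :> R.
  apply/funext => s; rewrite (bigD1_seq (obs l s)) /= ?obs_bits ?bits_uniq// big1 ?addr0.
    rewrite !indicE; congr ((nat_of_bool _)%:R); apply/idP/idP; rewrite !inE.
      by move=> Bs; split => //=; rewrite /Bv /= asg_obsK.
    by case; rewrite /Bv /= asg_obsK.
  move=> w wo; rewrite indicE memNset// => -[_ /= /eqP e].
  by rewrite e eqxx in wo.
rewrite {1}EB Ex_sum; last first.
  by move=> v; apply: bm_indic; apply: measurableI => //; exact: measurable_obs.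
rewrite big_seq [RHS]big_seq; apply: eq_bigr => v vl.
rewrite Ex_indic; last by apply: measurableI => //; exact: measurable_obs.
rewrite gibbs_set'//.
  congr Ex; apply/funext => s; rewrite [LHS]mulrC; congr (_ * _); rewrite !indicE.
by move=> s s' e; rewrite !indicE /Bv /preimage; congr ((nat_of_bool _)%:R);
  apply/idP/idP; rewrite !inE /= (asg_eqoff v e).
Qed.

Lemma dlr_unit l F : uniq l -> measurable_fun setT F -> unit_fun F ->
  Ex mu F = Ex mu (gam U l F).
Proof.
move=> ul mF F01.
have bF : bm F by split => //; exists 1 => s; have /andP[? ?] := F01 s; rewrite ger0_norm.
apply/eqP; rewrite -subr_eq0 -normr_le0; apply/ler_addgt0Pl => e e0.
rewrite addr0; have [N hN] : exists N : nat, (0 < N)%N /\ (2 / N%:R <= e).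
  exists (Num.truncn (2 / e)).+1; split => //.
  have := @truncnS_gt _ (2 / e); set n := _.+1 => h.
  by rewrite ler_pdivrMr ?ltr0n// mulrC -ler_pdivrMr// ltW.
case: hN => N0 hN.
have bL := @bm_layer _ _ R F N mF.
have h1 : `|Ex mu (layer F N) - Ex mu F| <= N%:R^-1.
  by apply: Ex_close => // s; apply: layer_close.
have h2 : `|Ex mu (gam U l (layer F N)) - Ex mu (gam U l F)| <= N%:R^-1.
  apply: Ex_close; [exact: bm_gam|exact: bm_gam|move=> s].
  rewrite /gam -wavgB; apply: (le_trans (wavg_norm (bw_gt0 U l) _ _ _)).
  have e1 : wavg (bw U l) l (fun=> N%:R^-1 * 1) s = N%:R^-1.
    by rewrite wavgZ wavg1 ?mulr1//; exact: bw_gt0.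
  rewrite -[leRHS]e1; apply: wavg_le => [|t _]; first exact: bw_gt0.
  by rewrite mulr1; apply: layer_close.
have h3 : Ex mu (layer F N) = Ex mu (gam U l (layer F N)).
  have mL k : measurable [set y | k%:R / N%:R <= F y] by exact: measurable_level.
  rewrite /layer Ex_sum; last by move=> k; apply: bmZ; exact: (bm_indic _ (mL _)).
  have -> : gam U l (fun x => \sum_(k <- iota 1 N) N%:R^-1 * \1_[set y | k%:R / N%:R <= F y] x) =
     fun s => \sum_(k <- iota 1 N) N%:R^-1 * gam U l (\1_[set y | k%:R / N%:R <= F y]) s.
    by apply/funext => s; rewrite /gam wavg_sum; apply: eq_bigr => k _; rewrite wavgZ.
  rewrite Ex_sum; last by move=> k; apply: bmZ; apply: bm_gam => //; exact: (bm_indic _ (mL _)).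
  have b1 k : bm (\1_[set y | k%:R / N%:R <= F y] : Omega -> R) := bm_indic R (mL k).
  by apply: eq_bigr => k _; rewrite (ExZ _ _ (b1 k)) (ExZ _ _ (bm_gam ul (b1 k))) -dlr_set.
apply: le_trans hN; move: h1 h2; rewrite h3 !ler_norml => /andP[? ?] /andP[? ?].
by apply/andP; split; lra.
Qed.

Lemma dlr l F : uniq l -> bm F -> Ex mu F = Ex mu (gam U l F).
Proof.
move=> ul bF; have [mF [M hM]] := bF.
pose K := `|M| + 1; have K0 : 0 < K by rewrite /K ltr_wpDl.
pose F' s := (F s + K) / (2 * K).
have FK s : - K <= F s <= K.
  by have := hM s; have := ler_norm M; rewrite /K ler_norml => ? /andP[? ?]; apply/andP; split; lra.
have F'01 : unit_fun F'.
  move=> s; have /andP[h1 h2] := FK s; rewrite /F' divr_ge0 ?ler_pdivrMr//; lra.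
have bF' : bm F'.
  have := bmZ (2 * K)^-1 (bmD bF (bm_cst Omega K)); congr bm.
  by apply/funext => s; rewrite mulrC.
have EF : F = fun s => 2 * K * F' s - K.
  by apply/funext => s; rewrite /F'; field; rewrite gt_eqF.
rewrite EF (_ : gam U l (fun s => 2 * K * F' s - K) = fun s => 2 * K * gam U l F' s - K).
  have bG := bm_gam ul bF'.
  rewrite (ExB _ (bmZ _ bF') (bm_cst Omega K)) (ExB _ (bmZ _ bG) (bm_cst Omega K)).
  by rewrite (ExZ _ _ bF') (ExZ _ _ bG) (dlr_unit ul bF'.1).
apply/funext => s; rewrite /gam wavgB wavgZ; congr (_ - _).
have iK : inv_on (sset l) (fun=> K : R) by [].
by rewrite (wavg_id (bw_gt0 U l) s iK).
Qed.

End dlr.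

(** * Triviality of the tail and passage to mu *)

Section tail.
Variables (R : realType) (U : {fset int} -> Omega -> R) (mu : probability Omega R).
Hypotheses (U_int : interaction U) (U_diam : diam_summable U) (mu_gibbs : gibbs U mu).
Implicit Types (f g F : Omega -> R).

Local Notation E := (Ex mu).
Definition box (N : nat) : seq int := sites (- N%:Z) (N + N).

Lemma box_uniq N : uniq (box N). Proof. exact: sites_uniq. Qed.
Local Notation G N := (gam U (box N)).

(** Triviality of the tail in L2 form: averages over growing boxes, with boundary condition
    distributed by mu, converge to the mean. *)
Definition triv f := forall e, 0 < e -> exists N0 : nat, forall N, (N0 <= N)%N ->
  E (fun s => (G N f s - E f) ^+ 2) <= e.

Lemma bmG N f : bm f -> bm (G N f).
Proof. by move=> bf; apply: bm_gam => //; exact: box_uniq. Qed.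

Lemma dlrG N f : bm f -> E f = E (G N f).
Proof. by move=> bf; apply: dlr => //; exact: box_uniq. Qed.

Lemma bmGE N f : bm f -> bm (fun s => (G N f s - E f) ^+ 2).
Proof. by move=> bf; apply: bm_sqr; apply: bmB; [exact: bmG|exact: bm_cst]. Qed.

Lemma triv_local l F : unit_fun F -> inv_on (~` sset l) F -> triv F.
Proof.
move=> F01 iF e e0; pose eta := Num.min e 1.
have eta0 : 0 < eta by rewrite /eta lt_min e0 ltr01.
have eta1 : eta ^+ 2 <= e.
  have h1 : eta <= e by rewrite /eta ge_min lexx.
  have h2 : eta <= 1 by rewrite /eta ge_min lexx orbT.
  by nra.
have [N1 hN1] := bnd_seq l.
have [M hM] := mem_loss U_int U_diam true (N1 + N1) eta0.
exists (N1 + M)%N => N hN.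
have osc1 s s' : `|G N F s - G N F s'| <= eta.
  have p0 : (M <= N - N1)%N by lia.
  have := hM (- N1%:Z) F F01 _ (N - N1)%N (N - N1)%N p0 p0.
  rewrite (_ : - N1%:Z - (N - N1)%N%:Z = - N%:Z); last lia.
  rewrite (_ : N - N1 + (N1 + N1) + (N - N1) = N + N)%N; last lia.
  move=> h; apply: h.
    move=> t t' et; apply: iF => x /contrapT xl; apply: et => -[|[_]];
    by have := hN1 _ xl; lia.
  move=> x nx; exfalso; apply: nx; rewrite /sset /= mem_sites.
  case: (boolP (- N%:Z <= x < - N%:Z + (N + N)%N%:Z)) => h; first by right.
  by left; rewrite /outer /=; lia.
have bF : bm F by exact: bm_local iF.
rewrite -[leRHS](Ex_cst mu); apply: Ex_le; [exact: bmGE|exact: bm_cst|].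
move=> s; apply: le_trans eta1.
have : `|G N F s - E F| <= eta.
  rewrite (dlrG N bF) -[X in `|X - _|](Ex_cst mu); apply: Ex_close => //.
  - exact: bm_cst.
  - exact: bmG.
by rewrite -(real_normK (num_real (G N F s - _))) => h; rewrite lerXn2r// nnegrE// ltW.
Qed.

Lemma triv_lin c d f g : bm f -> bm g -> triv f -> triv g ->
  triv (fun s => c * f s + d * g s).
Proof.
move=> bf bg tf tg e e0.
pose K := 2 * (c ^+ 2 + d ^+ 2) + 1.
have K0 : 0 < K by have := sqr_ge0 c; have := sqr_ge0 d; rewrite /K; lra.
have [N1 h1] := tf _ (divr_gt0 e0 K0).
have [N2 h2] := tg _ (divr_gt0 e0 K0).
exists (maxn N1 N2) => N; rewrite geq_max => /andP[n1 n2].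
have {}h1 := h1 _ n1; have {}h2 := h2 _ n2.
have bb := bmD (bmZ (2 * c ^+ 2) (bmGE N bf)) (bmZ (2 * d ^+ 2) (bmGE N bg)).
apply: (@le_trans _ _ (2 * c ^+ 2 * (e / K) + 2 * d ^+ 2 * (e / K))); last first.
  rewrite -mulrDl mulrA ler_pdivrMr// mulrC ler_pM2l// /K; lra.
apply: (@le_trans _ _ (E (fun s => 2 * c ^+ 2 * (G N f s - E f) ^+ 2 +
    2 * d ^+ 2 * (G N g s - E g) ^+ 2))).
  apply: Ex_le => //; first by apply: bmGE; exact: bmD (bmZ _ bf) (bmZ _ bg).
  move=> s; rewrite (ExD _ (bmZ _ bf) (bmZ _ bg)) (ExZ _ _ bf) (ExZ _ _ bg).
  rewrite /gam wavgD !wavgZ -!/(gam U (box N) _).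
  have := sqr_ge0 (c * (G N f s - E f) - d * (G N g s - E g)).
  rewrite -!/(gam U (box N) _ _); lra.
rewrite (ExD _ (bmZ _ (bmGE N bf)) (bmZ _ (bmGE N bg))) (ExZ _ _ (bmGE N bf)) (ExZ _ _ (bmGE N bg)).
by apply: lerD; apply: ler_wpM2l => //; rewrite mulr_ge0 ?sqr_ge0.
Qed.

Lemma triv_cst c : triv (fun=> c).
Proof.
move=> e e0; exists 0%N => N _.
have -> : (fun s => (G N (fun=> c) s - E (fun=> c)) ^+ 2) = fun=> 0.
  apply/funext => s; have iK : inv_on (sset (box N)) (fun=> c : R) by [].
  by rewrite /gam (wavg_id (bw_gt0 U _) s iK) Ex_cst subrr expr0n.
by rewrite Ex_cst ltW.
Qed.

(** By [dlr] and Jensen's inequality, averaging over a box does not increase second moments, so an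
    L2 approximation of [f] survives it. The three errors of size e / 9 each receive a factor 3. *)
Lemma triv_approx f : bm f ->
  (forall e, 0 < e -> exists g, [/\ bm g, triv g & E (fun s => (f s - g s) ^+ 2) <= e]) ->
  triv f.
Proof.
move=> bf h e e0; have e9 : 0 < e / 9 by lra.
have [g [bg tg hg]] := h _ e9; have [N0 hN] := tg _ e9.
exists N0 => N /hN {}hN.
have bd := bmB bf bg; have bd2 := bm_sqr bd.
have bG2 := bm_sqr (bmG N bd).
have bb := bmD (bmD (bmZ 3 bG2) (bmZ 3 (bmGE N bg))) (bm_cst Omega (3 * E (fun s => f s - g s) ^+ 2)).
have h1 : E (fun s => G N (fun s => f s - g s) s ^+ 2) <= e / 9.
  apply: le_trans hg; rewrite [leRHS](dlrG N bd2); apply: Ex_le => //; first exact: bmG.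
  by move=> s; apply: wavg_sqr; exact: bw_gt0.
have h2 : E (fun s => f s - g s) ^+ 2 <= e / 9 by apply: le_trans hg; exact: Ex_sqr_le.
apply: (@le_trans _ _ (E (fun s => 3 * G N (fun s => f s - g s) s ^+ 2 +
   3 * (G N g s - E g) ^+ 2 + 3 * E (fun s => f s - g s) ^+ 2))).
  apply: Ex_le => //; first exact: bmGE.
  move=> s; rewrite (ExB _ bf bg) {1}/gam [in leRHS]/gam wavgB -!/(gam U (box N) _ _).
  set a := gam _ _ f s; set b := gam _ _ g s; set c := E f; set d := E g.
  have := sqr_ge0 ((a - b) - (b - d)); have := sqr_ge0 ((a - b) + (c - d)).
  have := sqr_ge0 ((b - d) + (c - d)); nra.
rewrite (ExD _ (bmD (bmZ 3 bG2) (bmZ 3 (bmGE N bg))) (bm_cst _ _)).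
rewrite (ExD _ (bmZ 3 bG2) (bmZ 3 (bmGE N bg))) (ExZ _ _ bG2) (ExZ _ _ (bmGE N bg)) Ex_cst.
lra.
Qed.

(** Dynkin's argument from cylinders, which are local; a countable disjoint union is approximated in
    L2 by finite ones. *)
Lemma triv_indic (B : set Omega) : measurable B -> triv (\1_B).
Proof.
pose P (B : set Omega) := triv (\1_B).
move=> mB; have sB : <<s @cyls int >> B by rewrite -measurable_cyls.
apply: (@dynkin_induction _ _ (@cyls int) P _ _ _ _ _ _ B sB).
- exact: measurable_cyls.
- exact: cyl_setI.
- rewrite /P (_ : \1_setT = fun=> 1); first exact: triv_cst.
  by apply/funext => s; rewrite indicE in_setT.
- move=> _ [l ->]; apply: (@triv_local [seq p.1 | p <- l]).
    by move=> s; rewrite indicE; case: (_ \in _); rewrite /= ?lexx ?ler01.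
  move=> s s' e; rewrite !indicE; congr ((nat_of_bool _)%:R); apply/idP/idP; rewrite !inE /cyl /=;
  move=> /allP h; apply/allP => p pl; rewrite -(eqP (h p pl)); apply/eqP; [symmetry|];
  by apply: e; apply; apply/mapP; exists p.
- move=> S mS; rewrite /P => tS.
  rewrite (_ : \1_(~` S) = fun s => 1 * 1 + (-1) * \1_S s).
    by apply: triv_lin => //; [exact: bm_cst|exact: bm_indic|exact: triv_cst].
  apply/funext => s; rewrite !indicE in_setC; case: (s \in S) => /=; ring.
move=> F mF tF hF; have mU : measurable (\bigcup_k F k) by exact: bigcupT_measurable.
apply: triv_approx => [|e e0]; first exact: bm_indic.
have [n hn] : exists n, fine (mu (\bigcup_k F k)) - \sum_(k <- iota 0 n) fine (mu (F k)) <= e.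
  have := @measure_semi_sigma_additive _ _ _ mu F mF tF mU.
  rewrite -[X in _ --> X]fineK ?fin_num_measure// => /fine_cvg.
  move=> /cvgrPdist_le /(_ e e0)[n _ /(_ n (leqnn n))] /= h; exists n.
  apply: le_trans h; apply: le_trans (ler_norm _); rewrite le_eqVlt; apply/orP; left; apply/eqP.
  congr (_ - _); rewrite -sum_fine; first by rewrite /index_iota subn0.
  by move=> i _; exact: fin_num_measure.
pose g s : R := \sum_(k <- iota 0 n) \1_(F k) s.
have bg : bm g by apply: bm_sum => k; exact: bm_indic.
exists g; split => //.
  rewrite /g; elim: (iota 0 n) => [|k r IH].
    by rewrite (_ : (fun _ => _) = fun=> 0); [exact: triv_cst|apply/funext => s; rewrite big_nil].
  rewrite (_ : (fun _ => _) = fun s => 1 * \1_(F k) s + 1 * \sum_(j <- r) \1_(F j) s); last first.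
    by apply/funext => s; rewrite big_cons !mul1r.
  apply: triv_lin => //; first exact: bm_indic; last exact: hF.
  by apply: bm_sum => j; exact: bm_indic.
apply: le_trans hn.
(* The difference takes the values 0 and 1 only, so the L2 error is the measure of the remaining
   sets. *)
have -> : (fun s => (\1_(\bigcup_k F k) s - g s) ^+ 2) = fun s => \1_(\bigcup_k F k) s - g s.
  apply/funext => s; rewrite /g indicE.
  have [[j _ Fj]|nF] := pselect ((\bigcup_k F k) s).
    rewrite mem_set; last by exists j.
    have gj k : k != j -> \1_(F k) s = 0 :> R.
      move=> kj; rewrite indicE memNset// => Fk.
      by have := tF k j I I; move=> /(_ _)/eqP; rewrite (negbTE kj) => h; have := h (ex_intro _ s (conj Fk Fj)).
    case: (boolP (j \in iota 0 n)) => hj.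
      rewrite (bigD1_seq j) ?iota_uniq//= big1 ?addr0; last by move=> k /gj.
      by rewrite indicE mem_set//= subrr expr0n.
    rewrite big1_seq /= ?subr0 ?expr1n//.
    by move=> k kn; apply: gj; apply: contraNneq hj => <-.
  rewrite memNset// big1 /= ?subr0 ?expr0n//.
  by move=> k _; rewrite indicE memNset// => Fk; apply: nF; exists k.
rewrite (ExB _ (bm_indic _ mU) bg) Ex_indic// /g Ex_sum; last by move=> k; exact: bm_indic.
by under eq_bigr do rewrite Ex_indic//.
Qed.

Lemma triv_sum (I : Type) (r : seq I) (F : I -> Omega -> R) c :
  (forall i, bm (F i)) -> (forall i, triv (F i)) ->
  triv (fun s => \sum_(i <- r) c * F i s).
Proof.
move=> bF tF; elim: r => [|k r IH].
  by rewrite (_ : (fun _ => _) = fun=> 0); [exact: triv_cst|apply/funext => s; rewrite big_nil].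
rewrite (_ : (fun _ => _) = fun s => c * F k s + 1 * \sum_(j <- r) c * F j s); last first.
  by apply/funext => s; rewrite big_cons mul1r.
apply: triv_lin => //; by apply: bm_sum => j; exact: bmZ.
Qed.

Lemma triv_unit f : measurable_fun setT f -> unit_fun f -> triv f.
Proof.
move=> mf f01.
have bf : bm f by split => //; exists 1 => s; have /andP[? ?] := f01 s; rewrite ger0_norm.
apply: triv_approx => // e e0.
have [N [N0 hN]] : exists N : nat, (0 < N)%N /\ (1 / N%:R <= Num.min e 1).
  have m0 : 0 < Num.min e 1 by rewrite lt_min e0 ltr01.
  exists (Num.truncn (1 / Num.min e 1)).+1; split => //.
  have := @truncnS_gt _ (1 / Num.min e 1); set n := _.+1 => h.
  by rewrite ler_pdivrMr ?ltr0n// mulrC -ler_pdivrMr// ltW.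
exists (layer f N); split; first exact: bm_layer.
  apply: triv_sum => k; first exact: (bm_indic _ (measurable_level _ mf)).
  exact: (triv_indic (measurable_level _ mf)).
rewrite -[leRHS](Ex_cst mu); apply: Ex_le; [|exact: bm_cst|].
  by apply: bm_sqr; apply: bmB => //; exact: bm_layer.
move=> s; have := layer_close N0 (f01 s); rewrite -div1r distrC => h.
have h1 := le_trans h hN.
rewrite -(real_normK (num_real (f s - _))).
have := normr_ge0 (f s - layer f N s); move: h1; rewrite le_min => /andP[h1 h2]; nra.
Qed.

Lemma unit_scale f : bm f -> exists2 K : R, 0 < K & unit_fun (fun s => (f s + K) / (2 * K)).
Proof.
move=> [mF [M hM]]; exists (`|M| + 1); first by rewrite ltr_wpDl.
set K := _ + 1; have K0 : 0 < K by rewrite /K ltr_wpDl.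
move=> s; have := hM s; have := ler_norm M; rewrite ler_norml => h /andP[h1 h2].
by rewrite divr_ge0 ?ler_pdivrMr//= /K; lra.
Qed.

Lemma triv_bm f : bm f -> triv f.
Proof.
move=> bf; have [K K0 h] := unit_scale bf.
have bf' : bm (fun s => (f s + K) / (2 * K)).
  have := bmZ (2 * K)^-1 (bmD bf (bm_cst Omega K)); congr bm.
  by apply/funext => s; rewrite mulrC.
have := triv_lin (2 * K) (- K) bf' (bm_cst Omega 1) (triv_unit bf'.1 h) (@triv_cst 1).
by congr triv; apply/funext => s; field; rewrite gt_eqF.
Qed.

Lemma Ex_var f : bm f -> E (fun s => (f s - E f) ^+ 2) = E (fun s => f s ^+ 2) - E f ^+ 2.
Proof.
move=> bf; set m := E f.
have -> : (fun s => (f s - m) ^+ 2) = (fun s => (f s ^+ 2 - (2 * m) * f s) + m ^+ 2).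
  by apply/funext => s; ring.
rewrite (ExD _ (bmB (bm_sqr bf) (bmZ _ bf)) (bm_cst _ _)) (ExB _ (bm_sqr bf) (bmZ _ bf)).
by rewrite (ExZ _ _ bf) Ex_cst -/m; ring.
Qed.

Lemma bm_grad2 f x : bm f -> bm (grad2 f x).
Proof.
by move=> bf; apply: bm_sqr; apply: bmB => //; exact: bm_comp (measurable_flip x) bf.
Qed.

(** Integrating the finite-volume inequality by [dlr] bounds E f^2 - E (G f)^2. What is missing from
    the variance of [f] is the variance of the box average G f, which tends to 0 by triviality of
    the tail. *)
Lemma poincare_mu (C : R) : 0 <= C ->
  (forall a n F s, gam U (sites a n) (fun s => F s ^+ 2) s - gam U (sites a n) F s ^+ 2 <=
    C * \sum_(x <- sites a n) gam U (sites a n) (grad2 F x) s) ->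
  forall f D, bm f -> (forall N, \sum_(x <- box N) E (grad2 f x) <= D) ->
  E (fun s => (f s - E f) ^+ 2) <= C * D.
Proof.
move=> C0 hC f D bf hD; apply/ler_addgt0Pl => e e0.
have [N hN] := triv_bm bf e0; have {}hN := hN N (leqnn N).
have bf2 := bm_sqr bf; have bG := bmG N bf; have bG2 := bm_sqr bG.
have h1 : E (fun s => f s ^+ 2) - E (fun s => G N f s ^+ 2) <= C * D.
  rewrite (dlrG N bf2) -(ExB _ (bmG N bf2) bG2).
  apply: (@le_trans _ _ (E (fun s => C * \sum_(x <- box N) G N (grad2 f x) s))).
    apply: Ex_le; [exact: bmB (bmG N bf2) bG2| |by move=> s; exact: hC].
    by apply: bmZ; apply: bm_sum => x; apply: bmG; exact: bm_grad2.
  rewrite ExZ; last by apply: bm_sum => x; apply: bmG; exact: bm_grad2.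
  rewrite Ex_sum; last by move=> x; apply: bmG; exact: bm_grad2.
  apply: ler_wpM2l => //; apply: le_trans (hD N).
  by apply: ler_sum => x _; rewrite -(dlrG N (bm_grad2 x bf)).
have h2 := Ex_var bG; rewrite -(dlrG N bf) in h2; rewrite h2 in hN.
by rewrite Ex_var//; lra.
Qed.

End tail.

Lemma measure_partition d (T : measurableType d) (R : realType)
    (m : {measure set T -> \bar R}) (n : nat) (h : T -> seq bool) (A : set T) :
  (forall t, h t \in bits n) -> (forall v, measurable [set t | h t == v]) ->
  measurable A ->
  m A = (\sum_(v <- bits n) m (A `&` [set t | h t == v]))%E.
Proof.
move=> hb mh mA; rewrite (fsbig_seq _ _ (bits_uniq n)) -measure_fin_bigcup//.
- congr (m _); apply/seteqP; split => [t At|t [v _ []]//].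
  by exists (h t); [exact: hb|split => //=].
- by move=> v w /= _ _ [t [[_ /eqP <-] [_ /eqP <-]]].
- by move=> v _; exact: measurableI.
Qed.

Lemma ae_seq d (T : measurableType d) (R : realType) (m : {measure set T -> \bar R})
    (I : eqType) (r : seq I) (P : I -> T -> Prop) :
  (forall i, {ae m, forall t, P i t}) -> {ae m, forall t, forall i, i \in r -> P i t}.
Proof.
move=> h; elim: r => [|i r IH]; first by apply: aeW => t j.
by apply: filterS2 (h i) IH => t Pi Pr j; rewrite inE => /orP[/eqP ->|/Pr].
Qed.

(** * Null sets, flips and cylinders *)

Section goodset.
Variables (R : realType) (U : {fset int} -> Omega -> R) (mu : probability Omega R).
Hypotheses (U_int : interaction U) (U_diam : diam_summable U) (mu_gibbs : gibbs U mu).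
Local Notation E := (Ex mu).
Local Notation G k m := (gam U (sites k m)).

Lemma null_Ex (N : set Omega) : measurable N -> E (\1_N) <= 0 -> mu N = 0%E.
Proof.
move=> mN; rewrite Ex_indic// => h.
have N0 : 0 <= fine (mu N) by exact: fine_ge0.
have e : fine (mu N) = 0 by apply/eqP; rewrite eq_le h N0.
by rewrite -[mu N]fineK ?e// fin_num_measure.
Qed.

Lemma ind_ge0 (N : set Omega) s : 0 <= \1_N s :> R.
Proof. by rewrite indicE. Qed.

(** By ellipticity dlt mu(flip^(-1) N) <= mu(N), so flips preserve null sets. It is needed because
    the coupling refers to conditional laws at a flipped past. *)
Lemma ae_flip k (P : Omega -> Prop) :
  {ae mu, forall z, P z} -> {ae mu, forall z, P (flip k z)}.
Proof.
move=> [N [mN N0 sN]]; pose N' := flip k @^-1` N.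
have mN' : measurable N' by rewrite /N' -[_ @^-1` _]setTI; exact: measurable_flip.
exists N'; split => //; last by move=> z /= h; apply: sN.
apply: null_Ex => //; have bN := bm_indic R mN; have bN' := bm_indic R mN'.
rewrite -(ler_pM2l (dlt_gt0 U)) mulr0.
have <- : E (\1_N) = 0 by rewrite Ex_indic// N0.
rewrite -ExZ// (dlr U_int U_diam mu_gibbs (sites_uniq k 1) bN).
apply: Ex_le; [exact: bmZ|exact: bm_gam (sites_uniq _ _) bN|].
move=> s; apply: le_trans (_ : _ <= dlt U * \1_N (upd s k (~~ s k))) _.
  apply: ler_wpM2l; first exact: ltW (dlt_gt0 U).
  by rewrite -flip_upd !indicE ler_nat; case: (boolP (s \in N')); rewrite ?inE// => h; rewrite mem_set.
have := @G_drop _ U U_int (~~ s k) k 0 (\1_N) s (ind_ge0 N); rewrite G0.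
exact.
Qed.

(** A cylinder over [n] sites has probability at least dlt^n, hence is not contained in a null
    set. *)
Lemma ae_cyl a n (s : Omega) (P : Omega -> Prop) : {ae mu, forall z, P z} ->
  exists z, P z /\ forall x, x \in sites a n -> z x = s x.
Proof.
move=> [N [mN N0 sN]]; apply: contrapT => nex.
pose C : set Omega := [set z | obs (sites a n) z == obs (sites a n) s].
have mC : measurable C by exact: measurable_obs.
have CN : C `<=` N.
  move=> z /= /eqP/eq_in_map hz; apply: sN => /= Pz.
  by apply: nex; exists z.
have : E (\1_C) <= 0.
  have bC := bm_indic R mC; have bN := bm_indic R mN.
  apply: (@le_trans _ _ (E (\1_N))).
    apply: Ex_le => // z; rewrite !indicE ler_nat.
    by case: (boolP (z \in C)); rewrite ?inE// => /CN h; rewrite mem_set.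
  by rewrite Ex_indic// N0.
have bC := bm_indic R mC.
rewrite (dlr U_int U_diam mu_gibbs (sites_uniq a n) bC) leNgt => /negP; apply.
have d0 : 0 < dlt U ^+ n by rewrite exprn_gt0// dlt_gt0.
apply: lt_le_trans d0 _; rewrite -[leLHS](Ex_cst mu); apply: Ex_le.
- exact: bm_cst.
- exact: bm_gam (sites_uniq _ _) bC.
move=> z; have := G_drops U_int n a 0 z (ind_ge0 C); rewrite addn0 => h; apply: le_trans h.
apply: ler_peMr; first by rewrite exprn_ge0// ltW// dlt_gt0.
rewrite /ssum (bigD1_seq (obs (sites a n) s)) /= ?obs_bits ?bits_uniq// G0.
rewrite {1}indicE mem_set /= ?lerDl; last first.
  by rewrite /C /= obs_asg ?sites_uniq ?size_obs.
by apply: sumr_ge0 => v _; rewrite indicE.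
Qed.

End goodset.

(** * Conditional laws of mu against finite-volume laws *)

Section from_coupling.
Variables (R : realType) (U : {fset int} -> Omega -> R) (mu : probability Omega R).
Hypotheses (U_int : interaction U) (U_diam : diam_summable U) (mu_gibbs : gibbs U mu).
Variable K : coupling mu.
Local Notation E := (Ex mu).
Local Notation G k m := (gam U (sites k m)).

Let S (k : int) (ell : nat) := sites (k + 1) ell.
Definition cellA (k : int) (ell : nat) (u : seq bool) : set (config_on (after k)) := [set y | obs (S k ell) (ext y) == u].
Arguments cellA : clear implicits.

Lemma measurable_cellA k ell u : measurable (cellA k ell u).
Proof.
have := @measurable_ext (after k) measurableT _ (measurable_obs (S k ell) u).
by rewrite setTI.
Qed.

Arguments measurable_cellA : clear implicits.

Definition condp (k : int) (ell : nat) (u : seq bool) (z : Omega) : R := fine (cp_cond K k (res (upto k) z) (cellA k ell u)).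

Lemma condp_fin k ell u z : cp_cond K k (res (upto k) z) (cellA k ell u) = (condp k ell u z)%:E.
Proof.
rewrite /condp fineK// ge0_fin_numE//; apply: (@le_lt_trans _ _ 1%E); last exact: ltry.
rewrite -(@prob_kernel _ _ _ _ _ (cp_cond K k) (res (upto k) z)).
by apply: le_measure; rewrite ?inE//; exact: measurable_cellA.
Qed.

Lemma bm_condp k ell u : bm (condp k ell u).
Proof.
split.
  apply/measurable_EFinP.
  rewrite (_ : EFin \o _ = fun z => cp_cond K k (res (upto k) z) (cellA k ell u)); last first.
    by apply/funext => z; rewrite condp_fin.
  apply: (@measurableT_comp _ _ _ _ _ _ (fun y => cp_cond K k y (cellA k ell u))).
    exact: (measurable_kernel (cp_cond K k) _ (measurable_cellA k ell u)).
  exact: measurable_res.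
exists 1 => z; rewrite ger0_norm ?fine_ge0// -lee_fin -condp_fin.
rewrite -(@prob_kernel _ _ _ _ _ (cp_cond K k) (res (upto k) z)).
by apply: le_measure; rewrite ?inE//; exact: measurable_cellA.
Qed.

Lemma obs_inv k ell u (D : set int) : (forall x, D x -> x \notin S k ell) ->
  inv_on D (fun t => (obs (S k ell) t == u)%:R : R).
Proof.
move=> h s s' e; congr ((nat_of_bool (_ == u))%:R); apply/eq_in_map => x xS.
by apply: e => /h; rewrite xS.
Qed.

Lemma bm_law k ell m u : bm (fun z => law U (k + 1) ell m z u).
Proof.
apply: (@bm_gam_local _ U U_int U_diam _ (S k ell)); first exact: obs_unit.
by apply: obs_inv => x; rewrite /sset /= => /negP.
Qed.

(** Both sides are the probability of the past event together with the pattern [u]: on the left by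
    [cp_condP], on the right by [dlr] in a volume disjoint from the past. *)
Lemma cond_past k ell m u (A : set (config_on (upto k))) : measurable A ->
  E (fun z => \1_(res (upto k) @^-1` A) z * condp k ell u z) =
  E (fun z => \1_(res (upto k) @^-1` A) z * law U (k + 1) ell m z u).
Proof.
move=> mA; set A' := _ @^-1` A.
have mA' : measurable A' by rewrite /A' -[_ @^-1` _]setTI; exact: measurable_res.
have bA' := bm_indic R mA'; have bO := @bm_obs R (S k ell) u.
transitivity (E (fun z => \1_A' z * (obs (S k ell) z == u)%:R)).
  apply/EFin_inj; rewrite !EFin_Ex; [|exact: bmM|exact: bmM (bm_condp k ell u)].
  have := @cp_condP _ _ K k A _ mA (measurable_cellA k ell u); rewrite -/A'.
  rewrite (_ : res (after k) @^-1` _ = [set s | obs (S k ell) s == u]); last first.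
    apply/seteqP; split => s; rewrite /cellA /preimage /= => /eqP <-; apply/eqP;
    apply/eq_in_map => x; rewrite mem_sites => hx; rewrite ext_res//; rewrite /after; lia.
  move=> h; rewrite -Ex_setint//; under eq_integral do rewrite -condp_fin.
  rewrite -h -EFin_Ex; last exact: bmM.
  rewrite (_ : (fun z => _) = \1_(A' `&` [set s | obs (S k ell) s == u])); last first.
    apply/funext => s; rewrite !indicE -natrM mulnb in_setI; congr ((nat_of_bool (_ && _))%:R).
    by apply/idP/idP; rewrite inE.
  have mI : measurable (A' `&` [set s | obs (S k ell) s == u]).
    by apply: measurableI => //; exact: measurable_obs.
  by rewrite Ex_indic// fineK// fin_num_measure.
rewrite (dlr U_int U_diam mu_gibbs (sites_uniq (k + 1) (ell + m)) (bmM bA' bO)).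
congr Ex; apply/funext => z; rewrite [RHS]mulrC.
rewrite -[RHS]wavgMr; last first.
  move=> s s' e; rewrite !indicE; congr ((nat_of_bool (_ \in A))%:R).
  by apply/res_eq => x kx; apply: e; rewrite /sset /= mem_sites; move: kx; rewrite /upto; lia.
- by congr wavg; apply/funext => t; rewrite mulrC.
Qed.

(** The finite-volume law also depends on spins to the right. Setting these to [false], which costs
    [e1], leaves a function of the past; if it differed from [condp] by at least e1 + e2 on a past
    event of positive measure, the integrals in [cond_past] over that event would differ. Going back
    costs [e1] once more. *)
Lemma ae_close k ell m (e1 e2 : R) u : 0 < e2 ->
  (forall z z', (forall x, x <= k -> z x = z' x) ->
     `|law U (k + 1) ell m z u - law U (k + 1) ell m z' u| <= e1) ->
  {ae mu, forall z, `|condp k ell u z - law U (k + 1) ell m z u| <= 2 * e1 + e2}.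
Proof.
move=> e20 hosc; pose Lo (z : Omega) := law U (k + 1) ell m (ext (res (upto k) z)) u.
have hLo z : `|law U (k + 1) ell m z u - Lo z| <= e1.
  by apply: hosc => x xk; rewrite ext_res.
have bl := bm_law k ell m u; have bq := bm_condp k ell u.
have mext : measurable_fun setT (fun z : Omega => ext (res (upto k) z) : Omega).
  by apply: measurableT_comp; [exact: measurable_ext|exact: measurable_res].
have bLo : bm Lo := bm_comp mext bl.
have one (sg : R) : sg ^+ 2 = 1 ->
    {ae mu, forall z, sg * (condp k ell u z - law U (k + 1) ell m z u) <= 2 * e1 + e2}.
  move=> sg2; pose h (z : Omega) := sg * (condp k ell u z - Lo z).
  have bh : bm h := bmZ sg (bmB bq bLo).
  pose A : set (config_on (upto k)) := @ext (upto k) @^-1` [set z | e1 + e2 <= h z].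
  have mA : measurable A.
    by have := @measurable_ext (upto k) measurableT _ (measurable_level (e1 + e2) bh.1); rewrite setTI.
  have hres z : h (ext (res (upto k) z)) = h z.
    by rewrite /h /Lo /condp !res_ext.
  have EA : res (upto k) @^-1` A = [set z | e1 + e2 <= h z].
    by apply/seteqP; split => z; rewrite /A /preimage /= hres.
  exists [set z | e1 + e2 <= h z]; split.
  - exact: measurable_level bh.1.
  - apply: null_Ex; first exact: measurable_level bh.1.
    have mD := measurable_level (e1 + e2) bh.1.
    set D := [set z | _]; have bD : bm (\1_D : Omega -> R) := bm_indic R mD.
    have := @cond_past k ell m u A mA; rewrite EA -/D => h0.
    have h1 : E (fun z => \1_D z * (sg * (condp k ell u z - law U (k + 1) ell m z u))) = 0.
      rewrite (_ : (fun z => _) = fun z => sg * (\1_D z * condp k ell u z - \1_D z * law U (k + 1) ell m z u)).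
        by rewrite ExZ ?ExB ?h0 ?subrr ?mulr0//; [exact: bmM|exact: bmM|apply: bmB; exact: bmM].
      by apply/funext => z; ring.
    rewrite -(ler_pM2l e20) mulr0 -h1 -ExZ//; apply: Ex_le; first exact: bmZ.
      by apply: bmM => //; apply: bmZ; exact: bmB.
    move=> z; rewrite mulrC indicE; case: (boolP (z \in D)); rewrite ?inE /=; last by rewrite !mul0r.
    move=> Dz; rewrite !mul1r; have := hLo z.
    have : `|sg| = 1.
      have : `|sg| ^+ 2 = 1 by rewrite real_normK ?num_real.
      by have := normr_ge0 sg; nra.
    move=> s1; have := ler_norm (sg * (law U (k + 1) ell m z u - Lo z)).
    rewrite normrM s1 mul1r; move: Dz; rewrite /D /= /h; lra.
  - move=> z /= /negP; rewrite -ltNge => h1; rewrite /h.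
    have := hLo z; have : `|sg| = 1.
      have : `|sg| ^+ 2 = 1 by rewrite real_normK ?num_real.
      by have := normr_ge0 sg; nra.
    move=> s1; have := ler_norm (sg * (Lo z - law U (k + 1) ell m z u)).
    rewrite normrM s1 mul1r distrC; move: h1; rewrite /h; lra.
have o1 := one 1 (expr1n _ _).
have o2 := one (-1) (etrans (sqrrN 1) (expr1n _ _)).
apply: filterS2 o1 o2 => z; rewrite mul1r mulN1r => h1 h2.
by rewrite ler_norml; apply/andP; split; lra.
Qed.

End from_coupling.

Arguments cellA : clear implicits.
Arguments measurable_cellA : clear implicits.

(** * From the coupling under mu to couplings of block laws *)

(** The laws [x1] and [x0] contain 1 - eta times [y1] and [y0]. The old coupling is kept with mass 1
    - eta and the normalised remainders are coupled independently, which adds at most [eta] to each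
    disagreement probability. *)
Lemma coupled_adjust (R : realType) ell (y1 y0 x1 x0 : seq bool -> R) (th : nat -> R) (th' : nat -> R)
    (eta : R) (pi0 : seq bool -> seq bool -> R) :
  0 < eta -> eta <= 1 ->
  (forall u v, 0 <= pi0 u v) ->
  (forall u, u \in bits ell -> \sum_(v <- bits ell) pi0 u v = y1 u) ->
  (forall v, v \in bits ell -> \sum_(u <- bits ell) pi0 u v = y0 v) ->
  (forall i, (i < ell)%N -> \sum_(u <- bits ell) \sum_(v <- bits ell)
      pi0 u v * (nth false u i != nth false v i)%:R <= th i) ->
  (forall i, th i + eta <= th' i.+1 ^+ 2) -> (forall i, 0 <= th i) ->
  (forall u, u \in bits ell -> (1 - eta) * y1 u <= x1 u) ->
  (forall u, u \in bits ell -> (1 - eta) * y0 u <= x0 u) ->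
  \sum_(u <- bits ell) x1 u = 1 -> \sum_(u <- bits ell) x0 u = 1 ->
  \sum_(u <- bits ell) y1 u = 1 -> \sum_(u <- bits ell) y0 u = 1 ->
  coupled ell x1 x0 th'.
Proof.
move=> e0 e1 p0 pL pR pd hth th0 h1 h0 sx1 sx0 sy1 sy0.
pose r1 u := if u \in bits ell then (x1 u - (1 - eta) * y1 u) / eta else 0.
pose r0 u := if u \in bits ell then (x0 u - (1 - eta) * y0 u) / eta else 0.
have r1p u : 0 <= r1 u.
  by rewrite /r1; case: ifP => // /h1 h; rewrite divr_ge0 ?subr_ge0// ltW.
have r0p u : 0 <= r0 u.
  by rewrite /r0; case: ifP => // /h0 h; rewrite divr_ge0 ?subr_ge0// ltW.
have sr (x y : seq bool -> R) : \sum_(u <- bits ell) x u = 1 -> \sum_(u <- bits ell) y u = 1 ->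
    \sum_(u <- bits ell) (if u \in bits ell then (x u - (1 - eta) * y u) / eta else 0) = 1.
  move=> sx sy; rewrite big_seq (eq_bigr (fun u => (x u - (1 - eta) * y u) / eta)).
    by rewrite -big_seq -mulr_suml sumrB -mulr_sumr sx sy; field; rewrite gt_eqF.
  by move=> u ->.
have s1 : \sum_(u <- bits ell) r1 u = 1 by exact: sr.
have s0 : \sum_(u <- bits ell) r0 u = 1 by exact: sr.
have [pi2 [p20 p2L p2R p2d]] := @coupled_prod R ell r1 r0 r1p r0p s1 s0.
exists (fun u v => (1 - eta) * pi0 u v + eta * pi2 u v); split.
- by move=> u v; rewrite addr_ge0 ?mulr_ge0//; lra.
- move=> u ub; rewrite big_split /= -!mulr_sumr pL// p2L// /r1 ub.
  by field; rewrite gt_eqF.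
- move=> v vb; rewrite big_split /= -!mulr_sumr pR// p2R// /r0 vb.
  by field; rewrite gt_eqF.
move=> i il; apply: le_trans (hth i).
have -> : \sum_(u <- bits ell) \sum_(v <- bits ell) ((1 - eta) * pi0 u v + eta * pi2 u v) *
    (nth false u i != nth false v i)%:R =
  (1 - eta) * (\sum_(u <- bits ell) \sum_(v <- bits ell) pi0 u v * (nth false u i != nth false v i)%:R) +
  eta * (\sum_(u <- bits ell) \sum_(v <- bits ell) pi2 u v * (nth false u i != nth false v i)%:R).
  rewrite !mulr_sumr -big_split; apply: eq_bigr => u _ /=.
  by rewrite !mulr_sumr -big_split; apply: eq_bigr => v _ /=; ring.
have := pd i il; have := p2d i il; rewrite expr1n; have := th0 i.
set b := \sum_(u <- _) _; set a := \sum_(u <- _) _ => t0 hb ha.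
have : (1 - eta) * a <= (1 - eta) * th i by apply: ler_wpM2l => //; lra.
have : eta * b <= eta * 1 by apply: ler_wpM2l => //; lra.
nra.
Qed.

Section coupling_blocks.
Variables (R : realType) (U : {fset int} -> Omega -> R) (mu : probability Omega R).
Hypotheses (U_int : interaction U) (U_diam : diam_summable U) (mu_gibbs : gibbs U mu).
Variable K : coupling mu.
Local Notation E := (Ex mu).
Local Notation G k m := (gam U (sites k m)).

Lemma Theta_le1 j : (Theta K j <= 1)%E.
Proof.
apply: ge_ereal_sup => _ [i [s _ ->]].
rewrite -(@prob_kernel _ _ _ _ _ (cp_ker K i) (res (upto i) s)).
have [mA|nA] := pselect (measurable (disagree i j)).
  by apply: le_measure; rewrite ?inE.
exfalso; apply: nA.
have mc (k : {x : int | after i x}) (b : bool) c :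
    measurable [set p : config_on (after i) * config_on (after i) | (p.1 k == b) && (p.2 k == c)].
  have -> : [set p : config_on (after i) * config_on (after i) | (p.1 k == b) && (p.2 k == c)] =
     (fst @^-1` [set y | (y : _ -> bool) k == b]) `&` (snd @^-1` [set y | (y : _ -> bool) k == c]).
    by apply/seteqP; split => p /= ; [move=> /andP[]|case=> -> ->].
  by apply: measurableI; rewrite -[X in measurable X]setTI;
    [apply: measurable_fst|apply: measurable_snd] => //; exact: measurable_coord.
have [ij|ij] := boolP (after i (i + j%:Z)); last first.
  rewrite (_ : disagree i j = set0)//; apply/seteqP; split => // p [k kE _].
  by move: ij; rewrite -kE (valP k).
pose k0 : {x : int | after i x} := exist (fun x : int => is_true (after i x)) _ ij.
rewrite (_ : disagree i j = [set p | (p.1 k0 == true) && (p.2 k0 == false)] `|`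
   [set p | (p.1 k0 == false) && (p.2 k0 == true)]).
  by apply: measurableU; exact: mc.
apply/seteqP; split => p.
  move=> [k kE]; have -> : k = k0 by apply: val_inj.
  by rewrite /=; case: (p.1 k0); case: (p.2 k0) => //= _; [left|right].
by case=> /= h; exists k0 => //; move: h; case: (p.1 k0); case: (p.2 k0).
Qed.

Definition ThR j : R := fine (Theta K j).

Lemma Theta_ge0 j : cp_dom K !=set0 -> (0 <= Theta K j)%E.
Proof.
move=> [s sK]; apply: (@le_trans _ _ (cp_ker K 0 (res (upto 0) s) (disagree 0 j))) => //.
by apply: ereal_sup_ubound; exists 0, s.
Qed.

Lemma dom_nonempty : cp_dom K !=set0.
Proof.
by have [z [hz _]] := ae_cyl U_int U_diam mu_gibbs 0 0 (fun=> true) (cp_domP K); exists z.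
Qed.

Lemma ThR_fin j : Theta K j = (ThR j)%:E.
Proof.
rewrite /ThR fineK// ge0_fin_numE; last exact: Theta_ge0 dom_nonempty.
by apply: le_lt_trans (Theta_le1 j) _; exact: ltry.
Qed.

Lemma ThR_ge0 j : 0 <= ThR j.
Proof. by rewrite -lee_fin -ThR_fin; exact: Theta_ge0 dom_nonempty. Qed.

Lemma ThR_le1 j : ThR j <= 1.
Proof. by rewrite -lee_fin -ThR_fin; exact: Theta_le1. Qed.

Lemma law_lb ell k m s u : u \in bits ell -> dlt U ^+ ell <= law U (k + 1) ell m s u.
Proof.
move=> ub; have := @G_drops _ U U_int ell (k + 1) m (fun t => (obs (sites (k + 1) ell) t == u)%:R) s.
move=> /(_ (fun=> ler0n _ _)); apply: le_trans; apply: ler_peMr.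
  by rewrite exprn_ge0// ltW// dlt_gt0.
rewrite /ssum size_sites (bigD1_seq u) ?bits_uniq//=.
set a := gam _ _ _ _; have -> : a = 1.
  rewrite /a; apply: (etrans _ (wavg1 (bw_gt0 U (sites (k + 1 + ell%:Z) m)) _ (asg (sites (k + 1) ell) u s))).
  apply: eq_wavg => t e; suff -> : obs (sites (k + 1) ell) t = u by rewrite eqxx.
  have eu : obs (sites (k + 1) ell) (asg (sites (k + 1) ell) u s) = u.
    exact: (obs_asg _ (sites_uniq _ _) (etrans (bits_size ub) (esym (size_sites _ _)))).
  rewrite -[RHS]eu; apply/eq_in_map => x; rewrite mem_sites => hx; apply: e.
  by rewrite /sset /= mem_sites; lia.
by rewrite lerDl sumr_ge0// => v _; apply: G_ge0.
Qed.

Lemma coupled_of_K ell (eta : R) (th : nat -> R) : 0 < eta -> eta <= 1 ->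
  (forall i, ThR i.+1 + eta <= th i.+1 ^+ 2) ->
  exists M, forall k m s, (M <= m)%N ->
    coupled ell (law U (k + 1) ell m (upd s k true)) (law U (k + 1) ell m (upd s k false)) th.
Proof.
move=> e0 e1 hth.
have d0 : 0 < dlt U ^+ ell by rewrite exprn_gt0// dlt_gt0.
(* [kap] is eta times the least probability of a block pattern. The budget is spent in fifths: three
   in [ae_close], one for the spins far to the right, one for those far to the left. *)
pose kap := eta * dlt U ^+ ell; have kap0 : 0 < kap by exact: mulr_gt0.
have kap5 : 0 < kap / 5 by lra.
have [M hM] := mem_loss U_int U_diam false ell kap5.
have [m' hm'] := ee_cvg U_int U_diam kap5; have {}hm' := hm' m' (leqnn m').
exists M => k m s Mm.
pose S := sites (k + 1) ell.
have hright z z' u : (forall x, x <= k -> z x = z' x) ->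
    `|law U (k + 1) ell m z u - law U (k + 1) ell m z' u| <= kap / 5.
  move=> h; have := hM (k + 1) (fun t => (obs S t == u)%:R) (@obs_unit R S u) _ M m (leqnn M) Mm.
  rewrite subr0 add0n => hh; apply: hh.
    apply: obs_inv => x; rewrite mem_sites /outer /= => -[|[]//]; lia.
  move=> x nx; apply: h; rewrite leNgt; apply/negP => kx; apply: nx.
  case: (boolP (x \in sites (k + 1) (ell + m))) => hx; first by right.
  by left; left; move: hx; rewrite mem_sites; lia.
have hleft z z' u : (forall x, k - m'%:Z <= x -> z x = z' x) ->
    `|law U (k + 1) ell m z u - law U (k + 1) ell m z' u| <= kap / 5.
  move=> h; apply: le_trans hm'.
  apply: (gam_lip U_int (X := [set x | x < k - m'%:Z])).
  - exact: obs_unit.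
  - by apply: obs_inv => x /=; rewrite mem_sites; lia.
  - apply: cle_sub (cle_half U_int U_diam k m') => //.
    by move=> x /sset_sites /=; lia.
  - by move=> x nx; apply: h; rewrite leNgt; apply/negP => xk; apply: nx; left.
have hae : {ae mu, forall z, forall u, u \in bits ell ->
     `|condp K k ell u z - law U (k + 1) ell m z u| <= 2 * (kap / 5) + kap / 5}.
  apply: ae_seq => u; apply: (ae_close U_int U_diam mu_gibbs) => //.
  by move=> z z'; exact: hright.
pose cls (z : Omega) := forall u, u \in bits ell ->
     `|condp K k ell u z - law U (k + 1) ell m z u| <= 2 * (kap / 5) + kap / 5.
have hae2 : {ae mu, forall z, cp_dom K z /\ (cls z /\ cls (flip k z))}.
  have h2 : {ae mu, forall z, cls z /\ cls (flip k z)}.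
    by apply: filterS2 hae (ae_flip U_int U_diam mu_gibbs k hae) => z h1 h2.
  by apply: filterS2 (cp_domP K) h2 => z h1 h2'.
(* A past in the domain of the coupling, good together with its flip at [k], which imitates [s] on
   the [m'] sites left of [k]. *)
have [z [[zK [zc zf]] zs]] :=
  ae_cyl U_int U_diam mu_gibbs (k - m'%:Z) m'.+1 (upd s k false) hae2.
have zk : z k = false by rewrite zs ?upd_eq// mem_sites; lia.
have fk : flip k z k = true by rewrite flip_upd upd_eq zk.
have close b z0 u : u \in bits ell -> z0 k = b ->
    (forall x, k - m'%:Z <= x < k -> z0 x = s x) ->
    `|condp K k ell u z0 - law U (k + 1) ell m z0 u| <= 2 * (kap / 5) + kap / 5 ->
    (1 - eta) * condp K k ell u z0 <= law U (k + 1) ell m (upd s k b) u.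
  move=> ub zb hz h.
  (* Interpolates: it equals [z0] up to [k], and equals [upd s k b] from k - m' on. *)
  pose w : Omega := fun x => if x < k - m'%:Z then z0 x else if x < k then s x else if x == k then b else s x.
  have h1 : `|law U (k + 1) ell m w u - law U (k + 1) ell m z0 u| <= kap / 5.
    apply: hright => x xk; rewrite /w; case: ifPn => // h1; case: ifPn => h2.
      by rewrite hz//; move: h1 h2; clear; lia.
    have -> : x = k by move: h1 h2 xk; clear; lia.
    by rewrite eqxx.
  have h2 : `|law U (k + 1) ell m w u - law U (k + 1) ell m (upd s k b) u| <= kap / 5.
    apply: hleft => x xk; rewrite /w ifF; last by move: xk; clear; lia.
    by rewrite /upd; case: ifPn => // h2; rewrite ifF//; move: h2; clear; lia.
  have lb := law_lb k m (upd s k b) ub.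
  have q1 : condp K k ell u z0 <= 1 := ltac:(
    by rewrite -lee_fin -condp_fin -(@prob_kernel _ _ _ _ _ (cp_cond K k) (res (upto k) z0));
    apply: le_measure; rewrite ?inE//; exact: measurable_cellA).
  have q0 : 0 <= condp K k ell u z0 by exact: fine_ge0.
  set x := law U (k + 1) ell m (upd s k b) u in lb h2 *.
  have hx : `|condp K k ell u z0 - x| <= kap.
    move: h h1 h2; rewrite !ler_norml => /andP[? ?] /andP[? ?] /andP[? ?].
    by apply/andP; split; lra.
  move: hx; rewrite ler_norml /kap => /andP[_ hx].
  (* If [condp] exceeds x it exceeds the lower bound dlt^ell, and the additive error eta dlt^ell is
     at most eta times [condp]. *)
  have [le|lt] := leP (condp K k ell u z0) x; first nra.
  have : eta * dlt U ^+ ell <= eta * condp K k ell u z0.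
    by apply: ler_wpM2l; [exact: ltW|lra].
  lra.
pose kern := cp_ker K k (res (upto k) z).
pose cell u v : set (config_on (after k) * config_on (after k)) :=
  [set p | (obs S (ext p.1) == u) && (obs S (ext p.2) == v)].
have mc1 u : measurable [set p : config_on (after k) * config_on (after k) | obs S (ext p.1) == u].
  have := @measurable_fst _ _ (config_on (after k)) (config_on (after k)) measurableT _ (measurable_cellA k ell u).
  by rewrite setTI.
have mc2 u : measurable [set p : config_on (after k) * config_on (after k) | obs S (ext p.2) == u].
  have := @measurable_snd _ _ (config_on (after k)) (config_on (after k)) measurableT _ (measurable_cellA k ell u).
  by rewrite setTI.
have cellE u v : cell u v = [set p | obs S (ext p.1) == u] `&` [set p | obs S (ext p.2) == v].
  by apply/seteqP; split => p; rewrite /cell /=; [move=> /andP[]|case=> -> ->].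
have mcell u v : measurable (cell u v) by rewrite cellE; exact: measurableI.
have fink (A : set (config_on (after k) * config_on (after k))) : measurable A -> kern A \is a fin_num.
  move=> mA; rewrite ge0_fin_numE//; apply: (@le_lt_trans _ _ 1%E); last exact: ltry.
  rewrite -(@prob_kernel _ _ _ _ _ (cp_ker K k) (res (upto k) z)).
  by apply: le_measure; rewrite ?inE.
pose pi0 u v : R := fine (kern (cell u v)).
have pi0E u v : kern (cell u v) = (pi0 u v)%:E by rewrite /pi0 fineK// fink.
have obsb (p : config_on (after k)) : obs S (ext p) \in bits ell.
  by have := obs_bits S (ext p); rewrite size_sites.
have margL u : \sum_(v <- bits ell) pi0 u v = condp K k ell u (flip k z).
  apply/EFin_inj; rewrite -condp_fin -sumEFin.
  have := @cp_marg1 _ _ K k z _ zK (measurable_cellA k ell u); rewrite -/kern => <-.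
  rewrite (@measure_partition _ _ _ kern ell (fun p => obs S (ext p.2)) (fst @^-1` cellA k ell u)) //; last exact: mc1.
  by apply: eq_bigr => v _; rewrite -pi0E cellE.
have margR v : \sum_(u <- bits ell) pi0 u v = condp K k ell v z.
  apply/EFin_inj; rewrite -condp_fin -sumEFin.
  have := @cp_marg2 _ _ K k z _ zK (measurable_cellA k ell v); rewrite -/kern => <-.
  rewrite (@measure_partition _ _ _ kern ell (fun p => obs S (ext p.1)) (snd @^-1` cellA k ell v)) //; last exact: mc2.
  by apply: eq_bigr => u _; rewrite -pi0E cellE setIC.
have condS z0 : \sum_(u <- bits ell) condp K k ell u z0 = 1.
  apply/EFin_inj; rewrite -sumEFin.
  rewrite -(@prob_kernel _ _ _ _ _ (cp_cond K k) (res (upto k) z0)).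
  rewrite (@measure_partition _ _ _ (cp_cond K k (res (upto k) z0)) ell (fun y => obs S (ext y)))//.
    by apply: eq_bigr => u _; rewrite -condp_fin setTI.
  by move=> u; exact: measurable_cellA.
have dis i : (i < ell)%N -> \sum_(u <- bits ell) \sum_(v <- bits ell)
    pi0 u v * (nth false u i != nth false v i)%:R <= ThR i.+1.
  move=> il; rewrite -lee_fin -ThR_fin.
  pose DD' := [set p : config_on (after k) * config_on (after k) | nth false (obs S (ext p.1)) i != nth false (obs S (ext p.2)) i].
  have ak : after k (k + i.+1%:Z) by rewrite /after; clear; lia.
  pose pt : {x : int | after k x} := exist (fun x : int => is_true (after k x)) _ ak.
  have nthE (y : config_on (after k)) : nth false (obs S (ext y)) i = y pt.
    rewrite (nth_map 0) ?size_sites// /S (nth_map 0%N) ?size_iota// nth_iota// add0n.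
    rewrite (_ : k + 1 + i%:Z = k + i.+1%:Z); last by clear; lia.
    by rewrite /ext insubT.
  have DE : DD' = disagree k i.+1.
    apply/seteqP; split => p; rewrite /DD' /disagree /= !nthE.
      by move=> h; exists pt.
    by move=> [q qE]; have -> : q = pt by exact: val_inj.
  apply: (@le_trans _ _ (kern (disagree k i.+1))); last first.
    by apply: ereal_sup_ubound; exists k, z.
  rewrite -DE; have mDD : measurable DD'.
    have -> : DD' = ([set p | (p.1 : _ -> bool) pt == true] `&` [set p | (p.2 : _ -> bool) pt == false]) `|`
        ([set p | (p.1 : _ -> bool) pt == false] `&` [set p | (p.2 : _ -> bool) pt == true]).
      apply/seteqP; split => p; rewrite /DD' /= !nthE;
        case: (p.1 _); case: (p.2 _) => //=; by [left|right|case=> -[]].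
    have m1 b : measurable [set p : config_on (after k) * config_on (after k) | (p.1 : _ -> bool) pt == b].
      have := @measurable_fst _ _ (config_on (after k)) (config_on (after k)) measurableT _ (measurable_coord pt b).
      by rewrite setTI.
    have m2 b : measurable [set p : config_on (after k) * config_on (after k) | (p.2 : _ -> bool) pt == b].
      have := @measurable_snd _ _ (config_on (after k)) (config_on (after k)) measurableT _ (measurable_coord pt b).
      by rewrite setTI.
    by apply: measurableU; apply: measurableI.
  rewrite (@measure_partition _ _ _ kern ell (fun p => obs S (ext p.1)) DD')//.
  rewrite -sumEFin; apply: lee_sum => u _.
  rewrite (@measure_partition _ _ _ kern ell (fun p => obs S (ext p.2)))//; last exact: measurableI.
  rewrite -sumEFin; apply: lee_sum => v _.
  rewrite EFinM -pi0E; case: (boolP (nth false u i != nth false v i)) => h; last by rewrite mule0 measure_ge0.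
  rewrite mule1 (_ : cell u v = DD' `&` [set t | obs S (ext t.1) == u] `&` [set t | obs S (ext t.2) == v])//.
  apply/seteqP; split => p; rewrite /cell /DD' /=; first by move=> /andP[/eqP -> /eqP ->]; rewrite h !eqxx.
  by case=> -[_ ->] ->.
apply: (@coupled_adjust _ ell (fun u => condp K k ell u (flip k z)) (fun u => condp K k ell u z)
  _ _ (fun i => ThR i.+1) th eta pi0) => //.
- by move=> u v; exact: fine_ge0.
- by move=> i; exact: ThR_ge0.
- move=> u ub; apply: close => //; last exact: zf.
  by move=> x hx; rewrite flip_upd upd_neq ?zs ?upd_neq ?mem_sites//; move: hx; clear; lia.
- move=> u ub; apply: close => //; last exact: zc.
  by move=> x hx; rewrite zs ?upd_neq ?mem_sites//; move: hx; clear; lia.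
- exact: law_sum.
- exact: law_sum.
Qed.

End coupling_blocks.

Lemma summable_tail (R : realType) (a : nat -> R) (A e : R) :
  (forall i, 0 <= a i) -> (forall N, \sum_(i < N) a i <= A) -> 0 < e ->
  exists N1, forall N, \sum_(i < N) a (N1 + i)%N <= e.
Proof.
move=> a0 hA e0; pose S := [set x | exists N, x = \sum_(i < N) a i].
have hS : has_sup S.
  split; first by exists 0, 0%N; rewrite big_ord0.
  by exists A => _ [N ->].
have [_ [N1 ->] h] := sup_adherent e0 hS.
exists N1 => N; have : \sum_(i < N1 + N) a i <= sup S.
  by apply: sup_upper_bound => //; exists (N1 + N)%N.
by rewrite big_split_ord /=; lra.
Qed.

(** * Choice of the block, and the Poincare inequality for mu *)

Section part1.
Variables (R : realType) (U : {fset int} -> Omega -> R) (mu : probability Omega R).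
Hypotheses (U_int : interaction U) (U_diam : diam_summable U) (mu_gibbs : gibbs U mu).

Lemma bj_sum (th : nat -> R) ell m : (forall i, 0 <= th i) ->
  \sum_(j < m) bj U th ell j <= \sum_(i < ell.+1) th i * ee U (ell - i).
Proof.
move=> th0; rewrite /bj exchange_big /=; apply: ler_sum => i _.
rewrite -mulr_sumr; apply: ler_wpM2l => //.
have il := ltn_ord i.
have := sum_tt U_int U_diam (ell - i) m.
rewrite -{1}(add0n (ell - i)%N) (addnC (ell - i)%N m) big_addn addnK big_mkord => e.
have -> : \sum_(j < m) tt U (ell.+1 + j - i) = \sum_(j < m) tt U (j + (ell - i)).+1.
  by apply: eq_bigr => j _; congr tt; lia.
by rewrite e lerBlDr lerDl ee_ge0.
Qed.

(** The summand [eta] makes the profile positive, and its square pays for the loss in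
    [coupled_of_K]: (a + eta)^2 >= a^2 + eta^2 for a >= 0. *)
Definition profile (a : nat -> R) (eta : R) (i : nat) : R :=
  if i is i'.+1 then a i' + eta else 1.

(** The convolution of a summable sequence with one tending to 0 is small at large [ell]. The
    quarters of [phi0] go to the site left of the block, to the [eta] terms, to early sites, which
    are far from the end of the block, and to late sites, where the tail of [a] is small. *)
Lemma small_block (a : nat -> R) (A phi0 : R) :
  (forall i, 0 <= a i) -> (forall N, \sum_(i < N) a i <= A) -> 0 < phi0 ->
  exists ell, exists eta, [/\ 0 < eta, eta <= 1 &
    \sum_(i < ell.+1) profile a eta i * ee U (ell - i) <= phi0].
Proof.
move=> a0 hA p0; have A0 : 0 <= A by have := hA 0%N; rewrite big_ord0.
pose c := ee U 0 + 1; have c0 : 0 < c by have := ee_ge0 U 0; rewrite /c; lra.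
have eec n : ee U n <= c.
  by have := @ee_anti _ _ U_int U_diam 0 n isT; rewrite /c; lra.
pose e1 := phi0 / 4 / (A + 1).
have A1 : 0 < A + 1 by lra.
have e10 : 0 < e1 by rewrite !divr_gt0.
have [p hp] := ee_cvg U_int U_diam e10.
have e20 : 0 < phi0 / 4 / c by rewrite !divr_gt0.
have [N1 hN1] := summable_tail a0 hA e20.
pose ell := (N1 + p)%N; pose eta := Num.min 1 (phi0 / 4 / c / ell.+1%:R).
exists ell.+1, eta.
have eta0 : 0 < eta by rewrite /eta lt_min ltr01 !divr_gt0.
have eta1 : eta <= phi0 / 4 / c / ell.+1%:R by rewrite /eta ge_min lexx orbT.
split=> //; first by rewrite /eta ge_min lexx.
rewrite big_ord_recl /= mul1r subn0.
have s1 : ee U ell.+1 <= phi0 / 4.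
  apply: le_trans (hp _ _) _; first by rewrite /ell; lia.
  by rewrite /e1 ler_pdivrMr// ler_peMr//; lra.
have -> : \sum_(i < ell.+1) (a i + eta) * ee U (ell.+1 - bump 0 i) =
    \sum_(i < ell.+1) a i * ee U (ell - i) + \sum_(i < ell.+1) eta * ee U (ell - i).
  by rewrite -big_split; apply: eq_bigr => i _; rewrite /bump /= add1n subSS mulrDl.
have s2 : \sum_(i < ell.+1) eta * ee U (ell - i) <= phi0 / 4.
  apply: (@le_trans _ _ (\sum_(i < ell.+1) eta * c)).
    by apply: ler_sum => i _; rewrite ler_wpM2l// ltW.
  rewrite sumr_const card_ord -mulr_natr.
  have n0 : 0 < ell.+1%:R :> R by rewrite ltr0n.
  move: eta1; rewrite ler_pdivlMr// ler_pdivlMr//; nra.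
have s3 : \sum_(i < ell.+1) a i * ee U (ell - i) <= phi0 / 4 + phi0 / 4.
  have -> : ell.+1 = (N1 + p.+1)%N by rewrite /ell addnS.
  rewrite big_split_ord /=; apply: lerD.
    apply: (@le_trans _ _ (\sum_(i < N1) a i * e1)).
      by apply: ler_sum => i _; apply: ler_wpM2l => //; apply: hp; have := ltn_ord i; rewrite /ell; lia.
    rewrite -mulr_suml; apply: (@le_trans _ _ ((A + 1) * e1)).
      by apply: ler_wpM2r; [exact: ltW|have := hA N1; lra].
    by rewrite /e1 mulrC divfK// gt_eqF.
  apply: (@le_trans _ _ (\sum_(i < p.+1) a (N1 + i)%N * c)).
    by apply: ler_sum => i _; apply: ler_wpM2l.
  by rewrite -mulr_suml -ler_pdivlMr.
lra.
Qed.

(** On [0,1] a smaller exponent gives a larger power, and 2p <= 1. With p = 1/q this is where q > 2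
    enters. *)
Lemma theta_pow (t p : R) : 0 <= t -> t <= 1 -> 0 <= p -> p <= 1 / 2 -> t <= (t `^ p) ^+ 2.
Proof.
move=> t0 t1 p0 p1; have [->|tn0] := eqVneq t 0; first exact: sqr_ge0.
have tp : 0 < t by rewrite lt_neqAle eq_sym tn0.
rewrite expr2 -powRD; last by rewrite tn0 implybT.
by apply: ger1_powR; [rewrite tp t1|lra].
Qed.

Lemma theta_partial (K : coupling mu) (q : R) N : 0 < q -> (Theta_norm K q < +oo)%E ->
  \sum_(i < N) ThR K i.+1 `^ q^-1 <= fine (Theta_norm K q).
Proof.
move=> q0 fin.
have T0 j : (0 <= Theta K j `^ q^-1)%E by exact: poweR_ge0.
have n0 : (0 <= Theta_norm K q)%E by apply: nneseries_ge0 => *; exact: T0.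
rewrite -lee_fin fineK ?ge0_fin_numE// -sumEFin.
have := @nneseries_lim_ge _ (fun j => Theta K j `^ q^-1)%E xpredT 1 N.+1 (fun n _ _ => T0 n).
rewrite big_add1 /= big_mkord; apply: le_trans.
by apply: lee_sum => i _; rewrite (ThR_fin U_int U_diam mu_gibbs) poweR_EFin.
Qed.

Lemma gam_poincare (K : coupling mu) (q : R) : 2 < q -> (Theta_norm K q < +oo)%E ->
  exists2 C : R, 0 < C & forall a n F s,
    gam U (sites a n) (fun s => F s ^+ 2) s - gam U (sites a n) F s ^+ 2 <=
    C * \sum_(x <- sites a n) gam U (sites a n) (grad2 F x) s.
Proof.
move=> q2 fin; have q0 : 0 < q by lra.
pose a i := ThR K i.+1 `^ q^-1.
have a0 i : 0 <= a i by exact: powR_ge0.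
have E0 := ee_ge0 U 0; have d0 := dlt_gt0 U; have d1 := dlt_le1 U.
pose X := expR (ee U 0) ^+ 2 / dlt U.
have X0 : 0 < X by rewrite divr_gt0// exprn_gt0// expR_gt0.
(* Absorption requires 2 X phi0^2 <= 1/2, which follows from X phi0 <= 1/4 and phi0 <= 1. *)
pose phi0 := Num.min 1 (1 / 4 / X).
have p0 : 0 < phi0 by rewrite lt_min ltr01 divr_gt0// divr_gt0.
have [ell [eta [e0 e1 hs]]] := small_block a0 (fun N => theta_partial N q0 fin) p0.
have th0 i : 0 < profile a eta i by case: i => [|i] /=; [exact: ltr01|apply: ltr_wpDl].
have hK i : ThR K i.+1 + eta ^+ 2 <= profile a eta i.+1 ^+ 2.
  rewrite /= sqrrD; have t0 := ThR_ge0 U_int U_diam mu_gibbs K i.+1.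
  have t1 := ThR_le1 U_int U_diam mu_gibbs K i.+1.
  have qV : 0 <= q^-1 by rewrite invr_ge0 ltW.
  have qV2 : q^-1 <= 1 / 2 by rewrite div1r lef_pV2 ?posrE// ltW.
  have := theta_pow t0 t1 qV qV2; have := mulr_ge0 (a0 i) (ltW e0).
  rewrite -/(a i); lra.
have e20 : 0 < eta ^+ 2 by exact: exprn_gt0.
have e21 : eta ^+ 2 <= 1 by rewrite expr_le1// ltW.
have [M hM] := coupled_of_K U_int U_diam mu_gibbs ell e20 e21 hK.
apply: (fin_poincare U_int U_diam (ell := ell) (M := M) (th := profile a eta) (phi := phi0)) => //.
  by move=> m; apply: le_trans hs; apply: bj_sum => i; exact: ltW.
have -> : 2 * (expR (ee U 0) ^+ 2 * phi0 / dlt U) * phi0 = 2 * (X * phi0) * phi0 by rewrite /X; ring.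
have pX : X * phi0 <= 1 / 4.
  by rewrite mulrC -ler_pdivlMr// /phi0 ge_min lexx orbT.
have ph1 : phi0 <= 1 by rewrite /phi0 ge_min lexx.
by have := ler_pM (mulr_ge0 (ltW X0) (ltW p0)) (ltW p0) pX ph1; lra.
Qed.

Lemma variance_Ex (f : Omega -> R) : bm f ->
  'V_mu[f]%E = (Ex mu (fun s => (f s - Ex mu f) ^+ 2))%:E.
Proof.
move=> bf; rewrite /variance covariance.unlock expectation.unlock -(EFin_Ex mu bf) /=.
rewrite EFin_Ex; last by apply: bm_sqr; apply: bmB => //; exact: bm_cst.
by apply: eq_integral => s _; rewrite /= expr2.
Qed.

Lemma dirichlet_partial (f : Omega -> R) N : bm f ->
  ((\sum_(x <- box N) Ex mu (grad2 f x))%:E <= dirichlet mu f)%E.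
Proof.
move=> bf; rewrite -sumEFin; apply: esum_ge; exists [set` box N]; first by split => //; exact: finite_seq.
rewrite -fsbig_seq ?sites_uniq//; apply: lee_sum => x _.
by rewrite EFin_Ex//; exact: bm_grad2.
Qed.

Lemma poincare_part : forall q : R, 2 < q ->
  exists2 C : R, 0 < C &
    forall K : coupling mu, (Theta_norm K q < +oo)%E ->
    forall f : Omega -> R, measurable_fun setT f -> bounded_fun f ->
      ('V_mu[f] <= C%:E * (1 + Theta_norm K q ^+ 2) * dirichlet mu f)%E.
Proof.
move=> q q2; have q0 : 0 < q by lra.
(* The constant has to be chosen before the coupling. If no coupling has finite norm for this [q],
   the claim is vacuous. *)
have [[K0 fin0]|nK] := pselect (exists K : coupling mu, (Theta_norm K q < +oo)%E); last first.
  by exists 1 => // K fK; case: nK; exists K.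
have [C C0 hC] := gam_poincare q2 fin0; exists C => // K fin f mf bf.
have {}bf : bm f.
  split=> //; have [M [_ hM]] := bf; exists (M + 1) => x.
  by apply: (hM (M + 1)) => //; rewrite ltrDl.
have T0 : (0 <= Theta_norm K q)%E by apply: nneseries_ge0 => *; exact: poweR_ge0.
have -> : Theta_norm K q = (fine (Theta_norm K q))%:E by rewrite fineK ?ge0_fin_numE.
set T := fine _; have Y0 : 0 < C * (1 + T ^+ 2) by rewrite mulr_gt0// ltr_pwDl// sqr_ge0.
rewrite -EFin_expe -EFinD -EFinM variance_Ex//.
have D0 : (0 <= dirichlet mu f)%E.
  by apply: esum_ge0 => i _; apply: integral_ge0 => s _; rewrite lee_fin sqr_ge0.
have [Df|/negP] := boolP (dirichlet mu f < +oo)%E; last first.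
  rewrite ltey => /negP; rewrite negbK => /eqP ->.
  by rewrite gt0_muley ?lte_fin// leey.
have DE : dirichlet mu f = (fine (dirichlet mu f))%:E by rewrite fineK ?ge0_fin_numE.
rewrite DE -EFinM lee_fin.
apply: (@le_trans _ _ (C * fine (dirichlet mu f))).
  apply: (poincare_mu U_int U_diam mu_gibbs (ltW C0) hC bf) => N.
  by rewrite -lee_fin -DE; exact: dirichlet_partial.
rewrite ler_wpM2r//; first by rewrite -lee_fin -DE.
by apply: ler_peMr; [exact: ltW|rewrite lerDl sqr_ge0].
Qed.

End part1.

(** * The one-sided chain of conditional probabilities *)

Section bernoulli_chain.
Variables (R : realType) (g : int -> Omega -> R).

Definition bern b k s : R := if b then g k s else 1 - g k s.

(** The probability that spins drawn one after the other from [k] on, the next being [true] with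
    probability [g], spell the word [v]. *)
Fixpoint chain k (v : seq bool) s : R :=
  if v is b :: v' then bern b k s * chain (k + 1) v' (upd s k b) else 1.

End bernoulli_chain.

Section one_sided.
Variables (R : realType) (U : {fset int} -> Omega -> R).
Hypotheses (U_int : interaction U) (U_diam : diam_summable U).
Implicit Types (s : Omega) (b : bool).

(** The one-sided conditional probability, as a limit that exists at every configuration; hence the
    coupling built from it has no exceptional set. *)
Definition gg k s : R := limn (fun m => pp U k m s).
Local Notation gb := (bern gg).
Local Notation chain := (chain gg).

(** The probability in a larger volume is an average of those in the smaller volume over boundary
    conditions to its right, which by [mem_loss] differ by at most [e]. *)
Lemma pp_close (e : R) : 0 < e -> exists M : nat, forall k s s',
  (forall x, x < k -> s x = s' x) -> forall m m', (M <= m)%N -> (M <= m')%N ->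
  `|pp U k m s - pp U k m' s'| <= e.
Proof.
move=> e0; have [M hM] := mem_loss U_int U_diam false 1 e0; exists M.
pose F k (s : Omega) := ind R (s k).
have F01 k : unit_fun (F k) by move=> s; rewrite /F /ind; case: (s k); rewrite /= ?lexx ler01.
have iF k : inv_on (outer false k (k + 1%:Z)) (F k).
  by move=> s s' es; rewrite /F es// => -[|[]]//; lia.
have osc0 k m s s' : (M <= m)%N -> (forall x, x < k -> s x = s' x) ->
    `|pp U k m s - pp U k m s'| <= e.
  move=> Mm hs; have := hM k _ (F01 k) (iF k) m m Mm Mm s s'.
  rewrite /= subr0 add0n add1n; apply => x nx; apply: hs; rewrite ltNge; apply/negP => kx; apply: nx.
  have [hx|hx] := lerP (k + 1%:Z + m%:Z) x; first by left; left.
  by right; rewrite /sset /= mem_sites; lia.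
have main k s s' m d : (M <= m)%N -> (forall x, x < k -> s x = s' x) ->
    `|pp U k m s - pp U k (m + d) s'| <= e.
  move=> Mm hs; have dj : disj (sites (k + m.+1%:Z) d) (sites k m.+1).
    by move=> x; rewrite !mem_sites; lia.
  have E t : pp U k (m + d) t = gam U (sites k (m.+1 + d)) (pp U k m) t.
    rewrite /pp -addSn sites_cat -(gam_catC U_int (fun s => ind R (s k)) dj).
    by rewrite (gam_tower U_int _ dj) -(gam_catC U_int (gam U _ _) dj).
  have w c : gam U (sites k (m.+1 + d)) (fun=> c) s' = c.
    by rewrite /gam (wavg_id (bw_gt0 U _) s')//.
  have near t : eqoff (sset (sites k (m.+1 + d))) t s' -> `|pp U k m s - pp U k m t| <= e.
    move=> et; apply: osc0 => // x xk; rewrite hs//; symmetry; apply: et.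
    by rewrite /sset /= mem_sites; lia.
  have wp := bw_gt0 U (sites k (m.+1 + d)).
  have lb : pp U k m s - e <= pp U k (m + d) s'.
    rewrite E -[leLHS]w; apply: (wavg_le wp) => t /near.
    by rewrite ler_norml => /andP[]; lra.
  have ub : pp U k (m + d) s' <= pp U k m s + e.
    rewrite E -[leRHS]w; apply: (wavg_le wp) => t /near.
    by rewrite ler_norml => /andP[]; lra.
  by rewrite ler_norml; apply/andP; split; lra.
move=> k s s' hs m m' Mm Mm'; have [h|h] := leqP m m'.
  by rewrite -(subnKC h); exact: main.
by rewrite -(subnKC (ltnW h)) distrC; apply: main => // x /hs.
Qed.

Lemma gg_cvg k s : pp U k m s @[m --> \oo] --> gg k s.
Proof.
apply: cauchy_cvg; apply/cauchy_exP => e e0; have e20 : 0 < e / 2 by lra.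
have [M hM] := pp_close e20; exists (pp U k M s); exists M => // m /= hm.
rewrite -ball_normE /=.
have := hM k s s (fun=> fun=> erefl) M m (leqnn M) hm; lra.
Qed.

Lemma gg_close (e : R) : 0 < e -> exists M : nat, forall k s m, (M <= m)%N ->
  `|pp U k m s - gg k s| <= e.
Proof.
move=> e0; have [M hM] := pp_close e0; exists M => k s m hm.
have h : `|pp U k m s - pp U k n s| @[n --> \oo] --> `|pp U k m s - gg k s|.
  by apply: cvg_norm; apply: cvgB; [exact: cvg_cst|exact: gg_cvg].
rewrite -(cvg_lim _ h)//; apply: limr_le; first by apply/cvg_ex; eexists; exact: h.
by near=> n; apply: hM => //; near: n; exists M.
Unshelve. all: by end_near. Qed.

Lemma gb_ge b k s : dlt U <= gb b k s.
Proof.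
apply/ler_addgt0Pl => e e0; have [M /(_ k s M (leqnn M))] := gg_close e0.
have := pb_ge U_int b k M s; rewrite ler_norml /pb /bern.
by case: b => h /andP[h1 h2]; lra.
Qed.

Lemma gb_ge0 b k s : 0 <= gb b k s.
Proof. exact: le_trans (ltW (dlt_gt0 U)) (gb_ge b k s). Qed.

Lemma gg_inv k s s' : (forall x, x < k -> s x = s' x) -> gg k s = gg k s'.
Proof.
move=> hs; apply/eqP; rewrite -subr_eq0 -normr_le0; apply/ler_addgt0Pl => e e0.
rewrite addr0; have [M hM] := pp_close e0.
have h : `|pp U k m s - pp U k m s'| @[m --> \oo] --> `|gg k s - gg k s'|.
  by apply: cvg_norm; apply: cvgB; exact: gg_cvg.
rewrite -(cvg_lim _ h)//; apply: limr_le; first by apply/cvg_ex; eexists; exact: h.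
by near=> m; apply: hM => //; near: m; exists M.
Unshelve. all: by end_near. Qed.

(** As only the past matters, [s'] may be replaced by [t], which has the past of [s'] and the future
    of [s]. In each finite volume the change then lies more than [n] sites to the left, where
    [gam_lip] and [cle_half] give [ee U n]. *)
Lemma gg_lip k n s s' : (forall x, k - n%:Z <= x < k -> s x = s' x) ->
  `|gg k s - gg k s'| <= ee U n.
Proof.
move=> hs; pose t : Omega := fun x => if x < k then s' x else s x.
rewrite -(@gg_inv k t s'); last by move=> x xk; rewrite /t xk.
have h : `|pp U k m s - pp U k m t| @[m --> \oo] --> `|gg k s - gg k t|.
  by apply: cvg_norm; apply: cvgB; exact: gg_cvg.
rewrite -(cvg_lim _ h)//; apply: limr_le; first by apply/cvg_ex; eexists; exact: h.
near=> m; apply: (@gam_lip _ U U_int _ [set x | x < k - n%:Z]).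
- by move=> r; rewrite /ind; case: (r k); rewrite /= ?lexx ler01.
- by move=> r r' e; rewrite e//= ; lia.
- by apply: cle_sub (cle_half U_int U_diam k n) => // x; rewrite sset_sites /=; lia.
move=> x nx; rewrite /t; case: ifP => // xk; apply: hs; rewrite xk andbT leNgt.
by apply/negP => hx; apply: nx; left.
Unshelve. all: by end_near. Qed.

Lemma measurable_gg k : measurable_fun setT (gg k).
Proof.
apply: (@measurable_fun_cvg _ _ _ _ (fun m s => pp U k m s)) => [m|s _]; last exact: gg_cvg.
have : bm (pp U k m).
  apply: (@bm_gam_local _ U U_int U_diam _ [:: k]).
    by move=> r; rewrite /ind; case: (r k); rewrite /= ?lexx ler01.
  by move=> r r' e; rewrite e// => /(_ _); apply; rewrite /sset /= inE.
by case.
Qed.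

Lemma chain_ge0 k v s : 0 <= chain k v s.
Proof.
elim: v k s => [|b v IH] k s /=; first exact: ler01.
by apply: mulr_ge0; [exact: gb_ge0|exact: IH].
Qed.

Lemma chain_sum k n s : \sum_(v <- bits n) chain k v s = 1.
Proof.
elim: n k s => [|n IH] k s; first by rewrite /= big_seq1.
rewrite sum_bitsS /= -!mulr_sumr !IH; ring.
Qed.

Lemma law_cons k n m s b v : v \in bits n ->
  law U k n.+1 m s (b :: v) = pb U b k (n + m) s * law U (k + 1) n m (upd s k b) v.
Proof.
move=> vb; rewrite {1}/law addSn (G_step_b U_int).
have h c : gam U (sites (k + 1) (n + m)) (fun t => (obs (sites k n.+1) t == b :: v)%:R) (upd s k c) =
   (c == b)%:R * law U (k + 1) n m (upd s k c) v.
  rewrite /law -(wavgZ _ _ (c == b)%:R); apply: eq_wavg => t et; rewrite sitesS /= eqseq_cons -natrM mulnb; congr ((nat_of_bool ((_ == _) && _))%:R).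
  by rewrite et ?upd_eq// sset_sites; lia.
by rewrite !h {h}; case: b => /=; rewrite ?mul1r ?mul0r; ring.
Qed.

Lemma chain_le1 k v s : chain k v s <= 1.
Proof.
have vb := mem_bits v.
rewrite -(chain_sum k (size v) s) (bigD1_seq v) ?bits_uniq//= lerDl.
by apply: sumr_ge0 => w _; exact: chain_ge0.
Qed.

Lemma chain_close n (e : R) : 0 < e -> exists M : nat, forall k v s m,
  v \in bits n -> (M <= m)%N -> `|law U k n m s v - chain k v s| <= e.
Proof.
elim: n e => [|n IH] e e0.
  exists 0%N => k v s m; rewrite inE => /eqP -> _ /=.
  have := law_sum U_int k 0 m s; rewrite /= big_seq1 => ->.
  by rewrite subrr normr0 ltW.
have e20 : 0 < e / 2 by lra.
have [M1 h1] := IH _ e20; have [M2 h2] := gg_close e20.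
exists (M1 + M2)%N => k v s m; rewrite mem_bitsE; case: v => [//|b v].
rewrite /= eqSS -mem_bitsE => vb hm; rewrite law_cons//.
have {}h1 : `|law U (k + 1) n m (upd s k b) v - chain (k + 1) v (upd s k b)| <= e / 2.
  by apply: h1 => //; lia.
have {}h2 : `|pb U b k (n + m) s - gb b k s| <= e / 2.
  have hnm : (M2 <= n + m)%N by lia.
  have := h2 k s _ hnm; rewrite /pb /bern; case: b {h1} => //.
  by rewrite -normrN; congr (`|_| <= _); ring.
move: h1 h2 (chain_ge0 (k + 1) v (upd s k b)) (chain_le1 (k + 1) v (upd s k b)).
have p0 := pb_ge0 U b k (n + m) s; have p1 : pb U b k (n + m) s <= 1.
  by have /andP[] := pp_unit U k (n + m) s; rewrite /pb; case: b {p0}; lra.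
move: (law _ _ _ _ _ _) (chain _ _ _) p0 p1; move: (pb _ _ _ _ _) (gb _ _ _) => x y l c x0 x1.
rewrite !ler_norml => /andP[a1 a2] /andP[a3 a4] c0 c1.
have -> : x * l - y * c = x * (l - c) + c * (x - y) by ring.
by apply/andP; split; nra.
Qed.

Lemma measurable_chain k v : measurable_fun setT (chain k v).
Proof.
elim: v k => [|b v IH] k; first exact: measurable_cst.
apply: (@measurable_funM _ _ _ _ (gb b k) (fun s => chain (k + 1) v (upd s k b))).
  case: b; first exact: measurable_gg.
  by apply: measurable_funB; [exact: measurable_cst|exact: measurable_gg].
by apply: measurableT_comp; [exact: IH|exact: measurable_upd].
Qed.

Lemma bm_chain k v : bm (chain k v).
Proof.
split; first exact: measurable_chain.
by exists 1 => s; rewrite ger0_norm ?chain_le1 ?chain_ge0.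
Qed.

Lemma chain_inv k v s s' : (forall x, x < k -> s x = s' x) -> chain k v s = chain k v s'.
Proof.
elim: v k s s' => [|b v IH] k s s' hs; first exact: erefl.
rewrite /= /bern (gg_inv hs) (IH _ _ (upd s' k b))// => x xk.
by rewrite /upd; case: eqP => // /eqP ?; apply: hs; lia.
Qed.

End one_sided.

(** The identity holds by [dlr] with the law in volume n + m in place of the chain, for every [m],
    and these laws converge to the chain uniformly in the configuration. *)
Lemma chain_mu (R : realType) (U : {fset int} -> Omega -> R) (mu : probability Omega R) :
  interaction U -> diam_summable U -> gibbs U mu ->
  forall k v (A : set Omega), measurable A ->
  inv_on [set x | k <= x] (\1_A : Omega -> R) ->
  Ex mu (fun s => \1_A s * (obs (sites k (size v)) s == v)%:R) =
  Ex mu (fun s => \1_A s * chain (gg U) k v s).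
Proof.
move=> U_int U_diam mu_gibbs k v A mA iA; set n := size v.
have bA := bm_indic R mA; have bO := @bm_obs R (sites k n) v.
have bL m : bm (fun s => law U k n m s v).
  apply: (@bm_gam_local _ U U_int U_diam _ (sites k n)); first exact: obs_unit.
  move=> s s' e; congr ((nat_of_bool (_ == v))%:R); apply/eq_in_map => x xS.
  by apply: e; rewrite /sset /= xS.
have bC := bm_chain U_int U_diam k v.
have h m : Ex mu (fun s => \1_A s * (obs (sites k n) s == v)%:R) =
    Ex mu (fun s => \1_A s * law U k n m s v).
  rewrite (dlr U_int U_diam mu_gibbs (sites_uniq k (n + m)) (bmM bA bO)).
  congr Ex; apply/funext => z; rewrite [RHS]mulrC.
  rewrite -[RHS]wavgMr; last first.
    by move=> s s' e; apply: iA => x nx; apply: e; rewrite sset_sites; move: nx => /=; lia.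
  by congr wavg; apply/funext => t; rewrite mulrC.
apply/eqP; rewrite -subr_eq0 -normr_le0; apply/ler_addgt0Pl => e e0; rewrite addr0.
have [M hM] := chain_close U_int U_diam n e0; rewrite (h M).
apply: Ex_close; [exact: bmM|exact: bmM|move=> s].
rewrite -mulrBr normrM indicE; case: (s \in A) => /=; last by rewrite normr0 mul0r ltW.
by rewrite normr1 mul1r; apply: hM => //; exact: mem_bits.
Qed.

(** * Kernels defined by a random map *)

Section random_map_kernel.
Context d1 d2 d3 (T : measurableType d1) (S : measurableType d2) (Y : measurableType d3).
Variables (R : realType) (P : probability S R) (phi : T * S -> Y).

Definition random_map (mphi : measurable_fun setT phi) (t : T) (B : set Y) : \bar R :=
  P ((fun s => phi (t, s)) @^-1` B).

Hypothesis mphi : measurable_fun setT phi.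

Let mphi1 t : measurable_fun setT (fun s => phi (t, s)).
Proof. by apply: measurableT_comp mphi _; exact: measurable_pair1. Qed.

Let random_map0 t : random_map mphi t set0 = 0%E.
Proof. by rewrite /random_map preimage_set0 measure0. Qed.

Let random_map_ge0 t B : (0 <= random_map mphi t B)%E.
Proof. exact: measure_ge0. Qed.

Let random_map_sigma_additive t : semi_sigma_additive (random_map mphi t).
Proof.
have mpre (B : set Y) : measurable B -> measurable ((fun s => phi (t, s)) @^-1` B).
  by move=> mB; rewrite -[X in measurable X]setTI; exact: mphi1.
move=> F mF tF mUF; rewrite /random_map preimage_bigcup.
apply: measure_semi_sigma_additive => [n| |]; first exact: mpre.
- apply/trivIsetP => i j _ _ ij; rewrite -preimage_setI.
  by move/trivIsetP : tF => /(_ _ _ I I ij) ->; rewrite preimage_set0.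
- by rewrite -preimage_bigcup; exact: mpre.
Qed.

HB.instance Definition _ t := isMeasure.Build _ _ _ (random_map mphi t)
  (random_map0 t) (random_map_ge0 t) (@random_map_sigma_additive t).

Definition random_kernel : T -> {measure set Y -> \bar R} := random_map mphi.

Let measurable_random_kernel B : measurable B -> measurable_fun setT (random_kernel ^~ B).
Proof.
move=> mB; have mX : measurable (phi @^-1` B) by rewrite -[X in measurable X]setTI; exact: mphi.
have := measurable_fun_xsection P mX; congr measurable_fun; apply/funext => t.
by rewrite /= /random_map; congr (P _); apply/seteqP; split => s; rewrite /xsection /= inE.
Qed.

HB.instance Definition _ := isKernel.Build _ _ _ _ _ random_kernel measurable_random_kernel.

Let random_kernel_prob t : random_kernel t setT = 1%E.
Proof. by rewrite /= /random_map preimage_setT probability_setT. Qed.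

HB.instance Definition _ := Kernel_isProbability.Build _ _ _ _ _ random_kernel random_kernel_prob.

End random_map_kernel.

(** * The uniform distribution on [0,1) *)

Section uniform_unit.
Variable R : realType.

Definition unit_itv : set R := [set` `[(0 : R), 1[].

Lemma measurable_unit_itv : measurable unit_itv.
Proof. exact: measurable_itv. Qed.

Definition unif : set R -> \bar R := mrestr (@lebesgue_measure R) measurable_unit_itv.

Let unif0 : unif set0 = 0%E.
Proof. by rewrite /unif /mrestr set0I measure0. Qed.

Let unif_ge0 A : (0 <= unif A)%E.
Proof. exact: measure_ge0. Qed.

Let unif_sigma_additive : semi_sigma_additive unif.
Proof. exact: (@measure_semi_sigma_additive _ _ _ (mrestr lebesgue_measure measurable_unit_itv)). Qed.

HB.instance Definition _ := isMeasure.Build _ _ _ unif unif0 unif_ge0 unif_sigma_additive.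

Let unif_setT : unif setT = 1%E.
Proof. by rewrite /unif /mrestr setTI lebesgue_measure_itv /= lte_fin ltr01 oppr0 adde0. Qed.

HB.instance Definition _ := Measure_isProbability.Build _ _ _ unif unif_setT.

Lemma unif_itv (A : set R) (a b : R) : 0 <= a -> a <= b -> b <= 1 ->
  (forall u, 0 <= u < 1 -> A u <-> a <= u < b) -> unif A = (b - a)%:E.
Proof.
move=> a0 ab b1 hA; rewrite /unif /mrestr.
have -> : A `&` unit_itv = [set` `[a, b[].
  apply/seteqP; split => u; rewrite /unit_itv /= !in_itv /=.
    by case=> Au u01; have /hA := u01; case=> h _; exact: h.
  move=> /andP[au ub]; have u01 : 0 <= u < 1 by apply/andP; split; lra.
  by split => //; apply/hA => //; rewrite au.
rewrite lebesgue_measure_itv /= lte_fin; case: ltP => // ba.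
by have -> : b - a = 0 by lra.
Qed.

End uniform_unit.

(** * Optimal coupling of two spins *)

Section monotone_coupling.
Variable R : realType.
Implicit Types (u : R) (a b : bool).

(* With u uniform on [0,1), u < p1 and u < p2 are Bernoulli variables coupled
   optimally; they take the values a and b exactly on [jlo, jlo + jw). *)
Definition jlo (p1 p2 : R) a b : R :=
  match a, b with
  | true, true => 0 | true, false => p2 | false, true => p1
  | false, false => Num.max p1 p2
  end.
Definition jhi (p1 p2 : R) a b : R :=
  match a, b with
  | true, true => Num.min p1 p2 | true, false => p1 | false, true => p2
  | false, false => 1
  end.
(** At least one of the two mixed intervals is empty; when its end points come in the wrong order,
    the width is cut off at 0. *)
Definition jw (p1 p2 : R) a b : R := Num.max 0 (jhi p1 p2 a b - jlo p1 p2 a b).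

Lemma jw_ge0 (p1 p2 : R) a b : 0 <= jw p1 p2 a b.
Proof. by rewrite /jw le_max lexx. Qed.

Lemma jwE (p1 p2 : R) a b : 0 <= p1 <= 1 -> 0 <= p2 <= 1 ->
  jw p1 p2 a b = match a, b with
    | true, true => if p1 <= p2 then p1 else p2
    | true, false => if p1 <= p2 then 0 else p1 - p2
    | false, true => if p1 <= p2 then p2 - p1 else 0
    | false, false => if p1 <= p2 then 1 - p2 else 1 - p1
    end.
Proof.
move=> /andP[? ?] /andP[? ?]; rewrite /jw /jhi /jlo.
by case: a; case: b; case: (leP p1 p2) => ?; case: (leP 0 _) => ?; lra.
Qed.

Lemma jlo_bnd (p1 p2 : R) a b : 0 <= p1 <= 1 -> 0 <= p2 <= 1 ->
  0 <= jlo p1 p2 a b /\ jlo p1 p2 a b + jw p1 p2 a b <= 1.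
Proof.
move=> h1 h2; rewrite jwE//; move: h1 h2 => /andP[? ?] /andP[? ?]; rewrite /jlo.
by case: a; case: b; case: (leP p1 p2) => ?; split; lra.
Qed.

Lemma jw_sum1 (p1 p2 : R) a : 0 <= p1 <= 1 -> 0 <= p2 <= 1 ->
  jw p1 p2 a true + jw p1 p2 a false = if a then p1 else 1 - p1.
Proof. by move=> h1 h2; rewrite !jwE//; case: a; case: (leP p1 p2) => ?; lra. Qed.

Lemma jw_sum2 (p1 p2 : R) b : 0 <= p1 <= 1 -> 0 <= p2 <= 1 ->
  jw p1 p2 true b + jw p1 p2 false b = if b then p2 else 1 - p2.
Proof. by move=> h1 h2; rewrite !jwE//; case: b; case: (leP p1 p2) => ?; lra. Qed.

Lemma jw_diff (p1 p2 : R) : 0 <= p1 <= 1 -> 0 <= p2 <= 1 ->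
  jw p1 p2 true false + jw p1 p2 false true = `|p1 - p2|.
Proof.
move=> h1 h2; rewrite !jwE//; case: (leP p1 p2) => h.
  by rewrite ler0_norm ?subr_le0//; lra.
by rewrite gtr0_norm ?subr_gt0//; lra.
Qed.

Lemma jwP01 (p1 p2 : R) u a b : 0 <= p1 <= 1 -> 0 <= p2 <= 1 -> 0 <= u < 1 ->
  ((u < p1) == a) && ((u < p2) == b) =
  (jlo p1 p2 a b <= u < jlo p1 p2 a b + jw p1 p2 a b).
Proof.
move=> h1 h2 /andP[u0 u1]; rewrite jwE// /jlo.
move: h1 h2 => /andP[? ?] /andP[? ?].
case: (leP p1 p2) => h; case: (ltP u p1) => h1; case: (ltP u p2) => h2; case: a; case: b => /=;
  apply/esym/idP; first [by apply/andP; split; lra | by move=> /andP[? ?]; lra].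
Qed.

Lemma jwP (p1 p2 L W : R) u a b : 0 <= p1 <= 1 -> 0 <= p2 <= 1 ->
  0 <= W -> L <= u < L + W ->
  ((u < L + W * p1) == a) && ((u < L + W * p2) == b) =
  (L + W * jlo p1 p2 a b <= u < L + W * (jlo p1 p2 a b + jw p1 p2 a b)).
Proof.
move=> h1 h2 W0 /andP[Lu uL]; have Wp : 0 < W by lra.
have v01 : 0 <= (u - L) / W < 1 by rewrite divr_ge0 ?ltr_pdivrMr//=; lra.
have -> : u = L + W * ((u - L) / W) by field; rewrite gt_eqF.
by rewrite !ltrD2l !ltr_pM2l// lerD2l ler_pM2l// jwP01.
Qed.

End monotone_coupling.

(** * Two chains driven by one uniform variable *)

Section joint_chain.
Variables (R : realType) (g : int -> Omega -> R).
Hypothesis g01 : forall k s, 0 <= g k s <= 1.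

Local Notation state := (Omega * Omega * (R * R))%type.

(* u is known to lie in [L, L + W); the new spins a and b split this interval *)
Definition jstep k (u : R) (st : state) : state :=
  let: (s1, s2, (L, W)) := st in
  let p1 := g k s1 in let p2 := g k s2 in
  let a := u < L + W * p1 in let b := u < L + W * p2 in
  (upd s1 k a, upd s2 k b, (L + W * jlo p1 p2 a b, W * jw p1 p2 a b)).

Fixpoint jrun k n u (st : state) : state :=
  if n is n'.+1 then jrun (k + 1) n' u (jstep k u st) else st.

(** A site x >= k is set at step x - k and not touched again, so x - k + 1 steps determine it; sites
    left of [k] keep their initial values however long the run. *)
Definition path1 k (w : state * R) : Omega :=
  fun x => (jrun k (absz (x - k)%R).+1 w.2 w.1).1.1 x.
Definition path2 k (w : state * R) : Omega :=
  fun x => (jrun k (absz (x - k)%R).+1 w.2 w.1).1.2 x.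

Fixpoint jchain k (A B : seq bool) (s1 s2 : Omega) : R :=
  match A, B with
  | a :: A', b :: B' => jw (g k s1) (g k s2) a b *
                        jchain (k + 1) A' B' (upd s1 k a) (upd s2 k b)
  | _, _ => 1
  end.

Lemma jchain_ge0 k A B s1 s2 : 0 <= jchain k A B s1 s2.
Proof.
elim: A B k s1 s2 => [|a A IH] [|b B] k s1 s2 /=; rewrite ?ler01//.
by apply: mulr_ge0; [exact: jw_ge0|exact: IH].
Qed.

Lemma jchain_marg1 k A s1 s2 :
  \sum_(B <- bits (size A)) jchain k A B s1 s2 = chain g k A s1.
Proof.
elim: A k s1 s2 => [|a A IH] k s1 s2; first by rewrite /= big_seq1.
rewrite [size _]/= sum_bitsS /= -!mulr_sumr !IH -mulrDl.
by rewrite (jw_sum1 a (g01 k s1) (g01 k s2)).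
Qed.

Lemma jchain_marg2 k B s1 s2 :
  \sum_(A <- bits (size B)) jchain k A B s1 s2 = chain g k B s2.
Proof.
elim: B k s1 s2 => [|b B IH] k s1 s2; first by rewrite /= big_seq1.
rewrite [size _]/= sum_bitsS /= -!mulr_sumr !IH -mulrDl.
by rewrite (jw_sum2 b (g01 k s1) (g01 k s2)).
Qed.

Lemma path1_step k n u st : obs (sites (k + 1) n) (path1 k (st, u)) =
  obs (sites (k + 1) n) (path1 (k + 1) (jstep k u st, u)).
Proof.
apply/eq_in_map => x; rewrite mem_sites => hx; rewrite /path1 /=.
by have -> : absz (x - k)%R = (absz (x - (k + 1))%R).+1 by lia.
Qed.

Lemma path2_step k n u st : obs (sites (k + 1) n) (path2 k (st, u)) =
  obs (sites (k + 1) n) (path2 (k + 1) (jstep k u st, u)).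
Proof.
apply/eq_in_map => x; rewrite mem_sites => hx; rewrite /path2 /=.
by have -> : absz (x - k)%R = (absz (x - (k + 1))%R).+1 by lia.
Qed.

Lemma path1_head k u st : path1 k (st, u) k = (jstep k u st).1.1 k.
Proof. by rewrite /path1 subrr. Qed.

Lemma path2_head k u st : path2 k (st, u) k = (jstep k u st).1.2 k.
Proof. by rewrite /path2 subrr. Qed.

Lemma jcell k A B s1 s2 : size A = size B -> exists c, [/\ 0 <= c,
  c + jchain k A B s1 s2 <= 1 & forall L W u, 0 <= W -> L <= u < L + W ->
  (obs (sites k (size A)) (path1 k ((s1, s2, (L, W)), u)) == A) &&
  (obs (sites k (size A)) (path2 k ((s1, s2, (L, W)), u)) == B) =
  (L + W * c <= u < L + W * (c + jchain k A B s1 s2))].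
Proof.
elim: A B k s1 s2 => [|a A IH] [|b B] k s1 s2 //.
  by move=> _; exists 0; rewrite /=; split=> [||L W u W0 h]; rewrite ?add0r// mulr0 addr0 mulr1 h.
move=> [/IH]; set p1 := g k s1; set p2 := g k s2.
move=> /(_ (k + 1) (upd s1 k a) (upd s2 k b))[c []]; set P := jchain _ _ _ _ _ => c0 c1 hc.
have [l0 l1] := jlo_bnd a b (g01 k s1) (g01 k s2).
have w0 := jw_ge0 p1 p2 a b; have P0 : 0 <= P by exact: jchain_ge0.
exists (jlo p1 p2 a b + jw p1 p2 a b * c); split.
- by rewrite addr_ge0// mulr_ge0.
- rewrite -addrA -mulrDr; apply: le_trans l1; rewrite lerD2l.
  by rewrite ler_piMr.
move=> L W u W0 hu; have -> : size (a :: A) = (size A).+1 by [].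
rewrite sitesS [obs _ (path1 _ _)]/= [obs _ (path2 _ _)]/= !eqseq_cons.
have e1 : path1 k (s1, s2, (L, W), u) k = (u < L + W * p1).
  rewrite path1_head; exact: upd_eq.
have e2 : path2 k (s1, s2, (L, W), u) k = (u < L + W * p2).
  rewrite path2_head; exact: upd_eq.
have e3 := path1_step k (size A) u (s1, s2, (L, W)).
have e4 := path2_step k (size A) u (s1, s2, (L, W)).
move: (path1 k _) (path2 k _) e1 e2 e3 e4 => X1 X2 -> -> -> ->; rewrite andbACA.
have -> : jchain k (a :: A) (b :: B) s1 s2 = jw p1 p2 a b * P by [].
have := jwP a b (g01 k s1) (g01 k s2) W0 hu; rewrite -/p1 -/p2.
set lo := jlo p1 p2 a b; set w := jw p1 p2 a b.
have EL y : L + W * (lo + w * y) = L + W * lo + W * w * y by ring.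
rewrite -addrA -mulrDr !EL.
have Ww : 0 <= W * w by rewrite mulr_ge0.
set T := (L + W * lo <= u < L + W * (lo + w)); case: (boolP T) => [h e|].
  have /andP[/eqP ea /eqP eb] := e; rewrite e andTb.
  have -> : jstep k u (s1, s2, (L, W)) = (upd s1 k a, upd s2 k b, (L + W * lo, W * w)).
    by rewrite /jstep -/p1 -/p2 ea eb.
  by apply: hc; rewrite // -addrA -mulrDr.
move=> nh ->; apply/esym/negbTE; apply: contraNN nh => /andP[h1 h2].
have c2 : W * w * (c + P) <= W * w by rewrite ler_piMr.
have c3 : 0 <= W * w * c by rewrite mulr_ge0.
by rewrite /T mulrDr; apply/andP; split; lra.
Qed.

Hypothesis mg : forall k, measurable_fun setT (g k).

Lemma measurable_upd_fun d (T : measurableType d) (h : T -> Omega) (b : T -> bool) k :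
  measurable_fun setT h -> measurable_fun setT b ->
  measurable_fun setT (fun t => upd (h t) k (b t) : Omega).
Proof.
move=> mh mb; apply: config_measurable => x; rewrite /upd; case: (x == k).
  by have := mb measurableT [set true] I; rewrite setTI; congr measurable; apply/seteqP; split.
by have := mh measurableT _ (measurable_spin x); rewrite setTI.
Qed.

Lemma measurable_jstep k : measurable_fun setT (fun w : state * R => jstep k w.2 w.1).
Proof.
pose p1 (w : state * R) := g k w.1.1.1; pose p2 (w : state * R) := g k w.1.1.2.
pose a (w : state * R) := w.2 < w.1.2.1 + w.1.2.2 * p1 w.
pose b (w : state * R) := w.2 < w.1.2.1 + w.1.2.2 * p2 w.
rewrite (_ : (fun w => _) = fun w : state * R =>
  (upd w.1.1.1 k (a w), upd w.1.1.2 k (b w), (w.1.2.1 + w.1.2.2 * jlo (p1 w) (p2 w) (a w) (b w),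
     w.1.2.2 * jw (p1 w) (p2 w) (a w) (b w)))); last first.
  by apply/funext => -[[[s1 s2] [L W]] u].
have m1 : measurable_fun setT (fun w : state * R => w.1.1.1).
  by apply: measurableT_comp; [exact: measurable_fst|apply: measurableT_comp].
have m2 : measurable_fun setT (fun w : state * R => w.1.1.2).
  by apply: measurableT_comp; [exact: measurable_snd|apply: measurableT_comp].
have mL : measurable_fun setT (fun w : state * R => w.1.2.1).
  by apply: measurableT_comp; [exact: measurable_fst|apply: measurableT_comp].
have mW : measurable_fun setT (fun w : state * R => w.1.2.2).
  by apply: measurableT_comp; [exact: measurable_snd|apply: measurableT_comp].
have mp1 : measurable_fun setT p1 by apply: measurableT_comp m1; exact: mg.
have mp2 : measurable_fun setT p2 by apply: measurableT_comp m2; exact: mg.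
have ma : measurable_fun setT a.
  by apply: measurable_fun_ltr; [exact: measurable_snd|apply: measurable_funD => //; exact: measurable_funM].
have mb : measurable_fun setT b.
  by apply: measurable_fun_ltr; [exact: measurable_snd|apply: measurable_funD => //; exact: measurable_funM].
have mlo : measurable_fun setT (fun w => jlo (p1 w) (p2 w) (a w) (b w)).
  apply: (measurable_fun_ifT ma).
    by apply: (measurable_fun_ifT mb) => //; exact: measurable_cst.
  by apply: (measurable_fun_ifT mb) => //; exact: measurable_maxr.
have mhi : measurable_fun setT (fun w => jhi (p1 w) (p2 w) (a w) (b w)).
  apply: (measurable_fun_ifT ma).
    by apply: (measurable_fun_ifT mb) => //; exact: measurable_minr.
  by apply: (measurable_fun_ifT mb) => //; exact: measurable_cst.
apply: measurable_fun_pair; apply: measurable_fun_pair.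
- exact: measurable_upd_fun.
- exact: measurable_upd_fun.
- by apply: measurable_funD => //; exact: measurable_funM.
- apply: measurable_funM => //; apply: measurable_maxr; first exact: measurable_cst.
  exact: measurable_funB.
Qed.

Lemma measurable_jrun k n : measurable_fun setT (fun w : state * R => jrun k n w.2 w.1).
Proof.
elim: n k => [|n IH] k; first exact: measurable_fst.
apply: (@measurableT_comp _ _ _ _ _ _ (fun w : state * R => jrun (k + 1) n w.2 w.1)
  _ (fun w => (jstep k w.2 w.1, w.2))) => //.
by apply: measurable_fun_pair; [exact: measurable_jstep|exact: measurable_snd].
Qed.

Lemma measurable_path1 k : measurable_fun setT (path1 k).
Proof.
apply: config_measurable => x.
have m : measurable_fun setT (fun w : state * R => (jrun k (absz (x - k)%R).+1 w.2 w.1).1.1).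
  by apply: measurableT_comp; [exact: measurable_fst|apply: measurableT_comp => //; exact: measurable_jrun].
by have := m measurableT _ (measurable_spin x); rewrite setTI.
Qed.

Lemma measurable_path2 k : measurable_fun setT (path2 k).
Proof.
apply: config_measurable => x.
have m : measurable_fun setT (fun w : state * R => (jrun k (absz (x - k)%R).+1 w.2 w.1).1.2).
  by apply: measurableT_comp; [exact: measurable_snd|apply: measurableT_comp => //; exact: measurable_jrun].
by have := m measurableT _ (measurable_spin x); rewrite setTI.
Qed.

Definition start (s1 s2 : Omega) : state := (s1, s2, (0, 1)).

Lemma unif_jcell k A B s1 s2 : size A = size B ->
  @unif R [set u | obs (sites k (size A)) (path1 k (start s1 s2, u)) == A /\
                  obs (sites k (size A)) (path2 k (start s1 s2, u)) == B] =
  (jchain k A B s1 s2)%:E.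
Proof.
move=> /jcell => /(_ k s1 s2)[c [c0 c1 hc]]; have P0 := jchain_ge0 k A B s1 s2.
rewrite (@unif_itv _ _ c (c + jchain k A B s1 s2))//; [|by rewrite lerDl|].
  by congr (_%:E); ring.
move=> u u01; have := hc 0 1 u ler01; rewrite !add0r !mul1r => /(_ u01) <-.
by split=> [[-> ->]|/andP[]].
Qed.

End joint_chain.

(** * The two sides of a conditional distribution as measures *)

Section disintegration.
Context d1 d2 d3 (W : measurableType d1) (S : measurableType d2) (Z : measurableType d3).
Variables (R : realType) (P : probability W R) (A : set W).

(** For a fixed past event [A], the two sides of [cond_distr] become measures in [B], and their
    equality need only be tested on cells. The measurability proofs are arguments so that the
    measure structures can be inferred. *)
Definition slice (X : W -> Z) (mX : measurable_fun setT X) (mA : measurable A)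
  (B : set Z) : \bar R := P (A `&` X @^-1` B).

Definition mixture (k : R.-pker S ~> Z) (Y : W -> S) (mY : measurable_fun setT Y)
  (mA : measurable A) (B : set Z) : \bar R := (\int[P]_(w in A) k (Y w) B)%E.

Section slice_measure.
Variables (X : W -> Z) (mX : measurable_fun setT X) (mA : measurable A).

Let mpre B : measurable B -> measurable (A `&` X @^-1` B).
Proof. by move=> mB; apply: measurableI => //; have := mX measurableT mB; rewrite setTI. Qed.

Let slice0 : slice mX mA set0 = 0%E.
Proof. by rewrite /slice preimage_set0 setI0 measure0. Qed.

Let slice_ge0 B : (0 <= slice mX mA B)%E.
Proof. exact: measure_ge0. Qed.

Let slice_sigma_additive : semi_sigma_additive (slice mX mA).
Proof.
move=> F mF tF mUF; rewrite /slice preimage_bigcup setI_bigcupr.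
apply: measure_semi_sigma_additive => [n| |]; first exact: mpre.
- apply/trivIsetP => i j _ _ ij; rewrite setIACA -[X @^-1` F i `&` _]preimage_setI.
  by move/trivIsetP : tF => /(_ _ _ I I ij) ->; rewrite preimage_set0 setI0.
- by rewrite -setI_bigcupr -preimage_bigcup; exact: mpre.
Qed.

HB.instance Definition _ := isMeasure.Build _ _ _ (slice mX mA)
  slice0 slice_ge0 slice_sigma_additive.

End slice_measure.

Section mixture_measure.
Variables (k : R.-pker S ~> Z) (Y : W -> S) (mY : measurable_fun setT Y) (mA : measurable A).

Let mixture0 : mixture k mY mA set0 = 0%E.
Proof. by rewrite /mixture (eq_integral (cst 0%E)) ?integral0// => y _; rewrite measure0. Qed.

Let mixture_ge0 B : (0 <= mixture k mY mA B)%E.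
Proof. exact: integral_ge0. Qed.

Let mixture_sigma_additive : semi_sigma_additive (mixture k mY mA).
Proof.
move=> F mF tF mUF; rewrite [X in _ --> X](_ : _ =
  \int[P]_(w in A) (\sum_(n <oo) k (Y w) (F n)))%E; last first.
  apply: eq_integral => w _.
  by apply/esym/cvg_lim => //; exact/measure_semi_sigma_additive.
apply/cvg_closeP; split.
  by apply: is_cvg_nneseries => n _ _; exact: integral_ge0.
rewrite closeE// integral_nneseries// => n.
apply: measurable_funTS.
exact: measurableT_comp (measurable_kernel k _ (mF n)) mY.
Qed.

HB.instance Definition _ := isMeasure.Build _ _ _ (mixture k mY mA)
  mixture0 mixture_ge0 mixture_sigma_additive.

End mixture_measure.

End disintegration.

(** * The coupling built from a chain *)

Section chain_coupling.
Variables (R : realType) (g : int -> Omega -> R).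
Hypothesis g01 : forall k s, 0 <= g k s <= 1.
Hypothesis mg : forall k, measurable_fun setT (g k).
Implicit Types (i k : int).

Lemma measurable_path_from k s1 s2 :
  measurable_fun setT (fun u : R => path1 g k (start R s1 s2, u)) /\
  measurable_fun setT (fun u : R => path2 g k (start R s1 s2, u)).
Proof.
have m := @measurable_pair1 _ _ (Omega * Omega * (R * R))%type R (start R s1 s2).
split; first exact: measurableT_comp (measurable_path1 mg k) m.
exact: measurableT_comp (measurable_path2 mg k) m.
Qed.

Lemma measurable_obs_comp d (T : measurableType d) (h : T -> Omega) l v :
  measurable_fun setT h -> measurable [set t | obs l (h t) == v].
Proof. by move=> mh; have := mh measurableT _ (measurable_obs l v); rewrite setTI. Qed.

Lemma obs_sites_bits k n s : obs (sites k n) s \in bits n.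
Proof. by have := obs_bits (sites k n) s; rewrite size_sites. Qed.

Lemma unif_cell1 k A s1 s2 :
  unif [set u : R | obs (sites k (size A)) (path1 g k (start R s1 s2, u)) == A] =
  (chain g k A s1)%:E.
Proof.
have [m1 m2] := measurable_path_from k s1 s2.
rewrite (@measure_partition _ _ _ (@unif R) (size A)
  (fun u => obs (sites k (size A)) (path2 g k (start R s1 s2, u)))).
- rewrite -(jchain_marg1 g01 k A s1 s2) -sumEFin big_seq [RHS]big_seq.
  apply: eq_bigr => B; rewrite mem_bitsE => /eqP sB; rewrite -(unif_jcell g01)//.
- by move=> u; exact: obs_sites_bits.
- by move=> v; exact: measurable_obs_comp.
- exact: measurable_obs_comp.
Qed.

Lemma unif_cell2 k B s1 s2 :
  unif [set u : R | obs (sites k (size B)) (path2 g k (start R s1 s2, u)) == B] =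
  (chain g k B s2)%:E.
Proof.
have [m1 m2] := measurable_path_from k s1 s2.
rewrite (@measure_partition _ _ _ (@unif R) (size B)
  (fun u => obs (sites k (size B)) (path1 g k (start R s1 s2, u)))).
- rewrite -(jchain_marg2 g01 k B s1 s2) -sumEFin big_seq [RHS]big_seq.
  apply: eq_bigr => A; rewrite mem_bitsE => /eqP sA.
  rewrite -(unif_jcell g01)// sA; congr (unif _).
  by apply/seteqP; split => u /= [].
- by move=> u; exact: obs_sites_bits.
- by move=> v; exact: measurable_obs_comp.
- exact: measurable_obs_comp.
Qed.

(** The flipped past comes first, in the order of [cp_marg1] and [cp_marg2]. *)
Definition init i (w : config_on (upto i) * R) : Omega * Omega * (R * R) * R :=
  (start R (flip i (ext w.1)) (ext w.1), w.2).

Lemma measurable_init i : measurable_fun setT (@init i).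
Proof.
have me : measurable_fun setT (fun w : config_on (upto i) * R => ext w.1).
  by apply: measurableT_comp; [exact: measurable_ext|exact: measurable_fst].
apply: measurable_fun_pair; last exact: measurable_snd.
apply: measurable_fun_pair; last exact: measurable_cst.
apply: measurable_fun_pair => //.
by apply: measurableT_comp me; exact: measurable_flip.
Qed.

Definition out1 i (w : config_on (upto i) * R) : config_on (after i) :=
  res (after i) (path1 g (i + 1) (init w)).
Definition out2 i (w : config_on (upto i) * R) : config_on (after i) :=
  res (after i) (path2 g (i + 1) (init w)).
Definition outs i w := (@out1 i w, @out2 i w).

Lemma measurable_out1 i : measurable_fun setT (@out1 i).
Proof.
apply: measurableT_comp; first exact: measurable_res.
by apply: measurableT_comp (measurable_path1 mg _) _; exact: measurable_init.
Qed.

Lemma measurable_out2 i : measurable_fun setT (@out2 i).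
Proof.
apply: measurableT_comp; first exact: measurable_res.
by apply: measurableT_comp (measurable_path2 mg _) _; exact: measurable_init.
Qed.

Lemma measurable_outs i : measurable_fun setT (@outs i).
Proof. by apply: measurable_fun_pair; [exact: measurable_out1|exact: measurable_out2]. Qed.

Definition joint i : R.-pker config_on (upto i) ~> (config_on (after i) * config_on (after i))%type :=
  random_kernel (@unif R) (@measurable_outs i).
Definition marg1 i : R.-pker config_on (upto i) ~> config_on (after i) :=
  random_kernel (@unif R) (@measurable_out1 i).
Definition marg2 i : R.-pker config_on (upto i) ~> config_on (after i) :=
  random_kernel (@unif R) (@measurable_out2 i).

Definition cell i (v : seq bool) : set (config_on (after i)) :=
  [set y | obs (sites (i + 1) (size v)) (ext y) == v].
Arguments cell : clear implicits.

Lemma obs_after i n s : obs (sites (i + 1) n) (ext (res (after i) s)) = obs (sites (i + 1) n) s.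
Proof.
by apply/eq_in_map => x; rewrite mem_sites => hx; rewrite ext_res// /after; lia.
Qed.

Lemma marg1_cell i y v : marg1 i y (cell i v) = (chain g (i + 1) v (flip i (ext y)))%:E.
Proof.
rewrite -(unif_cell1 _ _ _ (ext y)); congr (unif _); apply/seteqP; split => u;
by rewrite /cell /= obs_after.
Qed.

Lemma marg2_cell i y v : marg2 i y (cell i v) = (chain g (i + 1) v (ext y))%:E.
Proof.
rewrite -(unif_cell2 _ _ (flip i (ext y))); congr (unif _); apply/seteqP; split => u;
by rewrite /cell /= obs_after.
Qed.

(** Once [n] is so large that the cylinder constrains only the first [n] sites after [i], a pattern
    on these sites decides membership in it. *)
Lemma cell_cyl i (l : seq ({x : int | after i x} * bool)) : exists n, forall v, v \in bits n ->
  cyl l `&` cell i v = cell i v \/ cyl l `&` cell i v = set0.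
Proof.
have [n hn] : exists n : nat, forall p, p \in l -> val p.1 <= i + n%:Z.
  elim: l => [|p l [n hn]]; first by exists 0%N.
  exists (n + absz (val p.1 - i)%R)%N => q; rewrite inE => /orP[/eqP ->|/hn].
    by move: (val p.1) => x; lia.
  by move: (val p.1) (val q.1) => x y; lia.
exists n => v; rewrite mem_bitsE => /eqP sv.
pose s := asg (sites (i + 1) n) v (fun=> false).
have E y p : cell i v y -> p \in l -> (y : _ -> bool) p.1 = s (val p.1).
  move=> /eqP yv pl; rewrite -(res_ext y) /res.
  have pS : val p.1 \in sites (i + 1) n.
    by have := hn _ pl; have := valP p.1; rewrite mem_sites /after; lia.
  have /eq_in_map : obs (sites (i + 1) n) (ext y) = obs (sites (i + 1) n) s.
    by rewrite -sv yv /s -sv obs_asg ?sites_uniq ?size_sites.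
  exact.
case: (boolP (all (fun p => s (val p.1) == p.2) l)) => h; [left|right].
  apply/seteqP; split => [y []//|y cy]; split=> //; apply/allP => p pl.
  by rewrite (E _ _ cy pl); exact: (allP h).
apply/seteqP; split => // y [yl cy]; move/negP: h; apply; apply/allP => p pl.
by rewrite -(E _ _ cy pl); exact: (allP yl).
Qed.

Lemma cell_measure_unique i (m1 m2 : {measure set (config_on (after i)) -> \bar R}) :
  (m1 setT < +oo)%E -> (forall v, m1 (cell i v) = m2 (cell i v)) ->
  forall A, measurable A -> m1 A = m2 A.
Proof.
move=> fin h; apply: config_measure_unique => // l.
have [n hn] := cell_cyl l; have mc := measurable_cyl l.
have P (m : {measure set (config_on (after i)) -> \bar R}) :
    m (cyl l) = (\sum_(v <- bits n) m (cyl l `&` cell i v))%E.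
  rewrite (@measure_partition _ _ _ m n (fun y => obs (sites (i + 1) n) (ext y)))//.
  - rewrite big_seq [RHS]big_seq; apply: eq_bigr => v; rewrite mem_bitsE => /eqP <-; exact: erefl.
  - by move=> y; exact: obs_sites_bits.
  - by move=> v; exact: measurable_obs_comp (@measurable_ext (after i)).
rewrite !P big_seq [RHS]big_seq; apply: eq_bigr => v /hn[->|->]; first exact: h.
by rewrite !measure0.
Qed.

Hypothesis mu_bm : forall k v, bm (chain g k v).
Hypothesis chain_past : forall k v s s', (forall x, x < k -> s x = s' x) ->
  chain g k v s = chain g k v s'.

(** The two kernels arise from different functions of [u], but both give a cell its chain
    probability for the flipped past, and cells determine the measure. *)
Lemma joint_marg1 i s B : measurable B ->
  joint i (res (upto i) s) (fst @^-1` B) = marg2 i (res (upto i) (flip i s)) B.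
Proof.
move=> mB; have : marg1 i (res (upto i) s) B = marg2 i (res (upto i) (flip i s)) B.
  apply: cell_measure_unique => [||//]; first by rewrite prob_kernel ltry.
  move=> v; rewrite marg1_cell marg2_cell; congr (_%:E); apply: chain_past => x xi.
  have xu : upto i x by rewrite /upto; lia.
  by rewrite ext_res// /flip ext_res.
exact.
Qed.

Variable mu : probability Omega R.
Hypothesis mu_chain : forall k v (A : set Omega), measurable A ->
  inv_on [set x | k <= x] (\1_A : Omega -> R) ->
  Ex mu (fun s => \1_A s * (obs (sites k (size v)) s == v)%:R) =
  Ex mu (fun s => \1_A s * chain g k v s).

Lemma marg2_cond i : cond_distr mu (res (after i)) (res (upto i)) (marg2 i).
Proof.
move=> A B mA mB.
have mA' : measurable (res (upto i) @^-1` A).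
  by have := measurable_res (P := upto i) measurableT mA; rewrite setTI.
apply: (@cell_measure_unique i (slice mu (measurable_res (P := after i)) mA')
  (mixture mu (marg2 i) (measurable_res (P := upto i)) mA') _ _ B mB).
  apply: le_lt_trans (_ : _ <= 1%E)%E (ltry 1).
  rewrite -(probability_setT mu) /=; apply: le_measure; rewrite ?inE//.
  by rewrite /slice preimage_setT setIT.
move=> v; rewrite [LHS]/= [RHS]/= /slice /mixture.
set A' := _ @^-1` A in mA' *; have bA := bm_indic R mA'.
have -> : (\int[mu]_(w in A') marg2 i (res (upto i) w) (cell i v) =
    \int[mu]_(w in A') (chain g (i + 1) v w)%:E)%E.
  apply: eq_integral => w _; rewrite marg2_cell; congr (_%:E); apply: chain_past => x xi.
  by rewrite ext_res// /upto; lia.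
have EB : res (after i) @^-1` cell i v = [set s | obs (sites (i + 1) (size v)) s == v].
  by apply/seteqP; split => s; rewrite /cell /= obs_after.
have mO := measurable_obs (sites (i + 1) (size v)) v.
have bO := @bm_obs R (sites (i + 1) (size v)) v.
rewrite EB Ex_setint// -EFin_Ex; last by apply: bmM => //; exact: mu_bm.
rewrite -mu_chain//; last first.
  move=> s s' e; rewrite !indicE; congr ((nat_of_bool (_ \in A))%:R).
  by apply/res_eq => x kx; apply: e; move: kx; rewrite /= /upto; lia.
rewrite (_ : (fun s => _) = \1_(A' `&` [set s | obs (sites (i + 1) (size v)) s == v])); last first.
  apply/funext => s; rewrite !indicE -natrM mulnb in_setI; congr ((nat_of_bool (_ && _))%:R).
  by apply/idP/idP; rewrite inE.
have mI := measurableI _ _ mA' mO.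
by rewrite Ex_indic// fineK// fin_num_measure.
Qed.

Definition chain_coupling_of : coupling mu :=
  @Coupling R mu marg2 marg2_cond setT (aeW mu (fun=> I)) joint
    (fun i s B _ mB => @joint_marg1 i s B mB) (fun i s B _ mB => erefl).

End chain_coupling.

(** * Disagreement and the house-of-cards chain *)

Section disagreement.
Variables (R : realType) (g : int -> Omega -> R).
Hypothesis g01 : forall k s, 0 <= g k s <= 1.
Hypothesis mg : forall k, measurable_fun setT (g k).
Implicit Types (i k : int).

Definition dchain k j (s1 s2 : Omega) : R :=
  \sum_(A <- bits j.+1) \sum_(B <- bits j.+1)
    jchain g k A B s1 s2 * (nth false A j != nth false B j)%:R.

Lemma dchain0 k s1 s2 : dchain k 0 s1 s2 = `|g k s1 - g k s2|.
Proof.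
have B1 (f : seq bool -> R) : \sum_(v <- bits 1) f v = f [:: true] + f [:: false].
  by rewrite sum_bitsS /= !big_seq1.
rewrite /dchain !B1 /= -(jw_diff (g01 k s1) (g01 k s2)); ring.
Qed.

Lemma dchainS k j s1 s2 : dchain k j.+1 s1 s2 =
  jw (g k s1) (g k s2) true true * dchain (k + 1) j (upd s1 k true) (upd s2 k true) +
  jw (g k s1) (g k s2) true false * dchain (k + 1) j (upd s1 k true) (upd s2 k false) +
  jw (g k s1) (g k s2) false true * dchain (k + 1) j (upd s1 k false) (upd s2 k true) +
  jw (g k s1) (g k s2) false false * dchain (k + 1) j (upd s1 k false) (upd s2 k false).
Proof.
have E a b : \sum_(A <- bits j.+1) \sum_(B <- bits j.+1)
    jchain g k (a :: A) (b :: B) s1 s2 * (nth false (a :: A) j.+1 != nth false (b :: B) j.+1)%:R =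
    jw (g k s1) (g k s2) a b * dchain (k + 1) j (upd s1 k a) (upd s2 k b).
  rewrite /dchain mulr_sumr; apply: eq_bigr => A _; rewrite mulr_sumr.
  by apply: eq_bigr => B _; rewrite mulrA.
rewrite /dchain sum_bitsS -!addrA addrA; congr (_ + _).
  rewrite -!E -big_split; apply: eq_bigr => A _; exact: sum_bitsS.
rewrite -!E -big_split; apply: eq_bigr => A _; exact: sum_bitsS.
Qed.

Section return_bound.
Variable b : nat -> R.
Hypotheses (b0 : forall n, 0 <= b n) (b1 : forall n, b n <= 1).
Hypothesis b_anti : forall n, b n.+1 <= b n.
Hypothesis g_lip : forall k n s s',
  (forall x, k - n%:Z <= x < k -> s x = s' x) -> `|g k s - g k s'| <= b n.

(* probability that the house-of-cards chain, which moves from n to n + 1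
   with probability 1 - b n and to 0 otherwise, makes its (j+1)-st step to 0 *)
Fixpoint hoc j n : R :=
  if j is j'.+1 then b n * hoc j' 0 + (1 - b n) * hoc j' n.+1 else b n.

Lemma hoc_ge0 j n : 0 <= hoc j n.
Proof.
elim: j n => [|j IH] n /=; first exact: b0.
by apply: addr_ge0; apply: mulr_ge0 => //; rewrite subr_ge0.
Qed.

(** A longer stretch of agreement is reset less easily, now and later, since [b] decreases. *)
Lemma hoc_anti j n : hoc j n.+1 <= hoc j n.
Proof.
elim: j n => [|j IH] n /=; first exact: b_anti.
have h0 m : hoc j m <= hoc j 0.
  by elim: m => // m; apply: le_trans; exact: IH.
have := b_anti n; have := b1 n; have := IH n.+1; have := h0 n.+1.
move: (b n) (b n.+1) (hoc j 0) (hoc j n.+1) (hoc j n.+2) => x y z t w h1 h2 h3 h4.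
have e1 : (z - t) * (x - y) >= 0 by rewrite mulr_ge0; lra.
have e2 : (1 - y) * (t - w) >= 0 by rewrite mulr_ge0; lra.
lra.
Qed.

Lemma hoc_le0 j n : hoc j n <= hoc j 0.
Proof. by elim: n => // n; apply: le_trans; exact: hoc_anti. Qed.

(** The next spins differ with probability d <= b(n), after which the agreement restarts at 0;
    otherwise it grows to n + 1. As [hoc] is largest at 0, raising d to b(n) only increases the
    bound. *)
Lemma dchain_hoc j k n s1 s2 : (forall x, k - n%:Z <= x < k -> s1 x = s2 x) ->
  dchain k j s1 s2 <= hoc j n.
Proof.
elim: j k n s1 s2 => [|j IH] k n s1 s2 hs; first by rewrite dchain0; exact: g_lip.
rewrite dchainS /=.
have agree a : dchain (k + 1) j (upd s1 k a) (upd s2 k a) <= hoc j n.+1.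
  by apply: IH => x hx; rewrite /upd; case: eqP => // /eqP xk; apply: hs; lia.
have differ a c : dchain (k + 1) j (upd s1 k a) (upd s2 k c) <= hoc j 0.
  by apply: IH => x hx; lia.
have dn := g_lip hs; rewrite -(jw_diff (g01 k s1) (g01 k s2)) in dn.
have s11 := jw_sum1 true (g01 k s1) (g01 k s2).
have s12 := jw_sum1 false (g01 k s1) (g01 k s2).
have w0 := jw_ge0 (g k s1) (g k s2); have hh := hoc_le0 j n.+1.
move: (jw _ _) w0 s11 s12 dn => w w0 /= s11 s12 dn; set d := w true false + w false true in dn.
apply: le_trans (_ : (w true true + w false false) * hoc j n.+1 +
  d * hoc j 0 <= _).
  have h1 := ler_wpM2l (w0 true true) (agree true).
  have h2 := ler_wpM2l (w0 false false) (agree false).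
  have h3 := ler_wpM2l (w0 true false) (differ true false).
  have h4 := ler_wpM2l (w0 false true) (differ false true).
  by rewrite /d; lra.
have -> : w true true + w false false = 1 - d by rewrite /d; lra.
have : (b n - d) * (hoc j 0 - hoc j n.+1) >= 0 by rewrite mulr_ge0; lra.
lra.
Qed.

End return_bound.

Lemma joint_disagree i j y : joint mg i y (disagree i j.+1) =
  (dchain (i + 1) j (flip i (ext y)) (ext y))%:E.
Proof.
set s1 := flip i _; set s2 := ext y; pose S := sites (i + 1) j.+1.
pose h1 u := obs S (path1 g (i + 1) (start R s1 s2, u)).
pose h2 u := obs S (path2 g (i + 1) (start R s1 s2, u)).
have [m1 m2] := measurable_path_from mg (i + 1) s1 s2.
have mh1 v : measurable [set u | h1 u == v] by exact: measurable_obs_comp.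
have mh2 v : measurable [set u | h2 u == v] by exact: measurable_obs_comp.
pose D := [set u : R | nth false (h1 u) j != nth false (h2 u) j].
have nthE s : nth false (obs S s) j = s (i + j.+1%:Z).
  rewrite (nth_map 0) ?size_sites// /S (nth_map 0%N) ?size_iota// nth_iota// add0n.
  by congr (s _); lia.
have -> : joint mg i y (disagree i j.+1) = unif D.
  congr (unif _); apply/seteqP; split => u; rewrite /D /h1 /h2 /= !nthE.
    by move=> [q <-].
  have ai : after i (i + j.+1%:Z) by rewrite /after; lia.
  by move=> h; exists (exist (fun x : int => is_true (after i x)) _ ai).
have cellE A B : A \in bits j.+1 -> B \in bits j.+1 ->
    unif ([set u | h1 u == A] `&` [set u | h2 u == B]) = (jchain g (i + 1) A B s1 s2)%:E.
  rewrite !mem_bitsE => /eqP sA /eqP sB; rewrite -(unif_jcell g01) ?sA//.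
have mI v w : measurable ([set u | h1 u == v] `&` [set u | h2 u == w]) by exact: measurableI.
have DE A B : D `&` [set u | h1 u == A] `&` [set u | h2 u == B] =
    if nth false A j != nth false B j then [set u | h1 u == A] `&` [set u | h2 u == B] else set0.
  case: ifPn => h; apply/seteqP; split => u; rewrite /D /=.
  - by move=> [[_ ->] ->].
  - by move=> [/eqP -> /eqP ->].
  - by move=> [[+ /eqP e1] /eqP e2]; rewrite e1 e2 (negbTE h).
  - by [].
have mD : measurable D.
  have -> : D = \bigcup_(p in [set` allpairs pair (bits j.+1) (bits j.+1)])
      (D `&` [set u | h1 u == p.1] `&` [set u | h2 u == p.2]).
    apply/seteqP; split => [u Du|u [p _ [[]]]//].
    exists (h1 u, h2 u) => //=; apply/allpairsP; exists (h1 u, h2 u).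
    by split => //; exact: obs_sites_bits.
  apply: fin_bigcup_measurable; first exact: finite_seq.
  move=> p _; rewrite DE; case: ifP => _; [exact: mI|exact: measurable0].
rewrite (@measure_partition _ _ _ (@unif R) j.+1 h1 D)//; last by move=> u; exact: obs_sites_bits.
rewrite /dchain -sumEFin big_seq [RHS]big_seq; apply: eq_bigr => A hA.
rewrite (@measure_partition _ _ _ (@unif R) j.+1 h2)//; last 2 first.
- by move=> u; exact: obs_sites_bits.
- exact: measurableI.
rewrite -sumEFin big_seq [RHS]big_seq; apply: eq_bigr => B hB.
rewrite DE; case: ifP => _; last by rewrite measure0 mulr0.
by rewrite mulr1; exact: cellE.
Qed.

End disagreement.

(** * Renewal sequences of a transient chain *)

Section renewal.
Variables (R : realType) (b : nat -> R).
Hypotheses (b0 : forall n, 0 <= b n) (b1 : forall n, b n <= 1).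

(** [surv n k] is the probability that the chain started at [n] makes [k] steps without a step to 0;
    [ret k] is the probability that its first return from 0 to 0 occurs at step k + 1. *)
Let surv n k := \prod_(i < k) (1 - b (n + i)%N).
Let ret k := surv 0 k * b k.

(* renewal sequence: u n is the probability that the house-of-cards chain
   started at 0 is at 0 after n steps *)
Definition renew n : R := if n is j.+1 then hoc b j 0 else 1.

(** Decomposition at the first step to 0, which occurs at step k + 1. *)
Lemma hoc_renew j n :
  hoc b j n = \sum_(k < j.+1) surv n k * b (n + k)%N * renew (j - k).
Proof.
elim: j n => [|j IH] n.
  by rewrite big_ord_recl big_ord0 /= /surv big_ord0 mul1r mulr1 addn0 addr0.
rewrite big_ord_recl {1}/surv big_ord0 mul1r addn0 [LHS]/=; congr (_ + _).
rewrite IH mulr_sumr; apply: eq_bigr => k _.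
rewrite lift0 subSS addSnnS !mulrA; congr (_ * _ * _).
rewrite /surv big_ord_recl addn0; congr (_ * _).
by apply: eq_bigr => i _; rewrite lift0 addSnnS.
Qed.

Lemma renewS j : renew j.+1 = \sum_(k < j.+1) ret k * renew (j - k).
Proof. exact: hoc_renew. Qed.

Lemma renew_ge0 j : 0 <= renew j.
Proof. by case: j => [|j] /=; [exact: ler01|exact: hoc_ge0]. Qed.

Lemma surv_ge0 n k : 0 <= surv n k.
Proof. by apply: prodr_ge0 => i _; rewrite subr_ge0. Qed.

Lemma ret_ge0 k : 0 <= ret k.
Proof. by apply: mulr_ge0 => //; exact: surv_ge0. Qed.

Lemma surv_le1 n k : surv n k <= 1.
Proof. by apply: prodr_ile1 => i _; rewrite subr_ge0 b1 gerBl b0. Qed.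

Lemma ret_le k : ret k <= b k.
Proof. by apply: ler_piMl => //; exact: surv_le1. Qed.

Lemma ret_sum n : \sum_(k < n) ret k = 1 - surv 0 n.
Proof.
elim: n => [|n IH]; first by rewrite big_ord0 /surv big_ord0 subrr.
by rewrite big_ord_recr /= IH /ret /surv big_ord_recr /= add0n; ring.
Qed.

Lemma surv_ge n k : 1 - \sum_(i < k) b (n + i)%N <= surv n k.
Proof.
elim: k => [|k IH]; first by rewrite /surv !big_ord0 subr0.
rewrite big_ord_recr /= /surv big_ord_recr /= -/(surv n k).
have := surv_le1 n k; have := b0 (n + k)%N; move: IH; nra.
Qed.

Lemma surv_cat n k : surv 0 (n + k) = surv 0 n * surv n k.
Proof. by rewrite /surv big_split_ord. Qed.

(** Transience: after some [N] the sum of the reset probabilities is at most 1/2, so survival from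
    there has probability at least 1/2, and the first [N] factors are positive. *)
Lemma surv_lb (dl A : R) : 0 < dl -> (forall n, b n <= 1 - dl) ->
  (forall n, \sum_(i < n) b i <= A) -> exists2 r, 0 < r & forall n, r <= surv 0 n.
Proof.
move=> dl0 hb hA; have h0 : 0 < 1 / 2 :> R by lra.
have [N hN] := summable_tail b0 hA h0.
have lbN n : 0 < surv 0 n by apply: prodr_gt0 => i _; have := hb (0 + i)%N; lra.
exists (surv 0 N / 2); first by rewrite divr_gt0.
move=> n; apply: (@le_trans _ _ (surv 0 (n + N))); last first.
  by rewrite surv_cat ler_piMr ?surv_le1// ltW.
rewrite addnC surv_cat ler_pM2l//; apply: le_trans (surv_ge N n).
by have := hN n; lra.
Qed.

Lemma renew_conv k N :
  \sum_(j < N) (if (k <= j)%N then renew (j - k) else 0) = \sum_(m < N - k) renew m.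
Proof.
elim: N => [|N IH]; first by rewrite !big_ord0.
rewrite big_ord_recr /= IH; case: leqP => h; first by rewrite subSn// big_ord_recr.
by rewrite addr0 (_ : (N.+1 - k = N - k)%N)//; lia.
Qed.

Lemma renew_sum_mono m n : (m <= n)%N -> \sum_(j < m) renew j <= \sum_(j < n) renew j.
Proof.
move=> /subnKC <-; rewrite big_split_ord /= lerDl.
by apply: sumr_ge0 => i _; exact: renew_ge0.
Qed.

(** The expected number S of visits to 0 up to time N satisfies S <= 1 + (1 - r) S, because the
    total probability of a return is at most 1 - r. *)
Lemma renew_sum (r : R) : (forall n, r <= surv 0 n) -> 0 < r ->
  forall N, \sum_(j < N) renew j <= 1 / r.
Proof.
move=> hr r0 N; set S := \sum_(j < N) renew j.
have S0 : 0 <= S by apply: sumr_ge0 => j _; exact: renew_ge0.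
suff : S <= 1 + (1 - r) * S by rewrite ler_pdivlMr//; lra.
have rs0 : 0 <= (1 - r) * S.
  by rewrite mulr_ge0// subr_ge0; apply: le_trans (hr 0%N) (surv_le1 0 0).
case: N @S S0 rs0 => [|N] S S0 rs0; rewrite {1}/S; first by rewrite big_ord0; lra.
rewrite big_ord_recl lerD2l.
under eq_bigr do rewrite lift0 renewS.
have -> : \sum_(j < N) \sum_(k < j.+1) ret k * renew (j - k) =
    \sum_(k < N) ret k * \sum_(m < N - k) renew m.
  under [RHS]eq_bigr do rewrite -renew_conv mulr_sumr.
  rewrite exchange_big; apply: eq_bigr => j _.
  rewrite (big_ord_widen N (fun k => ret k * renew (j - k)))// big_mkcond.
  by apply: eq_bigr => k _; rewrite ltnS; case: ifP => //; rewrite mulr0.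
apply: (@le_trans _ _ (\sum_(k < N) ret k * S)).
  apply: ler_sum => k _; apply: ler_wpM2l; first exact: ret_ge0.
  by apply: renew_sum_mono; lia.
rewrite -mulr_suml ret_sum; apply: ler_wpM2r => //.
by rewrite lerD2l lerN2.
Qed.

(* In the term k of the renewal equation for j + 1, either k is at most a small
   fraction of j, and renew (j - k) is controlled by induction, or ret k is
   already of the right order. *)
Lemma renew_pow (be B dl A : R) : 0 < be -> 0 < dl -> (forall n, b n <= 1 - dl) ->
  (forall n, \sum_(i < n) b i <= A) -> (forall k, b k * k.+1%:R `^ be <= B) ->
  exists C, forall j, renew j * j.+1%:R `^ be <= C.
Proof.
move=> be0 dl0 hb hA hB; have [r r0 hr] := surv_lb dl0 hb hA.
have r1 : r <= 1 by apply: le_trans (hr 0%N) (surv_le1 0 0).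
(* [q] lies strictly between 1 - r, which bounds the return probability, and 1. As ga^be = q, an
   index with k + 1 <= (1 - ga) t leaves j - k + 1 >= ga t, and the induction hypothesis loses only
   the factor 1/q. *)
pose q := 1 - r / 2; have q0 : 0 < q by rewrite /q; lra.
pose ga := q `^ be^-1; have ga0 : 0 < ga by exact: powR_gt0.
have gaq : ga `^ be = q by rewrite /ga -powRrM mulVf ?gt_eqF// powRr1// ltW.
have ga1 : ga < 1.
  rewrite ltNge; apply/negP => h.
  have : 1 `^ be <= ga `^ be by apply: ge0_ler_powR; rewrite ?nnegrE ?(ltW be0) ?(ltW ga0).
  by rewrite powR1 gaq /q; lra.
pose de := 1 - ga; have de0 : 0 < de by rewrite /de; lra.
have D0 : 0 < de `^ be by exact: powR_gt0.
have B0 : 0 <= B by apply: le_trans (hB 0%N); rewrite mulr_ge0 ?powR_ge0.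
pose S := 1 / r; have S0 : 0 < S by rewrite divr_gt0.
have sumu := renew_sum hr r0.
(* makes (1 - r) C / q + B S / de^be <= C, as (1 - r) / q <= 1 - r / 2 *)
pose C := Num.max 1 (B / de `^ be * S / (r / 2)).
exists C; have C1 : 1 <= C by rewrite le_max lexx.
have C2 : B / de `^ be * S <= r / 2 * C.
  by rewrite [leRHS]mulrC -ler_pdivrMr ?divr_gt0// le_max lexx orbT.
have mono x y : 0 <= x -> x <= y -> x `^ be <= y `^ be.
  by move=> x0 xy; apply: ge0_ler_powR; rewrite ?nnegrE ?(ltW be0)//; apply: le_trans xy.
elim/ltn_ind => -[|j] IH; first by rewrite powR1 mulr1.
rewrite renewS mulr_suml; set t := j.+2%:R.
have t0 : 0 < t by rewrite ltr0n.
apply: (@le_trans _ _ (\sum_(k < j.+1) (ret k * (C / q) + B / de `^ be * renew (j - k)))).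
  apply: ler_sum => k _; have kj := ltn_ord k.
  have u0 := renew_ge0 (j - k); have f0 := ret_ge0 k.
  have D1 : 0 <= B / de `^ be * renew (j - k) by rewrite mulr_ge0// divr_ge0// ltW.
  have D2 : 0 <= ret k * (C / q) by rewrite mulr_ge0// divr_ge0 ?(ltW q0)//; lra.
  have split_t : k.+1%:R + (j - k).+1%:R = t.
    rewrite -natrD addSn addnS subnKC; first exact: erefl.
    by rewrite -ltnS.
  have [h|h] := lerP k.+1%:R (de * t).
    apply: (@le_trans _ _ (ret k * (C / q))); last by rewrite lerDl.
    rewrite -mulrA; apply: ler_wpM2l => //; rewrite ler_pdivlMr//.
    have jk : (j - k < j.+1)%N by rewrite ltnS leq_subr.
    apply: le_trans (IH _ jk).
    rewrite -mulrA; apply: ler_wpM2l => //; rewrite mulrC -gaq -powRM ?(ltW ga0) ?(ltW t0)//.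
    apply: mono; first by rewrite mulr_ge0// ltW.
    by move: h; rewrite /de -split_t; lra.
  apply: (@le_trans _ _ (B / de `^ be * renew (j - k))); last by rewrite lerDr.
  rewrite mulrAC; apply: ler_wpM2r => //; rewrite ler_pdivlMr//.
  apply: le_trans (hB k); rewrite -mulrA; apply: ler_pM => //.
  - by rewrite mulr_ge0 ?powR_ge0.
  - exact: ret_le.
  - rewrite mulrC -powRM ?(ltW de0) ?(ltW t0)//; apply: mono; last exact: ltW.
    by rewrite mulr_ge0// ltW.
rewrite big_split /= -mulr_suml -mulr_sumr ret_sum.
have su : \sum_(k < j.+1) renew (j - k) <= S.
  apply: le_trans (sumu j.+1); rewrite [leRHS](reindex_inj rev_ord_inj) /=.
  by apply: ler_sum => k _; rewrite subSS.
have BD : 0 <= B / de `^ be by rewrite divr_ge0// ltW.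
have h1 := ler_wpM2l BD su.
have Cq : 0 <= C / q by rewrite divr_ge0 ?(ltW q0)//; lra.
have h2 : (1 - surv 0 j.+1) * (C / q) <= (1 - r) * (C / q).
  by apply: ler_wpM2r => //; rewrite lerD2l lerN2.
have h3 : (1 - r) * (C / q) <= C * q.
  rewrite mulrA ler_pdivrMr// -mulrA mulrC; apply: ler_wpM2l; first lra.
  by rewrite /q; nra.
have EC : C = C * q + r / 2 * C by rewrite /q; ring.
rewrite [leRHS]EC; apply: lerD; first exact: le_trans h2 h3.
exact: le_trans h1 C2.
Qed.

End renewal.

(** * Sums of powers *)

Section power_series.
Variable R : realType.

(** A telescoping substitute for comparison with an integral: with y = x + 1, (y/x)^a >= 1 + a
    ln(y/x) and ln(y/x) >= 1/y. *)
Lemma pow_tail (a : R) m N : 0 < a ->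
  a * \sum_(i < N) (m + i).+2%:R `^ (- (a + 1)) <= m.+1%:R `^ (- a) - (m + N).+1%:R `^ (- a).
Proof.
move=> a0; elim: N => [|N IH]; first by rewrite big_ord0 mulr0 addn0 subrr.
rewrite big_ord_recr /= mulrDr addnS.
suff : a * (m + N).+2%:R `^ (- (a + 1)) <= (m + N).+1%:R `^ (- a) - (m + N).+2%:R `^ (- a).
  move: IH; lra.
move: {m N IH} (m + N)%N => n; set x := n.+1%:R; set y := n.+2%:R.
have x0 : 0 < x by rewrite ltr0n.
have y0 : 0 < y by rewrite ltr0n.
have yx : y = x + 1 by rewrite /y -natr1.
have xE : x `^ (- a) = y `^ (- a) * (y / x) `^ a.
  rewrite powRM ?invr_ge0 ?(ltW x0) ?(ltW y0)// [y `^ (- a)]powRN mulrA mulVf ?mul1r; last by rewrite gt_eqF// powR_gt0.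
  by rewrite -powR_inv1 ?(ltW x0)// -powRrM mulN1r.
have yE : y `^ (- (a + 1)) = y `^ (- a) * y^-1.
  rewrite opprD powRD; last by apply/implyP => _; rewrite gt_eqF.
  by rewrite powR_inv1// ltW.
rewrite xE yE -{3}(mulr1 (y `^ (- a))) -mulrBr mulrCA; apply: ler_wpM2l; first exact: powR_ge0.
have l1 : y^-1 <= ln (y / x).
  have -> : ln (y / x) = - ln (1 + - y^-1).
    rewrite -lnV; last by rewrite posrE subr_gt0 invf_lt1// yx ltrDr.
    have -> : 1 - y^-1 = x / y.
      by rewrite (_ : x = y - 1) ?mulrBl ?divff ?mul1r ?gt_eqF// yx addrK.
    by rewrite invf_div.
  rewrite lerNr; apply: le_ln1Dx.
  by rewrite ltrN2 invf_lt1// yx ltrDr.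
have -> : (y / x) `^ a = expR (a * ln (y / x)) by rewrite /powR gt_eqF// divr_gt0.
apply: le_trans (ler_wpM2l (ltW a0) l1) _; rewrite lerBrDl; exact: expR_ge1Dx.
Qed.

Lemma pow_sum (p : R) : 1 < p -> exists A, forall N, \sum_(i < N) i.+1%:R `^ (- p) <= A.
Proof.
move=> p1; have a0 : 0 < p - 1 by lra.
exists (1 + 1 / (p - 1)) => -[|N]; first by rewrite big_ord0 addr_ge0// divr_ge0// ltW.
rewrite big_ord_recl powR1 lerD2l ler_pdivlMr// mulrC.
have h := pow_tail 0 N a0; rewrite powR1 subrK in h.
apply: le_trans (le_trans _ h) _; last by rewrite gerBl powR_ge0.
by rewrite ler_pM2l//; apply: ler_sum => i _; rewrite lift0 add0n.
Qed.

End power_series.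

(** * Decay of the interaction energy *)

Section interaction_decay.
Variables (R : realType) (U : {fset int} -> Omega -> R).
Hypotheses (U_int : interaction U) (U_diam : diam_summable U).

Lemma ee_pow (al C' : R) : 1 < al -> 0 < C' ->
  (forall m : nat, (0 < m)%N ->
    (\esum_(A in [set A : {fset int} | (0 : int) \in A /\ (m < diam A)%N])
       supnorm (U A) <= (C' / m%:R `^ al)%:E)%E) ->
  exists B, forall m, ee U m * m.+1%:R `^ (al - 1) <= B.
Proof.
move=> al1 C0 hU; pose be := al - 1; have be0 : 0 < be by rewrite /be; lra.
have tM m : tt U m.+2 <= 4 * C' * m.+1%:R `^ (- al).
  have tE : (\esum_(A in [set A : {fset int} | (0 : int) \in A /\ (m.+1 < diam A)%N])
      supnorm (U A))%E = (tt U m.+2 / 4)%:E := tt_fin U_int m.+2.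
  have := hU m.+1 isT; rewrite tE lee_fin -powRN; lra.
have E m : ee U m.+2 <= 4 * C' / be * m.+1%:R `^ (- be).
  apply/ler_addgt0Pl => e e0; have [M hM] := ee_cvg U_int U_diam e0.
  have hM' := hM (m.+2 + M)%N (leq_addl _ _).
  have s : \sum_(i < M) tt U (i + m.+2).+1 = ee U m.+2 - ee U (m.+2 + M).
    rewrite -(sum_tt U_int U_diam) -[X in \sum_(X <= _ < _) _]add0n big_addn.
    by rewrite addKn big_mkord.
  have : \sum_(i < M) tt U (i + m.+2).+1 <= 4 * C' / be * m.+1%:R `^ (- be).
    apply: (@le_trans _ _ (4 * C' * \sum_(i < M) (m + i).+2%:R `^ (- (be + 1)))).
      rewrite mulr_sumr; apply: ler_sum => i _; rewrite /be subrK.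
      by rewrite (_ : (i + m.+2).+1 = (m + i).+3)//; lia.
    have h := pow_tail m M be0; rewrite -[leRHS]mulrA; apply: ler_wpM2l; first by rewrite mulr_ge0// ltW.
    rewrite ler_pdivlMl//; apply: le_trans h _.
    by rewrite gerBl powR_ge0.
  rewrite s; lra.
(* The bound [E] at m + 2 is in terms of m + 1, and m + 3 <= 3 (m + 1) produces 3^be; the second
   summand covers the arguments 0 and 1. *)
exists (4 * C' / be * 3 `^ be + ee U 0 * 2 `^ be) => m.
have e0 := ee_ge0 U 0.
have c0 : 0 <= 4 * C' / be by rewrite divr_ge0 ?(ltW be0)// mulr_ge0// ltW.
case: (ltnP m 2) => hm.
  apply: (@le_trans _ _ (ee U 0 * 2 `^ be)); last by rewrite lerDr mulr_ge0// powR_ge0.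
  apply: ler_pM; rewrite ?ee_ge0 ?powR_ge0//; first exact: ee_anti.
  by apply: ge0_ler_powR; rewrite ?nnegrE ?(ltW be0) ?ler_nat.
case: m hm => [|[|m]] // _.
apply: (@le_trans _ _ (4 * C' / be * 3 `^ be)); last by rewrite lerDl mulr_ge0// powR_ge0.
apply: (@le_trans _ _ (4 * C' / be * m.+1%:R `^ (- be) * m.+3%:R `^ be)).
  by apply: ler_wpM2r; [exact: powR_ge0|exact: E].
rewrite -mulrA; apply: ler_wpM2l => //; rewrite powRN ler_pdivrMl ?powR_gt0//.
rewrite -powRM//; apply: ge0_ler_powR; rewrite ?nnegrE ?(ltW be0) ?mulr_ge0//.
by rewrite -natrM ler_nat; lia.
Qed.

End interaction_decay.

(** * The coupling for a Gibbs measure with decaying interaction *)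

Section part2.
Variables (R : realType) (U : {fset int} -> Omega -> R) (mu : probability Omega R).
Hypotheses (U_int : interaction U) (U_diam : diam_summable U) (mu_gibbs : gibbs U mu).

Lemma gg01 k s : 0 <= gg U k s <= 1.
Proof.
have := gb_ge0 U_int U_diam true k s; have := gb_ge0 U_int U_diam false k s.
by rewrite /bern => h1 h2; apply/andP; split; lra.
Qed.

Lemma gg_diff k s s' : `|gg U k s - gg U k s'| <= 1 - 2 * dlt U.
Proof.
have H (d x y : R) : d <= x -> d <= 1 - x -> d <= y -> d <= 1 - y -> `|x - y| <= 1 - 2 * d.
  by rewrite ler_norml => *; apply/andP; split; lra.
by apply: H; [apply: (gb_ge U_int U_diam true)|apply: (gb_ge U_int U_diam false)
             |apply: (gb_ge U_int U_diam true)|apply: (gb_ge U_int U_diam false)].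
Qed.

Definition gibbs_coupling : coupling mu :=
  chain_coupling_of gg01 (measurable_gg U_int U_diam) (bm_chain U_int U_diam)
    (@chain_inv _ _ U_int U_diam) (chain_mu U_int U_diam mu_gibbs).

(** The bound by [ee] gives the decay, and the one by ellipticity keeps the reset probability away
    from 1, so that the house-of-cards chain escapes with positive probability. *)
Definition reset n : R := Num.min (1 - 2 * dlt U) (ee U n).

Lemma dlt_le2 : 2 * dlt U <= 1.
Proof.
have := pb_ge U_int true 0 0 (fun=> false); have := pb_ge U_int false 0 0 (fun=> false).
by rewrite /pb; lra.
Qed.

Lemma reset_ge0 n : 0 <= reset n.
Proof. by rewrite le_min ee_ge0 andbT subr_ge0 dlt_le2. Qed.

Lemma reset_le n : reset n <= 1 - 2 * dlt U.
Proof. by rewrite ge_min lexx. Qed.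

Lemma reset_le1 n : reset n <= 1.
Proof. by apply: le_trans (reset_le n) _; have := dlt_gt0 U; lra. Qed.

Lemma reset_anti n : reset n.+1 <= reset n.
Proof. by apply: le_min2; rewrite ?lexx// ee_anti. Qed.

Lemma gg_reset k n (s s' : Omega) :
  (forall x, k - n%:Z <= x < k -> s x = s' x) -> `|gg U k s - gg U k s'| <= reset n.
Proof. by move=> h; rewrite le_min gg_diff gg_lip. Qed.

(** The pasts differ at [i], immediately to the left of the first coupled site, so the comparison
    chain starts from 0. *)
Lemma Theta_reset j : (Theta gibbs_coupling j.+1 <= (renew reset j.+1)%:E)%E.
Proof.
apply: ge_ereal_sup => _ [i [s _ ->]].
rewrite [X in (X <= _)%E](joint_disagree gg01) lee_fin.
apply: (@dchain_hoc _ _ gg01 _ reset_le1 reset_anti gg_reset j (i + 1) 0).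
by move=> x; lia.
Qed.

Lemma coupling_part : (exists alpha : R, exists2 C' : R, 3 < alpha /\ 0 < C' &
      forall m : nat, (0 < m)%N ->
        (\esum_(A in [set A : {fset int} | (0 : int) \in A /\ (m < diam A)%N])
           supnorm (U A) <= (C' / m%:R `^ alpha)%:E)%E) ->
   exists K : coupling mu, exists2 q : R, 2 < q & (Theta_norm K q < +oo)%E.
Proof.
move=> [al [C' [al3 C0] hU]]; pose be := al - 1; have be2 : 2 < be by rewrite /be; lra.
have al1 : 1 < al by lra.
have [B hB] := ee_pow U_int U_diam al1 C0 hU; rewrite -/be in hB.
have be1 : 1 < be by lra.
have be0 : 0 < be by lra.
have hr k : reset k * k.+1%:R `^ be <= B.
  by apply: le_trans (hB k); apply: ler_wpM2r; [exact: powR_ge0|rewrite ge_min lexx orbT].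
have B0 : 0 <= B.
  by apply: le_trans (hr 0%N); rewrite mulr_ge0 ?powR_ge0 ?reset_ge0.
have [A hA] := pow_sum be1.
have sumr N : \sum_(i < N) reset i <= B * A.
  apply: (@le_trans _ _ (\sum_(i < N) B * i.+1%:R `^ (- be))).
    apply: ler_sum => i _; rewrite powRN ler_pdivlMr ?powR_gt0//.
  by rewrite -mulr_sumr; apply: ler_wpM2l.
have d0 : 0 < 2 * dlt U by rewrite mulr_gt0// dlt_gt0.
have [C hC] := renew_pow reset_ge0 reset_le1 be0 d0 reset_le sumr hr.
(* [q] is the midpoint of 2 and be = alpha - 1 > 2; then Theta(j)^(1/q) is of order j^(-be/q) with
   be/q > 1. *)
exists gibbs_coupling; pose q := (be + 2) / 2; have q2 : 2 < q by rewrite /q; lra.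
exists q => //; have q0 : 0 < q by lra.
have p1 : 1 < be / q by rewrite ltr_pdivlMr// /q; lra.
have [A' hA'] := pow_sum p1.
have C1 : 0 <= C by apply: le_trans (hC 0%N); rewrite mulr_ge0 ?powR_ge0 ?renew_ge0//; [exact: reset_ge0|exact: reset_le1].
pose D := C `^ q^-1.
have term j : (Theta gibbs_coupling j.+1 `^ q^-1 <= (D * j.+1%:R `^ (- (be / q)))%:E)%E.
  have T0 := ThR_ge0 U_int U_diam mu_gibbs gibbs_coupling j.+1.
  have TE := ThR_fin U_int U_diam mu_gibbs gibbs_coupling j.+1.
  rewrite TE poweR_EFin lee_fin.
  have hT : ThR gibbs_coupling j.+1 <= C * j.+1%:R `^ (- be).
    apply: (@le_trans _ _ (renew reset j.+1)); first by rewrite -lee_fin -TE Theta_reset.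
    rewrite powRN ler_pdivlMr ?powR_gt0//; apply: le_trans (hC j.+1).
    apply: ler_wpM2l; first by apply: renew_ge0; [exact: reset_ge0|exact: reset_le1].
    by apply: ge0_ler_powR; rewrite ?nnegrE ?(ltW be0)// ler_nat.
  have -> : D * j.+1%:R `^ (- (be / q)) = (C * j.+1%:R `^ (- be)) `^ q^-1.
    by rewrite powRM ?powR_ge0// -powRrM mulNr.
  by apply: ge0_ler_powR; rewrite ?nnegrE ?invr_ge0 ?(ltW q0)// mulr_ge0 ?powR_ge0.
apply: (@le_lt_trans _ _ (D * A')%:E); last exact: ltry.
apply: lime_le; first by apply: is_cvg_nneseries => n _ _; exact: poweR_ge0.
near=> N; case: (N) => [|n].
  by rewrite big_geq// lee_fin mulr_ge0 ?powR_ge0//; have := hA' 0%N; rewrite big_ord0.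
rewrite big_add1 /= big_mkord; apply: (@le_trans _ _ (\sum_(i < n) (D * i.+1%:R `^ (- (be / q)))%:E)%E).
  by apply: lee_sum => i _; exact: term.
by rewrite sumEFin lee_fin -mulr_sumr; apply: ler_wpM2l; rewrite ?powR_ge0.
Unshelve. all: by end_near. Qed.

End part2.

Theorem theorem5p1 (R : realType) (U : {fset int} -> Omega -> R)
    (mu : probability Omega R)
    (U_interaction : interaction U)
    (U_diam : diam_summable U)
    (mu_gibbs : gibbs U mu) :
  (forall q : R, 2 < q ->
     exists2 C : R, 0 < C &
       forall K : coupling mu, (Theta_norm K q < +oo)%E ->
       forall f : Omega -> R, measurable_fun setT f -> bounded_fun f ->
         ('V_mu[f] <=
            C%:E * (1 + Theta_norm K q ^+ 2) * dirichlet mu f)%E)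
  /\
  ((exists alpha : R, exists2 C' : R, 3 < alpha /\ 0 < C' &
      forall m : nat, (0 < m)%N ->
        (\esum_(A in [set A : {fset int} | (0 : int) \in A /\ (m < diam A)%N])
           supnorm (U A) <= (C' / m%:R `^ alpha)%:E)%E) ->
   exists K : coupling mu, exists2 q : R, 2 < q & (Theta_norm K q < +oo)%E).
Proof.
split; first exact: (poincare_part U_interaction U_diam mu_gibbs).
exact: (coupling_part U_interaction U_diam mu_gibbs).
Qed.
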